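(* For every fixed density $d\in(\frac13,1)$ there exists $C>0$ such that for every $0<\varepsilon\le\frac12$, asymptotically almost surely (as $m\to\infty$) a random group in the triangular density model $\mathcal M(m,d)$ has property $FL^p_{(2-2\varepsilon)^{1/(2p)}}$ for every $p\in\left[2,\,C\left(\frac{\log m}{\log\log m}\right)^{1/2}\right]$. In particular, asymptotically almost surely it has $FL^p$ for all $p$ in this range.
   Context: Triangular density model $\mathcal M(m,d)$, $d\in(0,1)$: for a fixed set of generators $S$ with $|S|=m$, a set $R$ of $(2m-1)^{3d}$ relators (rounded to the nearest integer) is chosen uniformly at random among all subsets of this cardinality of the set of cyclically reduced words of length 3 in $S\cup S^{-1}$; the random group is $\Gamma=\langle S\mid R\rangle$. A property holds asymptotically almost surely (a.a.s.) if its probability tends to $1$ as $m\to\infty$. Let $p\in(0,\infty)$, $L\ge1$, $n_0\in\mathbb N$. A Banach space has $L$-bi-Lipschitz $L^p$ geometry above dimension $n_0$ if every $n_0$-dimensional subspace of it is contained in a subspace that is $L$-bi-Lipschitz equivalent either to $\ell^p_n$ ($\mathbb R^n$ with the $p$-norm) for some $n\ge n_0$, or to $\ell^p_\infty$ (the space of $p$-summable sequences), or to some space $L^p(X,\mu)$. Here two spaces are $L$-bi-Lipschitz equivalent if there is a bijection $F$ between them with $L^{-1}\|u-v\|\le\|F(u)-F(v)\|\le L\|u-v\|$ for all $u,v$. If this holds for every $n_0$, the Banach space has $L$-bi-Lipschitz $L^p$ geometry in finite dimension. A (topological) group $\Gamma$ has property $FL^p_L$ if every affine isometric continuous action of $\Gamma$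 on a Banach space with $L$-bi-Lipschitz $L^p$ geometry in finite dimension has a global fixed point (continuity means that all orbit maps are continuous; the random groups are discrete). $\Gamma$ has property $FL^p$ if every affine isometric continuous action of $\Gamma$ on a space $L^p(X,\mu)$ has a global fixed point. *)

(* Defs.v *)
From HB Require Import structures.
From mathcomp Require Import all_boot all_order all_algebra.
From mathcomp Require Import all_classical all_reals all_analysis.
From mathcomp Require Import measurable_realfun ess_sup_inf.
Set Implicit Arguments.
Unset Strict Implicit.
Unset Printing Implicit Defensive.
Import Order.TTheory GRing.Theory Num.Theory.
Import numFieldNormedType.Exports.
Local Open Scope classical_set_scope.
Local Open Scope ring_scope.

(* Words over S and its formal inverses: (s, false) stands for s and (s, true) *)
(* for s^-1.                                                                   *)
Notation letter S := (S * bool)%type.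

Definition letter_inv (S : Type) (a : letter S) : letter S := (a.1, ~~ a.2).

(* [cycle] also compares the last letter with the first one.                   *)
Definition cyclically_reduced (S : eqType) (w : seq (letter S)) : bool :=
  cycle (fun a b => b != letter_inv a) w.

Section Presentation.
Variables (S : choiceType) (rels : set (seq (letter S))).

Inductive word_equiv : seq (letter S) -> seq (letter S) -> Prop :=
| word_equiv_refl u : word_equiv u u
| word_equiv_sym u v : word_equiv u v -> word_equiv v u
| word_equiv_trans u v w : word_equiv u v -> word_equiv v w -> word_equiv u w
| word_equiv_cancel u v a : word_equiv (u ++ a :: letter_inv a :: v) (u ++ v)
| word_equiv_rel u v r : rels r -> word_equiv (u ++ r ++ v) (u ++ v).

Lemma word_equiv_cat u u' v v' :
  word_equiv u u' -> word_equiv v v' -> word_equiv (u ++ v) (u' ++ v').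
Proof.
move=> uu' vv'; apply: (@word_equiv_trans _ (u' ++ v)).
- elim: uu' => {u u'} [u|u w _ ih|u w x _ ih1 _ ih2|u w a|u w r rr].
  + exact: word_equiv_refl.
  + exact: word_equiv_sym.
  + exact: word_equiv_trans ih1 ih2.
  + by rewrite -!catA /=; exact: word_equiv_cancel.
  + by rewrite -!catA; exact: word_equiv_rel.
- elim: vv' => {v v'} [w|v w _ ih|v w x _ ih1 _ ih2|v w a|v w r rr].
  + exact: word_equiv_refl.
  + exact: word_equiv_sym.
  + exact: word_equiv_trans ih1 ih2.
  + by rewrite !catA; exact: word_equiv_cancel.
  + by rewrite !(catA u'); exact: word_equiv_rel.
Qed.

Definition word_eq u v : bool := `[< word_equiv u v >].

Lemma word_eq_is_equiv : equiv_class_of word_eq.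
Proof.
split=> [u|u v|v u w].
- exact/asboolP/word_equiv_refl.
- by apply/idP/idP => /asboolP /word_equiv_sym /asboolP.
- by move=> /asboolP uv /asboolP vw; apply/asboolP/(word_equiv_trans uv vw).
Qed.

Canonical word_eq_equiv := EquivRelPack word_eq_is_equiv.
Canonical word_eq_encModRel := defaultEncModRel word_eq.

Definition presented : Type := {eq_quot word_eq}%qT.
HB.instance Definition _ := Choice.on presented.
HB.instance Definition _ := EqQuotient.on presented.

Local Open Scope quotient_scope.

Definition word_inv (w : seq (letter S)) := rev (map (@letter_inv S) w).

Definition presented_one : presented := \pi_presented [::].
Definition presented_mul (x y : presented) : presented :=
  \pi_presented (repr x ++ repr y).
Definition presented_inv (x : presented) : presented := \pi_presented (word_inv (repr x)).

Lemma presented_piP u v :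
  \pi_presented u = \pi_presented v <-> word_equiv u v.
Proof. by split=> [/eqquotP /asboolP //|uv]; apply/eqquotP/asboolP. Qed.

Lemma presented_reprP u : word_equiv (repr (\pi_presented u)) u.
Proof. by apply/presented_piP; rewrite reprK. Qed.

Lemma presented_mulA : associative presented_mul.
Proof.
move=> x y z; apply/presented_piP.
apply: (@word_equiv_trans _ (repr x ++ (repr y ++ repr z))).
  by apply: word_equiv_cat (word_equiv_refl _) _; exact: presented_reprP.
rewrite catA; apply: word_equiv_cat (word_equiv_refl _).
exact/word_equiv_sym/presented_reprP.
Qed.

Lemma presented_mul1g : left_id presented_one presented_mul.
Proof.
move=> x; rewrite -[RHS]reprK; apply/presented_piP.
exact: word_equiv_cat (presented_reprP [::]) (word_equiv_refl _).
Qed.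

Lemma presented_mulg1 : right_id presented_one presented_mul.
Proof.
move=> x; rewrite -[RHS]reprK; apply/presented_piP; rewrite -[X in word_equiv _ X]cats0.
exact: word_equiv_cat (word_equiv_refl _) (presented_reprP [::]).
Qed.

Lemma word_invK : involutive word_inv.
Proof.
move=> w; rewrite /word_inv map_rev revK -map_comp map_id_in// => -[s b] _ /=.
by rewrite /letter_inv /= negbK.
Qed.

Lemma word_mulgV w : word_equiv (w ++ word_inv w) [::].
Proof.
elim: w => [|a w ih]; first exact: word_equiv_refl.
rewrite /word_inv /= rev_cons -rcons_cat -cats1 -cat1s.
apply: (word_equiv_trans
  (word_equiv_cat (word_equiv_refl [:: a])
    (word_equiv_cat ih (word_equiv_refl [:: letter_inv a])))).
exact: (@word_equiv_cancel [::] [::] a).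
Qed.

Lemma presented_mulgV : right_inverse presented_one presented_inv presented_mul.
Proof.
move=> x; apply/presented_piP; apply: word_equiv_trans (word_mulgV (repr x)).
exact: word_equiv_cat (word_equiv_refl _) (presented_reprP _).
Qed.

Lemma presented_mulVg : left_inverse presented_one presented_inv presented_mul.
Proof.
move=> x; apply/presented_piP.
apply: word_equiv_trans (word_mulgV (word_inv (repr x))); rewrite word_invK.
exact: word_equiv_cat (presented_reprP _) (word_equiv_refl _).
Qed.

HB.instance Definition _ := isGroup.Build presented presented_mulA
  presented_mul1g presented_mulg1 presented_mulVg presented_mulgV.

End Presentation.

Section TriangularModel.
Variable R : realType.

(* (2m-1)^(3d) rounded to the nearest integer, halves being rounded up.        *)
Definition relator_count (m : nat) (d : R) : nat :=
  Num.truncn ((2 * m%:R - 1) `^ (3 * d) + 2^-1).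

Definition relator_sets (m : nat) (d : R) :
    {set {set 3.-tuple (letter 'I_m)}} :=
  [set E : {set 3.-tuple (letter 'I_m)} |
    (E \subset [set w : 3.-tuple (letter 'I_m) | cyclically_reduced w])
    && (#|E| == relator_count m d)]%SET.

Definition random_group (m : nat) (E : {set 3.-tuple (letter 'I_m)}) :
  groupType := presented [set tval w | w in [set` E]].

(* The relator set is uniformly distributed on [relator_sets m d].             *)
Definition triangular_prob (m : nat) (d : R) (P : groupType -> Prop) : R :=
  #|[set E in relator_sets m d | `[< P (random_group E) >]]%SET|%:R
  / #|relator_sets m d|%:R.

Definition aas (d : R) (P : nat -> groupType -> Prop) : Prop :=
  triangular_prob m d (P m) @[m --> \oo] --> (1 : R).

End TriangularModel.

(* The library only provides the type of p-integrable functions, its Lspace    *)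
(* being a bare type without vector space structure.                           *)
Section LpSpace.
Context d (T : measurableType d) (R : realType).
Variables (mu : {measure set T -> \bar R}) (p : \bar R) (p1 : (1 <= p)%E).

Definition ae_null : {pred LfunType mu p1} :=
  fun f => `[< (f : T -> R) = cst 0 %[ae mu] >].

Lemma ae_null_zmod_closed : zmod_closed ae_null.
Proof.
split=> [|f g /asboolP f0 /asboolP g0]; apply/asboolP.
  by apply: nearW.
move: f0 g0; apply: filterS2 => x /(_ I) f0 /(_ I) g0 _.
by change (f x - g x = 0); rewrite f0 g0 subrr.
Qed.

HB.instance Definition _ :=
  GRing.isZmodClosed.Build (LfunType mu p1) ae_null ae_null_zmod_closed.

Definition Lp : Type := Quotient.quot ae_null.
HB.instance Definition _ := GRing.Zmodule.on Lp.
HB.instance Definition _ := EqQuotient.on Lp.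

Local Open Scope quotient_scope.

Definition Lp_scale (a : R) (x : Lp) : Lp := \pi_Lp (a *: repr x).
Definition Lp_norm (x : Lp) : R := fine ('N[mu]_p[EFin \o repr x])%E.

Lemma Lp_piP (f g : LfunType mu p1) :
  \pi_Lp f = \pi_Lp g <-> (f : T -> R) = g %[ae mu].
Proof.
split=> [/eqP|fg].
  rewrite -Quotient.idealrBE => /asboolP; apply: filterS => x /(_ I) fg0 _.
  by apply/eqP; rewrite -subr_eq0; apply/eqP.
apply/eqP; rewrite -Quotient.idealrBE; apply/asboolP.
move: fg; apply: filterS => x /(_ I) fg _.
by change (f x - g x = 0); rewrite fg subrr.
Qed.

Lemma Lp_reprP (f : LfunType mu p1) :
  (repr (\pi_Lp f) : T -> R) = f %[ae mu].
Proof. by apply/Lp_piP; rewrite reprK. Qed.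

Lemma ae_eq_Lnorm (f g : T -> R) :
  measurable_fun setT f -> measurable_fun setT g -> f = g %[ae mu] ->
  ('N[mu]_p[EFin \o f] = 'N[mu]_p[EFin \o g])%E.
Proof.
have mpow (h : T -> R) r : measurable_fun setT h ->
    measurable_fun setT (fun x => `|(EFin \o h) x| `^ r)%E.
  move=> mh; apply: (@measurableT_comp _ _ _ _ _ _ (fun x => x `^ r)%E).
    exact: (measurableT_comp (measurable_poweR _)).
  apply: measurableT_comp => //; exact/measurable_EFinP.
move=> mf mg fg; rewrite unlock /Lnorm; case: p p1 => [r r1|oo1|//].
  congr (_ `^ _)%E; apply: ae_eq_integral => //; [exact: mpow|exact: mpow|].
  by move: fg; apply: filterS => x /(_ I) /= -> _.
case: ifPn => // _; apply: eq_ess_sup.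
by move: fg; apply: filterS => x /(_ I) /= ->.
Qed.

Lemma Lp_norm_pi (f : LfunType mu p1) :
  Lp_norm (\pi_Lp f) = fine ('N[mu]_p[EFin \o f])%E.
Proof. by rewrite /Lp_norm; congr fine; apply: ae_eq_Lnorm => //; exact: Lp_reprP. Qed.

Lemma Lp_scale_pi a (f : LfunType mu p1) :
  Lp_scale a (\pi_Lp f) = \pi_Lp (a *: f).
Proof.
apply/Lp_piP; move: (Lp_reprP f); apply: filterS => x /(_ I) fE _.
by change (a * repr (\pi_Lp f) x = a * f x); rewrite fE.
Qed.

Lemma LpW (P : Lp -> Prop) : (forall f, P (\pi_Lp f)) -> forall x, P x.
Proof. by move=> Pf x; rewrite -[x]reprK. Qed.

Lemma Lp_piD (f g : LfunType mu p1) :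
  \pi_Lp (f + g) = \pi_Lp f + \pi_Lp g.
Proof. exact: Quotient.pi_add. Qed.

Lemma Lp_scaleA a b x : Lp_scale a (Lp_scale b x) = Lp_scale (a * b) x.
Proof. by elim/LpW: x => f; rewrite !Lp_scale_pi scalerA. Qed.

Lemma Lp_scale1 : left_id 1 Lp_scale.
Proof. by elim/LpW=> f; rewrite Lp_scale_pi scale1r. Qed.

Lemma Lp_scaleDr : right_distributive Lp_scale +%R.
Proof.
move=> a; elim/LpW=> f; elim/LpW=> g.
by rewrite -Lp_piD !Lp_scale_pi scalerDr Lp_piD.
Qed.

Lemma Lp_scaleDl x : {morph Lp_scale^~ x : a b / a + b}.
Proof.
move=> a b; elim/LpW: x => f.
by rewrite !Lp_scale_pi scalerDl Lp_piD.
Qed.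

HB.instance Definition _ := GRing.Zmodule_isLmodule.Build R Lp
  Lp_scaleA Lp_scale1 Lp_scaleDr Lp_scaleDl.

Lemma Lp_normD x y : Lp_norm (x + y) <= Lp_norm x + Lp_norm y.
Proof.
elim/LpW: x => f; elim/LpW: y => g.
by rewrite -Lp_piD !Lp_norm_pi; exact: ler_LnormD.
Qed.

Lemma Lp_normZ (a : R) (x : Lp) : Lp_norm (a *: x) = `|a| * Lp_norm x.
Proof.
elim/LpW: x => f.
rewrite [a *: _]Lp_scale_pi !Lp_norm_pi; apply: EFin_inj.
by rewrite EFinM !finite_norm_fine; exact: LnormZ.
Qed.

Lemma Lp_norm_eq0 x : Lp_norm x = 0 -> x = 0.
Proof.
elim/LpW: x => f; rewrite Lp_norm_pi => /fine_Lnormr_eq0 f0.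
have <- : \pi_Lp 0 = 0 by apply: (addrI (\pi_Lp 0)); rewrite -Lp_piD !addr0.
exact/Lp_piP.
Qed.

HB.instance Definition _ :=
  Lmodule_isNormed.Build R Lp Lp_normD Lp_normZ Lp_norm_eq0.

End LpSpace.

Section LpGeometry.
Variable R : realType.

Definition bilipschitz_equiv (L : R) (U V : zmodType) (normU : U -> R)
    (normV : V -> R) (A : set U) (B : set V) : Prop :=
  exists2 F : U -> V, set_bij A B F &
    forall u v, A u -> A v ->
      L^-1 * normU (u - v) <= normV (F u - F v) <= L * normU (u - v).

Definition lp_norm (p : R) (n : nat) (x : 'rV[R]_n) : R :=
  (\sum_(i < n) `|x 0 i| `^ p) `^ p^-1.

Definition lp_seq (p : R) : set (nat -> R) :=
  [set u | cvgn (series (fun k => `|u k| `^ p))].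

Definition lp_seq_norm (p : R) (u : nat -> R) : R :=
  (limn (series (fun k => `|u k| `^ p))) `^ p^-1.

(* {vspace V} and [free] need a finite-dimensional V.                          *)
Definition linearly_independent (V : lmodType R) (n : nat) (e : 'I_n -> V) :
    Prop :=
  forall c : 'I_n -> R, \sum_i c i *: e i = 0 -> forall i, c i = 0.

Definition has_dimension (V : lmodType R) (n : nat) (W : {pred V}) : Prop :=
  exists2 e : 'I_n -> V, linearly_independent e &
    forall v, v \in W <-> exists c : 'I_n -> R, v = \sum_i c i *: e i.

(* The p-norm is a norm, hence L^p is a normed space, only for 1 <= p.         *)
Variables (p : R) (p1 : (1 <= p%:E)%E).

Definition bilipschitz_to_Lp (L : R) (n0 : nat) (V : normedModType R)
    (W : {pred V}) : Prop :=
  let equiv_to (U : zmodType) (normU : U -> R) (B : set U) :=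
    bilipschitz_equiv L (fun v : V => `|v|) normU [set` W] B in
  [\/ exists2 n : nat, (n0 <= n)%N & equiv_to _ (@lp_norm p n) setT,
      equiv_to _ (lp_seq_norm p) (lp_seq p)
    | exists (d : measure_display) (T : measurableType d)
        (mu : {measure set T -> \bar R}),
        equiv_to (Lp mu p1) (fun x => `|x|) setT].

Definition Lp_geometry_above (L : R) (n0 : nat) (V : normedModType R) : Prop :=
  forall E : {pred V}, has_dimension n0 E ->
    exists W : {pred V},
      [/\ submod_closed W, {subset E <= W} & bilipschitz_to_Lp L n0 W].

Definition Lp_geometry (L : R) (V : normedModType R) : Prop :=
  forall n0 : nat, Lp_geometry_above L n0 V.

Definition affine_isometric_action (G : groupType) (V : normedModType R)
    (alpha : G -> V -> V) : Prop :=
  [/\ forall v, alpha 1%g v = v,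
      forall g h v, alpha (g * h)%g v = alpha g (alpha h v),
      forall g, exists (f : {linear V -> V}) (b : V),
        (forall v, `|f v| = `|v|) /\ forall v, alpha g v = f v + b
    & forall v, continuous (fun g : discrete_topology G => alpha g v)].

Definition has_fixed_point (G : groupType) (V : normedModType R)
    (alpha : G -> V -> V) : Prop :=
  exists v, forall g, alpha g v = v.

Definition FLpL (L : R) (G : groupType) : Prop :=
  forall V : completeNormedModType R, Lp_geometry L V ->
  forall alpha : G -> V -> V,
    affine_isometric_action alpha -> has_fixed_point alpha.

Definition FLp (G : groupType) : Prop :=
  forall (d : measure_display) (T : measurableType d)
    (mu : {measure set T -> \bar R}) (alpha : G -> Lp mu p1 -> Lp mu p1),
    affine_isometric_action alpha -> has_fixed_point alpha.

End LpGeometry.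

Lemma ge2_ge1 (R : realType) (p : R) : 2 <= p -> (1 <= p%:E)%E.
Proof. by rewrite lee_fin; apply: le_trans; rewrite ler1n. Qed.

(* Main.v *)
Require Import Defs.
From HB Require Import structures.
From mathcomp Require Import all_boot all_order all_algebra.
From mathcomp Require Import all_classical all_reals all_analysis.
From mathcomp Require Import measurable_realfun ring lra zify.
Set Implicit Arguments.
Unset Strict Implicit.
Unset Printing Implicit Defensive.
Import Order.TTheory GRing.Theory Num.Theory.
Import numFieldNormedType.Exports.
Local Open Scope classical_set_scope.
Local Open Scope ring_scope.

(** Let a group generated by a symmetric finite family of letters act by affine
isometries, and let the energy of a vector v be the sum of |x v - v|^p over the
letters x.  For any point c put w = (v + c) / 2.  Then
x w - w = ((x v - c) + (x c - v)) / 2 and |x c - v| = |x^-1 v - c|, so the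
convexity of t^p and the symmetry x <-> x^-1 bound the energy of w by the sum of
|x v - c|^p.  It is thus enough to find a c to which the points x v are close
in p-mean: if that sum is at most r times the energy of v with r < 1, iterating
v -> w gives a geometrically convergent sequence whose limit is fixed
([fixed_point_of_poincare]).

The relators supply c.  A relator a b y = 1 says that x = a^-1 satisfies
x = b y, hence |x v - b v| = |y v - v|.  Let A x b be the number of relators
whose first corner leads from x = a^-1 to b.  As each letter is the third letter
of about D relators, the sum of A x y |x v - y v|^p is at most about D times the
energy of v.  What is left is a Poincare inequality for the weights A, bounding
the sum of A x y |F x - F y|^p from below by kappa times the sum of
|F x - c|^p, with some kappa > D.

For real-valued F and weights that are close to the constant D / n in the sense
of discrepancy, n being the number of letters, this holds with kappa close to
2 D, for every p >= 2 ([quasirandom_poincare]).  The reason is the inequality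
  |a - b|^p >= |a|^p + |b|^p - p a b max (|a|, |b|)^(p - 2).
Summed against A, the first two terms give 2 D times the sum of |f|^p by
regularity.  The last one, averaged over all pairs, has the right sign when f
has mean zero: max is the sum minus the min, the sum contributes zero, and the
min kernel is positive semidefinite.  Replacing A by the constant costs little,
because after rounding f to geometrically spaced values this last term is
constant on few blocks, on each of which the discrepancy applies; the loss is
the discrepancy times exp (O (p^2 / eps)).

Applied coordinate by coordinate, the scalar inequality passes to finite sums,
series and integrals of p-th powers, hence to l^p and L^p; a bi-Lipschitz change
of norm with constant L divides kappa by L^(2 p).  This is at most 2 - 2 eps
here, and so there is room left below 2 ([good_relators_FLp]).

Finally, a uniformly chosen set of N relators meets a fixed set of words in a
hypergeometric number of points, which obeys a Chernoff bound.  A union bound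
over all pairs of sets of letters gives the discrepancy ([bad_draws_le]).  Since
D is about m^(3 d - 1), a positive power of m for d > 1/3, the relative
discrepancy can be taken to be a negative power of m, which beats
exp (O (p^2 / eps)) as soon as p^2 = o (log m). *)

(** * A lower bound for the p-th power of a difference *)

(** Splitting one factor off, (x + y)^q = x (x + y)^(q - 1) + y (x + y)^(q - 1),
and x + y dominates both x and y. *)
Lemma powR_superadd (R : realType) (q x y : R) : 1 <= q -> 0 <= x -> 0 <= y ->
  x `^ q + y `^ q <= (x + y) `^ q.
Proof.
move=> q1 x0 y0; have q0 : 0 < q by apply: lt_le_trans q1.
rewrite -[x `^ q]mulr_powRB1// -[y `^ q]mulr_powRB1// -[(x + y) `^ q]mulr_powRB1 ?addr_ge0//.
rewrite mulrDl; apply: lerD; apply: ler_wpM2l => //;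
  (apply: ge0_ler_powR; [by rewrite subr_ge0|by rewrite nnegrE ?addr_ge0..|lra]).
Qed.

(** Young's inequality for the product of (1 + q x)^(1/q) and 1, with exponents
q and its conjugate, says that (1 + q x)^(1/q) <= 1 + x. *)
Lemma powR_bernoulli (R : realType) (q x : R) : 1 <= q -> -1 <= x ->
  1 + q * x <= (1 + x) `^ q.
Proof.
move=> q1 x1; have q0 : 0 < q by apply: lt_le_trans q1.
have [q_eq1|q_neq1] := eqVneq q 1; first by rewrite q_eq1 mul1r powRr1//; lra.
have [/le_trans|qx] := leP (1 + q * x) 0; first by apply; exact: powR_ge0.
have q2 : 0 < (1 - q^-1).
  rewrite subr_gt0 invf_lt1// lt_neqAle q1 andbT; by rewrite eq_sym.
have := @conjugate_powR R ((1 + q * x) `^ q^-1) 1 q (1 - q^-1)^-1 (powR_ge0 _ _) ler01.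
rewrite !invrK invr_gt0 => /(_ q0 q2 (subrKC _ _)).
rewrite -powRrM mulVf ?gt_eqF// powRr1 ?(ltW qx)// powR1 /= mulr1 => h.
have {}h : (1 + q * x) `^ q^-1 <= 1 + x.
  apply: le_trans h _; rewrite le_eqVlt; apply/orP; left; apply/eqP; field; lra.
have -> : 1 + q * x = ((1 + q * x) `^ q^-1) `^ q.
  by rewrite -powRrM mulVf ?gt_eqF// powRr1// ltW.
by apply: ge0_ler_powR; rewrite ?nnegrE ?powR_ge0//; lra.
Qed.

(** What |a - b|^p may lack from |a|^p + |b|^p.  For p = 2 it is exactly 2 a b; for
larger p the maximum is what makes the sum over all pairs accessible, through
max = sum - min. *)
Definition cross_term (R : realType) (p a b : R) : R :=
  p * (a * b * Num.max (`|a| `^ (p - 2)) (`|b| `^ (p - 2))).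

Lemma cross_termC (R : realType) (p a b : R) : cross_term p a b = cross_term p b a.
Proof. by rewrite /cross_term (mulrC a) maxC. Qed.

Lemma cross_termE (R : realType) (p a b : R) : 2 <= p -> `|b| <= `|a| ->
  cross_term p a b = p * (a * b * `|a| `^ (p - 2)).
Proof.
move=> p2 ba; rewrite /cross_term; congr (_ * (_ * _)); apply/max_idPl.
by apply: ge0_ler_powR; rewrite ?nnegrE//; lra.
Qed.

(** Write (1 - t)^p as (1 - t)^(p - 1) - t (1 - t)^(p - 1): Bernoulli bounds the
first term from below, and superadditivity compares the second one with
|t|^(p - 1), from the side that the sign of t requires. *)
Lemma powR_distB_ge_unit (R : realType) (p t : R) : 2 <= p -> `|t| <= 1 ->
  1 + `|t| `^ p - p * t <= `|1 - t| `^ p.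
Proof.
move=> p2; rewrite ler_norml => /andP[t1 t2].
have q1 : 1 <= p - 1 by lra.
have p0 : 0 < p by lra.
have b : 1 + (p - 1) * (- t) <= (1 - t) `^ (p - 1) by apply: powR_bernoulli => //; lra.
have t3 : 0 <= 1 - t by lra.
rewrite (ger0_norm t3) -(mulr_powRB1 t3 p0) -(mulr_powRB1 (normr_ge0 t) p0).
have [t0|t0] := leP 0 t.
- rewrite ger0_norm//.
  have := powR_superadd q1 t3 t0; rewrite subrK powR1 => s.
  have : t * (1 - t) `^ (p - 1) <= t * (1 - t `^ (p - 1)).
    by apply: ler_wpM2l => //; lra.
  lra.
- rewrite ltr0_norm//.
  have t0' : 0 <= - t by lra.
  have := powR_superadd q1 t0' ler01; rewrite powR1 (addrC (- t)) => s.
  have : - t * (1 + (- t) `^ (p - 1)) <= - t * (1 - t) `^ (p - 1).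
    by apply: ler_wpM2l => //; lra.
  lra.
Qed.

(** Both sides are homogeneous of degree p, so that dividing by the larger of the
two numbers reduces to the case a = 1. *)
Lemma powR_distB_ge (R : realType) (p a b : R) : 2 <= p ->
  `|a| `^ p + `|b| `^ p - cross_term p a b <= `|a - b| `^ p.
Proof.
move=> p2; wlog ba : a b / `|b| <= `|a|.
  move=> h; have [/h//|/ltW/h] := leP `|b| `|a|.
  by rewrite cross_termC distrC (addrC (`|b| `^ p)).
rewrite cross_termE//.
have [a0|a0] := eqVneq a 0.
  move: ba; rewrite a0 normr0 normr_le0 => /eqP ->.
  by rewrite subrr !mul0r mulr0 normr0 powR0 ?subr0 ?addr0//; lra.
have na : 0 < `|a| by rewrite normr_gt0.
have [t bE] : exists t, b = a * t by exists (b / a); rewrite mulrC divfK.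
have t1 : `|t| <= 1 by rewrite -(ler_pM2l na) mulr1 -normrM -bE.
have -> : a - b = a * (1 - t) by rewrite bE mulrBr mulr1.
rewrite bE !normrM !powRM//.
have -> : p * (a * (a * t) * `|a| `^ (p - 2)) = `|a| `^ p * (p * t).
  have -> : `|a| `^ p = a ^+ 2 * `|a| `^ (p - 2).
    rewrite -(@real_normK _ a) ?num_real// -powR_mulrn// -powRD ?subrKC//.
    by apply/implyP => _; rewrite gt_eqF.
  ring.
rewrite -[X in X + _ - _](mulr1 (`|a| `^ p)) -mulrDr -mulrBr.
by apply: ler_wpM2l; [exact: powR_ge0|exact: powR_distB_ge_unit].
Qed.

Lemma cross_term_le (R : realType) (p a b : R) : 2 <= p -> `|b| <= `|a| ->
  `|cross_term p a b| <= p * (`|a| `^ (p - 1) * `|b|).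
Proof.
move=> p2 ba; rewrite cross_termE// !normrM.
rewrite (ger0_norm (powR_ge0 _ _)) ger0_norm; last lra.
have p0 : 0 < p - 1 by lra.
apply: ler_wpM2l; first lra.
rewrite -[X in _ <= X * _]mulr_powRB1//.
have -> : p - 1 - 1 = p - 2 by ring.
by rewrite le_eqVlt; apply/orP; left; apply/eqP; ring.
Qed.

(** The min kernel is a superposition of the kernels of the layers [u >= t], each
of which contributes the square of a partial sum of a.  The induction removes
the lowest positive layer. *)
Lemma min_kernel_ge0 (R : realDomainType) (I : finType) (a u : I -> R) :
  (forall i, 0 <= u i) ->
  0 <= \sum_i \sum_j a i * a j * Num.min (u i) (u j).
Proof.
move: {2}(#|[set i | u i != 0]%SET|) (leqnn #|[set i | u i != 0]%SET|) => n.
elim: n u => [|n ih] u.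
  rewrite leqn0 cards_eq0 => /eqP/finset.setP u0 _.
  rewrite big1// => i _; rewrite big1// => j _.
  have ui k : u k = 0 by have := u0 k; rewrite !inE => /negbFE/eqP.
  by rewrite !ui minxx mulr0.
move=> un u0; pose S := [set i | u i != 0]%SET.
have [S0|/finset.set0Pn[i0 i0S]] := eqVneq S finset.set0.
  by apply: ih => //; rewrite -/S S0 cards0.
(* m is the index of the lowest positive value; lower everything above 0 by it. *)
have [m mS mmin] := @Order.TotalTheory.arg_minP _ _ _ i0 (mem S) u i0S.
have {}mS : m \in S by [].
have {}mmin j : j \in S -> u m <= u j by exact: mmin.
have um : 0 < u m by rewrite lt_neqAle u0 andbT eq_sym; move: mS; rewrite inE.
pose v i := if i \in S then u i - u m else 0.
have v0 i : 0 <= v i by rewrite /v; case: ifP => // /mmin; rewrite subr_ge0.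
have vS : (#|[set i | v i != 0%R]%SET| <= n)%N.
  rewrite -ltnS; apply: leq_trans un; apply: proper_card; apply/properP; split.
    by apply/fintype.subsetP => i; rewrite inE /v; case: ifP => //; rewrite eqxx.
  by exists m => //; rewrite inE /v mS subrr eqxx.
(* The removed layer is a rank one kernel. *)
have minE i j : Num.min (u i) (u j) =
    u m * ((i \in S)%:R * (j \in S)%:R) + Num.min (v i) (v j).
  have uS k : k \notin S -> u k = 0 by rewrite inE negbK => /eqP.
  rewrite /v; case: ifPn => iS; case: ifPn => jS; rewrite ?mulr1 ?mulr0 ?add0r.
  - by rewrite -addr_minl addrC subrK.
  - by rewrite (uS _ jS) !min_r// subr_ge0 mmin.
  - by rewrite (uS _ iS) !min_l// subr_ge0 mmin.
  - by rewrite (uS _ jS) (uS _ iS).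
under eq_bigr do (under eq_bigr do rewrite minE mulrDr; rewrite big_split/=).
rewrite big_split/= addr_ge0 ?ih//.
suff -> : \sum_i \sum_j a i * a j * (u m * ((i \in S)%:R * (j \in S)%:R)) =
    u m * (\sum_i a i * (i \in S)%:R) ^+ 2.
  by rewrite mulr_ge0 ?sqr_ge0// ltW.
rewrite expr2 mulr_suml mulr_sumr; apply: eq_bigr => i _.
by rewrite !mulr_sumr; apply: eq_bigr => j _; ring.
Qed.

(** With u = |f|^(p - 2), the maximum of u i and u j is u i + u j minus their
minimum; the first two parts factor through the sum of f, which vanishes. *)
Lemma sum_cross_term_le0 (R : realType) (I : finType) (p : R) (f : I -> R) :
  2 <= p -> \sum_i f i = 0 -> \sum_i \sum_j cross_term p (f i) (f j) <= 0.
Proof.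
move=> p2 f0; pose u i := `|f i| `^ (p - 2).
have E i j : cross_term p (f i) (f j) =
    p * (f i * u i * f j) + p * (f i * (f j * u j))
    - p * (f i * f j * Num.min (u i) (u j)).
  have := addr_max_min (u i) (u j); rewrite /cross_term -/(u i) -/(u j) => mm.
  rewrite -!mulrDr -mulrBr; congr (_ * _).
  have -> : Num.max (u i) (u j) = u i + u j - Num.min (u i) (u j).
    by rewrite -mm addrK.
  ring.
have -> : \sum_i \sum_j cross_term p (f i) (f j) =
    - (p * \sum_i \sum_j f i * f j * Num.min (u i) (u j)).
  under eq_bigr do (under eq_bigr do rewrite E; rewrite sumrB big_split/=).
  rewrite sumrB big_split/= [X in X + _ - _]big1 => [|i _]; last first.
    by rewrite -mulr_sumr -mulr_sumr f0 !mulr0.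
  rewrite [X in _ + X - _](_ : _ = 0).
    by rewrite !add0r mulr_sumr; congr (- _); apply: eq_bigr => i _; rewrite mulr_sumr.
  by rewrite exchange_big big1//= => j _; rewrite -mulr_sumr -mulr_suml f0 mul0r mulr0.
rewrite oppr_le0 mulr_ge0//; first lra.
by apply: min_kernel_ge0 => i; exact: powR_ge0.
Qed.

(** * Weights of small discrepancy *)

(** Weights of mean degree D whose relative error on a rectangle S x T is at most
eta in the normalization of the expander mixing lemma. *)
Definition quasirandom (R : realType) (X : finType) (D eta : R) (A : X -> X -> R) : Prop :=
  [/\ forall x y, 0 <= A x y,
      forall x, `|\sum_y A x y - D| <= eta * D,
      forall y, `|\sum_x A x y - D| <= eta * D
    & forall S T : {set X},
        `|\sum_(x in S) \sum_(y in T) A x y - D / #|X|%:R * (#|S|%:R * #|T|%:R)|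
        <= eta * D * Num.sqrt (#|S|%:R * #|T|%:R)].

Definition centered (R : realType) (X : finType) (D : R) (A : X -> X -> R) (x y : X) : R :=
  A x y - D / #|X|%:R.

(** AM-GM in the form that splits a discrepancy term into one contribution for each
of its two sides. *)
Lemma sqrtM_le_mean (R : realType) (u v : R) : 0 <= u -> 0 <= v ->
  Num.sqrt u * Num.sqrt v <= (u + v) / 2.
Proof.
move=> u0 v0; have := sqr_ge0 (Num.sqrt u - Num.sqrt v).
rewrite sqrrB !sqr_sqrtr//; lra.
Qed.

Lemma sum_constE (R : pzSemiRingType) (I : finType) (P : {pred I}) (c : R) :
  \sum_(i in P) c = c * #|P|%:R.
Proof. by rewrite sumr_const mulr_natr. Qed.

(** Group the sum by pairs of level sets.  On each pair the discrepancy bounds the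
centered weight by eta D times the geometric mean of the two sizes, and AM-GM
distributes this bound over the two level sets; a level set is charged at most M
times from each side, once for every level near it. *)
Lemma block_sum_le (R : realType) (X J : finType) (D eta c : R) (A : X -> X -> R)
    (lev : X -> J) (near : rel J) (M : nat) (b : J -> R) (Psi : J -> J -> R) :
  quasirandom D eta A -> 0 <= c -> 0 <= D -> 0 <= eta ->
  (forall j, 0 <= b j) -> symmetric near -> (forall j, #|near j| <= M)%N ->
  (forall j j', `|Psi j j'| <= if near j j' then c * (b j * b j') else 0) ->
  `|\sum_x \sum_y centered D A x y * Psi (lev x) (lev y)|
    <= c * (eta * D) * M%:R * \sum_x b (lev x) ^+ 2.
Proof.
move=> [_ _ _ disc] c0 D0 eta0 b0 nsym nM Psib.
pose B j := [set x | lev x == j]%SET.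
pose N j : R := #|B j|%:R.
have N0 j : 0 <= N j by exact: ler0n.
have inB x j : (x \in B j) = (lev x == j) by rewrite inE.
have -> : \sum_x \sum_y centered D A x y * Psi (lev x) (lev y) =
    \sum_j \sum_j' Psi j j' * \sum_(x in B j) \sum_(y in B j') centered D A x y.
  rewrite (partition_big lev predT)//=; apply: eq_bigr => j _.
  under eq_bigr => x xj do rewrite (partition_big lev predT)//=.
  rewrite exchange_big/=; apply: eq_bigr => j' _; rewrite mulr_sumr.
  apply: eq_big => [x|x /eqP ->]; first by rewrite inB.
  rewrite mulr_sumr; apply: eq_big => [y|y /eqP ->]; first by rewrite inB.
  by rewrite mulrC.
have sumE (S T : {set X}) : \sum_(x in S) \sum_(y in T) centered D A x y =
    \sum_(x in S) \sum_(y in T) A x y - D / #|X|%:R * (#|S|%:R * #|T|%:R).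
  under eq_bigr do rewrite sumrB; rewrite sumrB; congr (_ - _).
  by rewrite !sum_constE; ring.
have bound j j' : `|Psi j j' * \sum_(x in B j) \sum_(y in B j') centered D A x y| <=
    if near j j' then c * (eta * D) * ((N j * b j ^+ 2 + N j' * b j' ^+ 2) / 2) else 0.
  rewrite normrM; have := Psib j j'; case: ifP => _ Pb; last first.
    by move: Pb; rewrite normr_le0 => /eqP ->; rewrite normr0 mul0r.
  have Eb : `|\sum_(x in B j) \sum_(y in B j') centered D A x y| <=
      eta * D * Num.sqrt (N j * N j') by rewrite sumE; exact: disc.
  apply: le_trans (ler_pM _ _ Pb Eb) _ => //.
  rewrite sqrtrM//.
  have := sqrtM_le_mean (mulr_ge0 (N0 j) (sqr_ge0 (b j)))
    (mulr_ge0 (N0 j') (sqr_ge0 (b j'))).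
  rewrite (sqrtrM _ (N0 j)) (sqrtrM _ (N0 j')) !sqrtr_sqr !(ger0_norm (b0 _)) => h.
  have := ler_wpM2l (mulr_ge0 c0 (mulr_ge0 eta0 D0)) h.
  by apply: le_trans; rewrite le_eqVlt; apply/orP; left; apply/eqP; ring.
apply: le_trans (ler_norm_sum _ _ _) _.
apply: (@le_trans _ _ (\sum_j \sum_j'
  if near j j' then c * (eta * D) * ((N j * b j ^+ 2 + N j' * b j' ^+ 2) / 2) else 0)).
  apply: ler_sum => j _; apply: le_trans (ler_norm_sum _ _ _) _.
  by apply: ler_sum => j' _; exact: bound.
have half : \sum_j \sum_(j' | near j j') N j * b j ^+ 2 <=
    M%:R * \sum_x b (lev x) ^+ 2.
  rewrite [X in _ <= _ * X](partition_big lev predT)//= mulr_sumr.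
  apply: ler_sum => j _; rewrite sum_constE.
  have -> : \sum_(x | lev x == j) b (lev x) ^+ 2 = N j * b j ^+ 2.
    under eq_bigr => x /eqP -> do [].
    by rewrite sum_constE mulrC /N; congr (_%:R * _); apply: eq_card => x; rewrite !inE.
  rewrite mulrC; apply: ler_wpM2r; last by rewrite ler_nat; exact: nM.
  by rewrite mulr_ge0 ?sqr_ge0// /N ler0n.
have half' : \sum_j \sum_(j' | near j j') N j' * b j' ^+ 2 <=
    M%:R * \sum_x b (lev x) ^+ 2.
  rewrite (exchange_big_dep predT)//=; under eq_bigr do under eq_bigl do rewrite nsym.
  exact: half.
have -> : \sum_j \sum_j' (if near j j' then
    c * (eta * D) * ((N j * b j ^+ 2 + N j' * b j' ^+ 2) / 2) else 0) =
  c * (eta * D) * ((\sum_j \sum_(j' | near j j') N j * b j ^+ 2 +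
                    \sum_j \sum_(j' | near j j') N j' * b j' ^+ 2) / 2).
  rewrite -big_split/= mulr_suml mulr_sumr; apply: eq_bigr => j _.
  by rewrite -big_split/= mulr_suml mulr_sumr [RHS]big_mkcond.
rewrite -[leRHS]mulrA; apply: ler_wpM2l; first by rewrite !mulr_ge0.
lra.
Qed.

(** A centered weight is at most A x y + D / n in absolute value, and these have
row and column sums at most 3 D. *)
Lemma sum_centered_le (R : realType) (X : finType) (D eta : R) (A : X -> X -> R)
    (h : X -> R) : quasirandom D eta A -> 0 <= D -> eta <= 1 -> (forall x, 0 <= h x) ->
  \sum_x \sum_y `|centered D A x y| * (h x + h y) <= 6 * D * \sum_x h x.
Proof.
move=> [A0 rowA colA _] D0 eta1 h0.
have [X0|X0] := posnP #|X|.
  by rewrite !big_pred0 ?mulr0// => x; have := card0_eq X0 x; rewrite !inE.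
have n0 : #|X|%:R != 0 :> R by rewrite pnatr_eq0 gtn_eqF.
have etaD : eta * D <= D by apply: ler_piMl.
have up u : `|u - D| <= eta * D -> u <= 2 * D.
  rewrite ler_norml => /andP[_]; lra.
apply: (@le_trans _ _ (\sum_x \sum_y (A x y + D / #|X|%:R) * (h x + h y))).
  apply: ler_sum => x _; apply: ler_sum => y _; apply: ler_wpM2r; first by rewrite addr_ge0.
  apply: le_trans (ler_normB _ _) _.
  by rewrite (ger0_norm (A0 _ _)) ger0_norm// divr_ge0.
have rowE x : \sum_y (A x y + D / #|X|%:R) <= 3 * D.
  rewrite big_split/= sum_constE divfK//; have := up _ (rowA x); lra.
have colE y : \sum_x (A x y + D / #|X|%:R) <= 3 * D.
  rewrite big_split/= sum_constE divfK//; have := up _ (colA y); lra.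
under eq_bigr do under eq_bigr do rewrite mulrDr.
under eq_bigr do rewrite big_split/=; rewrite big_split/=.
have -> : 6 * D * \sum_x h x = 3 * D * \sum_x h x + 3 * D * \sum_x h x by ring.
apply: lerD.
  by rewrite mulr_sumr; apply: ler_sum => x _; rewrite -mulr_suml ler_wpM2r.
rewrite exchange_big/= mulr_sumr; apply: ler_sum => y _.
by rewrite -mulr_suml ler_wpM2r.
Qed.

(** * Rounding to geometric levels *)

Lemma cross_term_leD (R : realType) (p a b : R) : 2 <= p ->
  `|cross_term p a b| <= p * (`|a| `^ p + `|b| `^ p).
Proof.
move=> p2; wlog ba : a b / `|b| <= `|a|.
  move=> h; have [/h//|/ltW/h] := leP `|b| `|a|.
  by rewrite cross_termC (addrC (`|b| `^ p)).
apply: le_trans (cross_term_le p2 ba) _; apply: ler_wpM2l; first lra.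
have p0 : 0 < p by lra.
apply: (@le_trans _ _ (`|a| `^ p)); last by rewrite lerDl powR_ge0.
by rewrite -(mulr_powRB1 (normr_ge0 a) p0) mulrC ler_wpM2r ?powR_ge0.
Qed.

(** The cross term is homogeneous of degree p, so that rounding both arguments
down by a factor of at least exp (- s) multiplies it by a factor between
exp (- s p) >= 1 - s p and 1. *)
Lemma cross_term_round (R : realType) (p s a b t u : R) : 2 <= p -> 0 <= s ->
  expR (- s) <= t <= 1 -> expR (- s) <= u <= 1 ->
  `|cross_term p a b - cross_term p (t * a) (u * b)| <= s * p * `|cross_term p a b|.
Proof.
move=> p2 s0 /andP[t1 t2] /andP[u1 u2].
have t0 : 0 < t by apply: lt_le_trans t1; exact: expR_gt0.
have u0 : 0 < u by apply: lt_le_trans u1; exact: expR_gt0.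
have q0 : 0 <= p - 2 by lra.
rewrite /cross_term !normrM !powRM// ?(ltW t0) ?(ltW u0)// (gtr0_norm t0) (gtr0_norm u0).
set x := `|a| `^ (p - 2); set y := `|b| `^ (p - 2).
have x0 : 0 <= x by exact: powR_ge0.
have y0 : 0 <= y by exact: powR_ge0.
set m := Num.max x y; set m' := Num.max _ _.
have m0 : 0 <= m by rewrite le_max x0.
have pow_hi v : 0 < v -> v <= 1 -> v `^ (p - 2) <= 1.
  move=> v0 v1; rewrite [leRHS](_ : 1 = 1 `^ (p - 2)); last by rewrite powR1.
  by apply: ge0_ler_powR; rewrite ?nnegrE// ltW.
have pow_lo v : expR (- s) <= v -> expR (- s * (p - 2)) <= v `^ (p - 2).
  move=> v1; rewrite expRM; apply: ge0_ler_powR; rewrite ?nnegrE ?expR_ge0//.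
  by apply: le_trans v1; exact: expR_ge0.
have m'le : m' <= m.
  rewrite /m' /m ge_max; apply/andP; split; rewrite le_max.
    by apply/orP; left; rewrite ler_piMl// pow_hi.
  by apply/orP; right; rewrite ler_piMl// pow_hi.
have m'0 : 0 <= m' by rewrite /m' le_max mulr_ge0 ?powR_ge0.
(* The maximum alone loses the power p - 2 of the rounding factor. *)
have m'ge : expR (- s * (p - 2)) * m <= m'.
  rewrite /m maxr_pMr ?expR_ge0// /m' ge_max; apply/andP; split; rewrite le_max.
    by apply/orP; left; rewrite ler_wpM2r// pow_lo.
  by apply/orP; right; rewrite ler_wpM2r// pow_lo.
have tum : t * u * m' <= m.
  by apply: le_trans m'le; apply: ler_piMl => //; apply: mulr_ile1 => //; exact: ltW.
have -> : p * (a * b * m) - p * (t * a * (u * b) * m') = p * (a * b) * (m - t * u * m').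
  ring.
rewrite !normrM (ger0_norm m0) (@ger0_norm _ (m - _)) ?subr_ge0//.
rewrite [leRHS](_ : _ = `|p| * (`|a| * `|b|) * (s * p * m)); last ring.
apply: ler_wpM2l; first by rewrite !mulr_ge0.
have lo : (1 - s * p) * m <= t * u * m'.
  apply: (@le_trans _ _ (expR (- s) * expR (- s) * (expR (- s * (p - 2)) * m))).
    rewrite mulrA -!expRD ler_wpM2r//.
    have -> : - s + - s + - s * (p - 2) = - (s * p) by ring.
    exact: expR_ge1Dx.
  by apply: ler_pM => //; rewrite ?mulr_ge0 ?expR_ge0//; apply: ler_pM; rewrite ?expR_ge0.
lra.
Qed.

(** The sign is part of the level, so that a level determines a rounded value.
At a = 0 the sign is 0 and the value is 0, whatever the first
component. *)
Definition log_level (R : realType) (s a : R) : int * int :=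
  (Num.floor (ln `|a| / s), sgz a).
Definition level_value (R : realType) (s : R) (j : int * int) : R :=
  j.2%:~R * expR (s * j.1%:~R).

Lemma log_levelP (R : realType) (s a : R) : 0 < s -> a != 0 ->
  expR (s * (log_level s a).1%:~R) <= `|a| < expR s * expR (s * (log_level s a).1%:~R).
Proof.
move=> s0 a0; have na : 0 < `|a| by rewrite normr_gt0.
have /andP[h1 h2] := @real_floor_itv _ _ (num_real (ln `|a| / s)).
rewrite -expRD -[X in _ <= X < _]lnK ?posrE// ler_expR ltr_expR /=.
rewrite ler_pdivlMr// in h1; rewrite ltr_pdivrMr// in h2.
by rewrite mulrC h1 /=; move: h2; rewrite intrD mulrDl mul1r (addrC s) mulrC.
Qed.

Lemma level_value_round (R : realType) (s a : R) : 0 < s ->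
  exists2 t, expR (- s) <= t <= 1 & level_value s (log_level s a) = t * a.
Proof.
move=> s0; have [->|a0] := eqVneq a 0.
  by exists 1; rewrite ?mulr0 /level_value/= ?sgz0 ?mul0r// lexx andbT -expR0 ler_expR oppr_le0 ltW.
have na : 0 < `|a| by rewrite normr_gt0.
have /andP[h1 h2] := log_levelP s0 a0.
exists (expR (s * (log_level s a).1%:~R) / `|a|).
  rewrite ler_pdivlMr// ler_pdivrMr// mul1r h1 andbT.
  by rewrite expRN mulrC ler_pdivrMr ?expR_gt0// mulrC ltW.
rewrite /level_value /log_level/= -sgrEz [X in _ = _ * X]numEsg; field; exact: lt0r_neq0.
Qed.

Definition near_levels (K : nat) (j j' : int * int) : bool := `|j.1 - j'.1| <= K%:Z.

(** If the levels of a and b differ by more than K, one of the two is smaller than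
the other by a factor exp (- s K), and the cross term is linear in the smaller
one. *)
Lemma cross_term_far (R : realType) (p s : R) (K : nat) (a b : R) : 2 <= p -> 0 < s ->
  ~~ near_levels K (log_level s a) (log_level s b) ->
  `|cross_term p a b| <= p * expR (- (s * K%:R)) * (`|a| `^ p + `|b| `^ p).
Proof.
move=> p2 s0; have p0 : 0 < p by lra.
have [->|a0] := eqVneq a 0.
  by rewrite /cross_term mul0r mul0r mulr0 normr0 !mulr_ge0 ?expR_ge0 ?addr_ge0 ?powR_ge0// ltW.
have [->|b0] := eqVneq b 0.
  by rewrite /cross_term mulr0 mul0r mulr0 normr0 !mulr_ge0 ?expR_ge0 ?addr_ge0 ?powR_ge0// ltW.
wlog kab : a b a0 b0 / (log_level s b).1 <= (log_level s a).1.
  move=> h; have [kk|/ltW kk] := leP (log_level s b).1 (log_level s a).1.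
    exact: h a0 b0 kk.
  rewrite cross_termC [X in _ * X]addrC /near_levels distrC; exact: h b0 a0 kk.
have /andP[ha1 ha2] := log_levelP s0 a0; have /andP[hb1 hb2] := log_levelP s0 b0.
rewrite /near_levels -ltNge => far.
have {}far : (log_level s b).1 + 1 + K%:Z <= (log_level s a).1 by lia.
have ba : `|b| <= expR (- (s * K%:R)) * `|a|.
  apply: le_trans (ltW hb2) _.
  apply: (@le_trans _ _ (expR (- (s * K%:R)) * expR (s * (log_level s a).1%:~R))).
    rewrite -!expRD ler_expR.
    have : (log_level s b).1%:~R + 1 + K%:R <= (log_level s a).1%:~R :> R.
      by rewrite -[K%:R]/(K%:Z%:~R) -[1]/(1%:~R) -!intrD ler_int.
    by move=> h; have := ler_wpM2l (ltW s0) h; lra.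
  by rewrite ler_wpM2l// expR_ge0.
have ba' : `|b| <= `|a|.
  apply: le_trans ba _; rewrite ler_piMl// -expR0 ler_expR oppr_le0.
  by rewrite mulr_ge0// ltW.
apply: le_trans (cross_term_le p2 ba') _; rewrite -mulrA ler_wpM2l ?(ltW p0)//.
apply: (@le_trans _ _ (`|a| `^ (p - 1) * (expR (- (s * K%:R)) * `|a|))).
  by rewrite ler_wpM2l// powR_ge0.
rewrite mulrCA (mulrC _ `|a|) mulr_powRB1// ler_wpM2l ?expR_ge0//.
by rewrite lerDl powR_ge0.
Qed.

Lemma level_value_norm (R : realType) (s a : R) : a != 0 ->
  `|level_value s (log_level s a)| = expR (s * (log_level s a).1%:~R).
Proof.
move=> a0; rewrite /level_value normrM /= -sgrEz normr_sg a0 mul1r.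
by rewrite ger0_norm ?expR_ge0.
Qed.

(** For near levels the larger value is at most exp (s K) times the smaller one, so
the p-th power of the larger one is at most a constant times the product of the
powers p / 2; it is this product form that [block_sum_le] takes. *)
Lemma cross_term_near (R : realType) (p s : R) (K : nat) (a b : R) : 2 <= p -> 0 < s ->
  near_levels K (log_level s a) (log_level s b) ->
  `|cross_term p (level_value s (log_level s a)) (level_value s (log_level s b))| <=
    p * expR (s * K%:R * (p / 2)) *
    (`|level_value s (log_level s a)| `^ (p / 2) * `|level_value s (log_level s b)| `^ (p / 2)).
Proof.
move=> p2 s0; have p0 : 0 < p by lra.
have lv0 : level_value s (log_level s 0) = 0 by rewrite /level_value/= sgz0 mul0r.
have [->|a0] := eqVneq a 0.
  by rewrite /cross_term lv0 mul0r mul0r mulr0 normr0 !mulr_ge0 ?expR_ge0 ?powR_ge0// ltW.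
have [->|b0] := eqVneq b 0.
  by rewrite /cross_term lv0 mulr0 mul0r mulr0 normr0 !mulr_ge0 ?expR_ge0 ?powR_ge0// ltW.
wlog kab : a b a0 b0 / (log_level s b).1 <= (log_level s a).1.
  move=> h; have [kk|/ltW kk] := leP (log_level s b).1 (log_level s a).1.
    exact: h a0 b0 kk.
  rewrite cross_termC [X in _ * X]mulrC /near_levels distrC; exact: h b0 a0 kk.
rewrite /near_levels => near.
have {}near : (log_level s a).1 <= (log_level s b).1 + K%:Z by lia.
set u := level_value s _; set v := level_value s _.
have nu : `|u| = expR (s * (log_level s a).1%:~R) by exact: level_value_norm.
have nv : `|v| = expR (s * (log_level s b).1%:~R) by exact: level_value_norm.
have vu : `|v| <= `|u| by rewrite nu nv ler_expR ler_wpM2l ?(ltW s0)// ler_int.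
have uv : `|u| <= expR (s * K%:R) * `|v|.
  rewrite nu nv -expRD ler_expR -mulrDr ler_wpM2l ?(ltW s0)//.
  by rewrite -[K%:R]/(K%:Z%:~R) -intrD ler_int addrC.
apply: le_trans (cross_term_le p2 vu) _; rewrite -mulrA ler_wpM2l ?(ltW p0)//.
apply: (@le_trans _ _ (`|u| `^ p)).
  by rewrite -(mulr_powRB1 (normr_ge0 u) p0) mulrC ler_wpM2r ?powR_ge0.
rewrite (splitr p) powRD; last by rewrite -splitr gt_eqF.
rewrite -splitr mulrCA ler_wpM2l ?powR_ge0//.
rewrite expRM -powRM ?expR_ge0//.
by apply: ge0_ler_powR; rewrite ?nnegrE ?mulr_ge0 ?expR_ge0//; lra.
Qed.

(** There are 2 K + 1 magnitudes within K of a given one, and three signs. *)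
Lemma card_near_levels (R : realType) (X : finType) (s : R) (K : nat) (f : X -> R)
    (j : seq_sub (codom (fun x => log_level s (f x)))) :
  (#|[pred j' : seq_sub (codom (fun x => log_level s (f x))) |
       near_levels K (val j) (val j')]| <= (2 * K + 1) * 3)%N.
Proof.
rewrite cardE -(size_map (fun j' => val j')).
pose l : seq (int * int) :=
  [seq ((val j).1 - K%:Z + i%:Z, t) | i <- iota 0 (2 * K + 1), t <- [:: -1; 0; 1]].
have -> : ((2 * K + 1) * 3 = size l)%N by rewrite size_allpairs size_iota.
apply: uniq_leq_size; first by rewrite map_inj_uniq ?enum_uniq//; exact: val_inj.
move=> _ /mapP[j' j'n ->]; move: j'n; rewrite mem_enum inE /near_levels => jn.
have [x] := codomP (valP j') => xj.
have [a aE] : exists a : int, a = (val j).1 by exists (val j).1.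
have [b bE] : exists b : int, b = (val j').1 by exists (val j').1.
rewrite -aE -bE in jn.
apply/allpairsP; exists (absz ((val j').1 - (val j).1 + K%:Z), (val j').2); split => /=.
- by rewrite mem_iota /= -aE -bE; lia.
- by rewrite xj /log_level /= /sgz; case: ifP => //; case: ifP.
- by rewrite {1}[val j']surjective_pairing -aE -bE; congr pair; lia.
Qed.

(** The terms are, in this order, the loss from irregular degrees, from rounding,
from pairs at far levels, and from the discrepancy of near levels.  The free
parameters s and K are the width of a level and the range of near levels. *)
Definition poincare_defect (R : realType) (eta p s : R) (K : nat) : R :=
  2 * eta + 6 * (s * p ^+ 2 + p * expR (- (s * K%:R)))
  + p * expR (s * K%:R * (p / 2)) * ((2 * K + 1) * 3)%N%:R * eta.

(** Sum [powR_distB_ge] against A.  The powers give 2 D up to the degree error.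
The cross term is split in three: the mean weight D / n, whose contribution has
the right sign by [sum_cross_term_le0]; the centered weight against the rounded
cross term of near levels, bounded by [block_sum_le]; and the centered weight
against the remainder, bounded termwise. *)
Lemma quasirandom_poincare (R : realType) (X : finType) (D eta p s : R) (K : nat)
    (A : X -> X -> R) (f : X -> R) :
  quasirandom D eta A -> 0 <= D -> 0 <= eta <= 1 -> 2 <= p -> 0 < s ->
  \sum_x f x = 0 ->
  (2 - poincare_defect eta p s K) * (D * \sum_x `|f x| `^ p)
  <= \sum_x \sum_y A x y * `|f x - f y| `^ p.
Proof.
move=> qr D0 /andP[eta0 eta1] p2 s0 f0; have p0 : 0 < p by lra.
pose h x := `|f x| `^ p; have h0 x : 0 <= h x by exact: powR_ge0.
rewrite -/(\sum_x h x); set H := \sum_x h x.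
have H0 : 0 <= H by apply: sumr_ge0.
(* Levels range over the finitely many levels of values of f. *)
pose J := seq_sub (codom (fun x => log_level s (f x))).
pose lev x : J := SeqSub (codom_f (fun x => log_level s (f x)) x).
pose nr (j j' : J) := near_levels K (val j) (val j').
pose g (j : J) := level_value s (val j).
pose Psi j j' := if nr j j' then cross_term p (g j) (g j') else 0.
pose c := p * expR (s * K%:R * (p / 2)).
have [A0 rowA colA _] := qr.
(* The part of the cross term that the block structure misses. *)
have rem x y : `|cross_term p (f x) (f y) - Psi (lev x) (lev y)| <=
    (s * p ^+ 2 + p * expR (- (s * K%:R))) * (h x + h y).
  have e1 : 0 <= p * expR (- (s * K%:R)) by rewrite mulr_ge0 ?expR_ge0// ltW.
  have e2 : 0 <= s * p ^+ 2 by rewrite mulr_ge0 ?sqr_ge0// ltW.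
  have hh : 0 <= h x + h y by rewrite addr_ge0.
  rewrite /Psi; case: ifPn => [_|far].
    have [t tb tE] := level_value_round (f x) s0.
    have [u ub uE] := level_value_round (f y) s0.
    rewrite /g /= tE uE; apply: le_trans (cross_term_round _ _ p2 (ltW s0) tb ub) _.
    apply: (@le_trans _ _ (s * p * (p * (h x + h y)))).
      by apply: ler_wpM2l; [rewrite mulr_ge0// ltW|exact: cross_term_leD].
    have -> : s * p * (p * (h x + h y)) = s * p ^+ 2 * (h x + h y) by ring.
    by rewrite ler_wpM2r// lerDl.
  rewrite subr0; apply: le_trans (cross_term_far p2 s0 far) _.
  by rewrite ler_wpM2r// lerDr.
have main : `|\sum_x \sum_y centered D A x y * Psi (lev x) (lev y)| <=
    c * (eta * D) * ((2 * K + 1) * 3)%N%:R * H.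
  have c0 : 0 <= c by rewrite mulr_ge0 ?expR_ge0// ltW.
  apply: le_trans (block_sum_le lev (near := nr) (b := fun j => `|g j| `^ (p / 2))
    qr c0 D0 eta0 _ _ (@card_near_levels _ _ s K f) _) _.
  - by move=> j; exact: powR_ge0.
  - by move=> j j'; rewrite /nr /near_levels distrC.
  - move=> j j'; rewrite /Psi; case: ifP => [jj'|]; last by rewrite normr0.
    have [x xj] := codomP (valP j); have [y yj] := codomP (valP j').
    by move: jj'; rewrite /g /nr xj yj; exact: cross_term_near.
  apply: ler_wpM2l; first by rewrite !mulr_ge0 ?expR_ge0 ?ler0n // ltW.
  apply: ler_sum => x _.
  rewrite -powR_mulrn ?powR_ge0// -powRrM divfK//.
  apply: ge0_ler_powR; rewrite ?nnegrE//; first exact: ltW.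
  have [t /andP[t1 t2] tE] := level_value_round (f x) s0.
  rewrite /g /= tE normrM ger0_norm; last by apply: le_trans t1; exact: expR_ge0.
  exact: ler_piMl.
have total : \sum_x \sum_y A x y * cross_term p (f x) (f y) <=
   c * (eta * D) * ((2 * K + 1) * 3)%N%:R * H +
   (s * p ^+ 2 + p * expR (- (s * K%:R))) * (6 * D * H).
  have -> : \sum_x \sum_y A x y * cross_term p (f x) (f y) =
      \sum_x \sum_y centered D A x y * Psi (lev x) (lev y) +
      \sum_x \sum_y centered D A x y * (cross_term p (f x) (f y) - Psi (lev x) (lev y)) +
      D / #|X|%:R * \sum_x \sum_y cross_term p (f x) (f y).
    rewrite mulr_sumr -!big_split/=; apply: eq_bigr => x _.
    rewrite mulr_sumr -!big_split/=; apply: eq_bigr => y _.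
    by rewrite /centered; ring.
  rewrite -[leRHS]addr0; apply: lerD; last first.
    by rewrite mulr_ge0_le0 ?divr_ge0//; exact: sum_cross_term_le0.
  apply: lerD; first exact: le_trans (ler_norm _) main.
  have := sum_centered_le qr D0 eta1 h0.
  set S := \sum_x _ => hS.
  apply: (@le_trans _ _ ((s * p ^+ 2 + p * expR (- (s * K%:R))) * S)); last first.
    apply: ler_wpM2l => //; rewrite addr_ge0// mulr_ge0 ?sqr_ge0 ?expR_ge0//; exact: ltW.
  rewrite /S mulr_sumr; apply: ler_sum => x _; rewrite mulr_sumr; apply: ler_sum => y _.
  apply: le_trans (ler_norm _) _; rewrite normrM mulrCA; apply: ler_wpM2l => //.
have deg : 2 * (1 - eta) * (D * H) <= \sum_x \sum_y A x y * (h x + h y).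
  under eq_bigr do under eq_bigr do rewrite mulrDr.
  under eq_bigr do rewrite big_split/=; rewrite big_split/=.
  have -> : 2 * (1 - eta) * (D * H) = (1 - eta) * D * H + (1 - eta) * D * H by ring.
  have lo u : `|u - D| <= eta * D -> (1 - eta) * D <= u.
    rewrite ler_norml => /andP[]; lra.
  apply: lerD.
    rewrite mulr_sumr; apply: ler_sum => x _; rewrite -mulr_suml ler_wpM2r//.
    exact/lo/rowA.
  rewrite exchange_big/= mulr_sumr; apply: ler_sum => y _.
  by rewrite -mulr_suml ler_wpM2r//; exact/lo/colA.
apply: (@le_trans _ _ (\sum_x \sum_y A x y * (h x + h y) -
    \sum_x \sum_y A x y * cross_term p (f x) (f y))).
  rewrite /poincare_defect -/c; move: deg total; lra.
rewrite -sumrB; apply: ler_sum => x _; rewrite -sumrB; apply: ler_sum => y _.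
by rewrite -mulrBr ler_wpM2l//; exact: powR_distB_ge.
Qed.

(** * Concentration for subsets of fixed size *)

Definition draws (U : finType) (W : {set U}) (N : nat) : {set {set U}} :=
  [set E : {set U} | (E \subset W) && (#|E| == N)]%SET.

(** The binomial theorem, indexed by the set of factors that contribute x. *)
Lemma sum_subset_exp (R : comNzRingType) (U : finType) (S : {set U}) (x : R) :
  \sum_(J : {set U} | J \subset S) x ^+ #|J| = (1 + x) ^+ #|S|.
Proof.
transitivity (\prod_(i : U) ((if i \in S then x else 0) + 1)).
  rewrite bigA_distr/= big_mkcond/=; apply: eq_bigr => J _.
  case: ifPn => [JS|JS].
    rewrite -big_mkcond/= (eq_bigr (fun => x)) ?prodr_const// => i iJ.
    by rewrite (fintype.subsetP JS).
  have [i iJ iS] := fintype.subsetPn JS.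
  by rewrite (bigD1 i)//= iJ (negbTE iS) mul0r.
rewrite (bigID (mem S))/= [X in _ * X]big1 ?mulr1 => [|i iS]; last first.
  by rewrite (negbTE iS) add0r.
by rewrite (eq_bigr (fun => 1 + x)) ?prodr_const// => i ->; rewrite addrC.
Qed.

(** The quotient of the two binomials is the product of the (N - i) / (w - i) over
i < j, and each factor is at most N / w. *)
Lemma bin_sub_le (w N j : nat) : (j <= N)%N -> (N <= w)%N ->
  ('C(w - j, N - j) * w ^ j <= 'C(w, N) * N ^ j)%N.
Proof.
move=> jN Nw; elim: j jN => [|j ih] jN; first by rewrite !subn0 !muln1.
have {}ih := ih (ltnW jN).
have wj : (0 < w - j)%N by lia.
rewrite -(leq_pmul2l wj) !expnS.
have e := mul_bin_diag (w - j) (N - j.+1).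
have e1 : ((w - j).-1 = w - j.+1)%N by lia.
have e2 : ((N - j.+1).+1 = N - j)%N by lia.
rewrite e1 e2 in e.
have -> : ((w - j) * ('C(w - j.+1, N - j.+1) * (w * w ^ j)) =
  (w * (N - j)) * ('C(w - j, N - j) * w ^ j))%N.
  by rewrite mulnA e; ring.
have -> : ((w - j) * ('C(w, N) * (N * N ^ j)) = (N * (w - j)) * ('C(w, N) * N ^ j))%N by ring.
apply: leq_mul => //; nia.
Qed.

(** The inclusion of j given points in a random N-subset of W is at most as likely
as if they were included independently with probability N / |W|. *)
Lemma card_draws_above (U : finType) (W J : {set U}) (N : nat) :
  (N <= #|W|)%N -> J \subset W ->
  (#|[set E in draws W N | J \subset E]| * #|W| ^ #|J| <= #|draws W N| * N ^ #|J|)%N.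
Proof.
move=> NW JW; have cd : #|draws W N| = 'C(#|W|, N) by exact: cards_draws.
have [JN|JN] := leqP #|J| N; last first.
  rewrite (_ : [set E in draws W N | J \subset E]%SET = finset.set0) ?cards0 ?mul0n//.
  apply/finset.setP => E; rewrite !inE; apply/negbTE/negP.
  move=> /andP[/andP[_ /eqP EN] /subset_leq_card].
  by rewrite EN leqNgt JN.
rewrite cd; apply: leq_trans (bin_sub_le JN NW); rewrite leq_mul2r; apply/orP; right.
have <- : #|draws (W :\: J) (N - #|J|)| = 'C(#|W| - #|J|, N - #|J|).
  by rewrite -(cardsDS JW); exact: cards_draws.
rewrite -(card_in_imset (f := fun E => E :\: J)); last first.
  move=> E F; rewrite !inE => /andP[_ JE] /andP[_ JF] EF.
  by rewrite -(finset.setID E J) -(finset.setID F J) EF (finset.setIidPr JE) (finset.setIidPr JF).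
apply: subset_leq_card; apply/fintype.subsetP => _ /imsetP[E + ->].
rewrite !inE => /andP[/andP[EW /eqP EN] JE].
by rewrite finset.setSD//= cardsDS// EN.
Qed.

(** Expanding z^|E & T| = (1 + (z - 1))^|E & T| over the subsets J of E & T turns the
generating function into a combination of the probabilities that E contains J.
Its coefficients (z - 1)^|J| are nonnegative, so that replacing each probability
by its binomial bound only increases the sum. *)
Lemma draws_mgf_ge1 (R : realType) (U : finType) (W T : {set U}) (N : nat) (z : R) :
  (N <= #|W|)%N -> T \subset W -> 1 <= z ->
  \sum_(E in draws W N) z ^+ #|E :&: T| <=
    #|draws W N|%:R * (1 + N%:R / #|W|%:R * (z - 1)) ^+ #|T|.
Proof.
move=> NW TW z1.
have -> : \sum_(E in draws W N) z ^+ #|E :&: T| =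
   \sum_(J : {set U} | J \subset T) #|[set E in draws W N | J \subset E]|%:R * (z - 1) ^+ #|J|.
  transitivity (\sum_(E in draws W N)
      \sum_(J : {set U} | (J \subset E) && (J \subset T)) (z - 1) ^+ #|J|).
    apply: eq_bigr => E _; rewrite -{1}(subrKC 1 z) -sum_subset_exp.
    by apply: eq_bigl => J; rewrite finset.subsetI.
  rewrite (exchange_big_dep (fun J : {set U} => J \subset T))/=; last by move=> E J _ /andP[].
  apply: eq_bigr => J JT; rewrite sumr_const mulr_natl; congr (_ *+ _).
  apply: eq_card => E.
  by rewrite -[LHS]/([&& E \in draws W N, J \subset E & J \subset T]) JT andbT !inE.
rewrite -sum_subset_exp mulr_sumr; apply: ler_sum => J JT.
rewrite exprMn mulrA; apply: ler_wpM2r; first by rewrite exprn_ge0// subr_ge0.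
have [W0|W0] := posnP #|W|.
  have : (#|J| <= 0)%N by rewrite -W0; apply: subset_leq_card; exact: fintype.subset_trans TW.
  rewrite leqn0 => /eqP ->; rewrite expr0 mulr1 ler_nat; apply: subset_leq_card.
  by apply/fintype.subsetP => E; rewrite inE => /andP[].
rewrite exprMn exprVn mulrA ler_pdivlMr ?exprn_gt0 ?ltr0n// -!natrX -!natrM ler_nat.
by apply: card_draws_above => //; exact: fintype.subset_trans TW.
Qed.

(** For z < 1, pass to complements: W minus E is a uniform subset of size |W| - N, and
|E & T| = |T| - |(W minus E) & T| turns z into 1 / z. *)
Lemma draws_mgf (R : realType) (U : finType) (W T : {set U}) (N : nat) (z : R) :
  (N <= #|W|)%N -> (0 < #|W|)%N -> T \subset W -> 0 < z ->
  \sum_(E in draws W N) z ^+ #|E :&: T| <=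
    #|draws W N|%:R * (1 + N%:R / #|W|%:R * (z - 1)) ^+ #|T|.
Proof.
move=> NW W0 TW z0; have [z1|z1] := leP 1 z; first exact: draws_mgf_ge1.
have zV : 1 <= z^-1 by rewrite invf_ge1// ltW.
have NW' : (#|W| - N <= #|W|)%N by exact: leq_subr.
have comp E : E \in draws W N -> W :\: E \in draws W (#|W| - N).
  rewrite !inE => /andP[EW /eqP EN].
  by rewrite finset.subsetDl cardsDS// EN eqxx.
have compK E : E \in draws W N -> W :\: (W :\: E) = E.
  rewrite inE => /andP[EW _]; apply/finset.setP => x; rewrite !inE negb_and negbK.
  by have := fintype.subsetP EW x; case: (x \in E); case: (x \in W) => // /(_ isT).
have cE : #|draws W (#|W| - N)| = #|draws W N|.
  by rewrite !cards_draws bin_sub.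
have := draws_mgf_ge1 NW' TW zV; rewrite cE => h.
have split E : E \in draws W N -> z ^+ #|E :&: T| = z ^+ #|T| * z^-1 ^+ #|(W :\: E) :&: T|.
  move=> _; have -> : #|T| = (#|E :&: T| + #|(W :\: E) :&: T|)%N.
    rewrite -(cardsID E T) finset.setIC; congr (_ + _)%N; apply: eq_card => x; rewrite !inE.
    have := fintype.subsetP TW x.
    by case: (x \in E); case: (x \in W); case: (x \in T) => // /(_ isT).
  by rewrite exprD -mulrA -exprMn divff ?gt_eqF// expr1n mulr1.
rewrite (eq_bigr _ split) -mulr_sumr.
apply: (@le_trans _ _ (z ^+ #|T| * \sum_(E in draws W (#|W| - N)) z^-1 ^+ #|E :&: T|)).
  apply: ler_wpM2l; first by rewrite exprn_ge0// ltW.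
  rewrite -(big_imset (h := fun E => W :\: E) (fun E => z^-1 ^+ #|E :&: T|))/=; last first.
    by move=> E F /compK {2}<- /compK {2}<- ->.
  rewrite big_mkcond [leRHS]big_mkcond/=; apply: ler_sum => E _.
  case: ifP => [/imsetP[F FW ->]|_]; first by rewrite comp.
  by case: ifP => // _; rewrite exprn_ge0// invr_ge0 ltW.
apply: le_trans (ler_wpM2l _ h) _; first by rewrite exprn_ge0// ltW.
rewrite mulrCA -exprMn; apply: ler_wpM2l => //; rewrite le_eqVlt; apply/orP; left.
apply/eqP; congr (_ ^+ _); rewrite natrB//; field.
by rewrite pnatr_eq0 gt_eqF//= gt_eqF.
Qed.

(** From exp (- x) >= 1 - x, and 1 / (1 - x) <= 1 + x + 2 x^2 on this range. *)
Lemma expR_le_quadratic (R : realType) (x : R) : x <= 2^-1 ->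
  expR x <= 1 + x + 2 * x ^+ 2.
Proof.
move=> x2; have := expR_ge1Dx (- x); rewrite expRN => h.
have x1 : 0 < 1 - x by lra.
have {}h : expR x <= (1 - x)^-1.
  rewrite -(invrK (expR x)) lef_pV2 ?posrE ?invr_gt0 ?expR_gt0//.
apply: le_trans h _; rewrite -[leLHS]mul1r ler_pdivrMr//.
have : 0 <= x ^+ 2 * (1 - 2 * x) by rewrite mulr_ge0 ?sqr_ge0//; lra.
lra.
Qed.

Lemma draws_expR (R : realType) (U : finType) (W T : {set U}) (N : nat) (x : R) :
  (N <= #|W|)%N -> (0 < #|W|)%N -> T \subset W -> x <= 2^-1 ->
  \sum_(E in draws W N) expR (x * #|E :&: T|%:R) <=
    #|draws W N|%:R * expR (N%:R / #|W|%:R * #|T|%:R * (x + 2 * x ^+ 2)).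
Proof.
move=> NW W0 TW x2; rewrite (eq_bigr (fun E => expR x ^+ #|E :&: T|)).
  2: by move=> E _; exact: expRM_natr.
apply: le_trans (draws_mgf NW W0 TW (expR_gt0 x)) _; apply: ler_wpM2l => //.
set q := N%:R / #|W|%:R.
have q0 : 0 <= q by rewrite divr_ge0.
have q1 : q <= 1 by rewrite ler_pdivrMr ?mul1r ?ler_nat// ltr0n.
have -> : expR (q * #|T|%:R * (x + 2 * x ^+ 2)) = expR (q * (x + 2 * x ^+ 2)) ^+ #|T|.
  by rewrite -expRM_natr mulrAC.
apply: lerXn2r; rewrite ?nnegrE ?expR_ge0//.
  have : 0 <= q * expR x by rewrite mulr_ge0 ?expR_ge0.
  lra.
apply: le_trans (expR_ge1Dx _); rewrite lerD2l ler_wpM2l//.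
have := expR_le_quadratic x2; lra.
Qed.

(** Markov's inequality for exp (x |E & T|).  The sign of x selects the tail; M is any
upper bound for the mean, which permits one deviation for sets of different
sizes. *)
Lemma draws_tail (R : realType) (U : finType) (W T : {set U}) (N : nat) (x M : R) :
  (N <= #|W|)%N -> (0 < #|W|)%N -> T \subset W -> x <= 2^-1 ->
  N%:R / #|W|%:R * #|T|%:R <= M ->
  #|[set E in draws W N | x * (N%:R / #|W|%:R * #|T|%:R) + 4 * x ^+ 2 * M <= x * #|E :&: T|%:R]|%:R
   <= #|draws W N|%:R * expR (- (2 * x ^+ 2 * M)).
Proof.
move=> NW W0 TW x2; set mu := N%:R / #|W|%:R * #|T|%:R => muM.
set B := [set _ | _]%SET; pose t := x * mu + 4 * x ^+ 2 * M.
have h := draws_expR NW W0 TW x2; rewrite -/mu in h.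
have markov : #|B|%:R * expR t <= \sum_(E in draws W N) expR (x * #|E :&: T|%:R).
  rewrite mulr_natl -sumr_const big_mkcond [leRHS]big_mkcond/=; apply: ler_sum => E _.
  rewrite inE; case: (E \in draws W N) => //=.
  by case: ifP => [tE|_]; rewrite ?ler_expR ?expR_ge0.
rewrite -(ler_pM2r (expR_gt0 t)); apply: le_trans (le_trans markov h) _.
rewrite -[leRHS]mulrA -expRD ler_wpM2l// ler_expR /t.
have : x ^+ 2 * mu <= x ^+ 2 * M by rewrite ler_wpM2l// sqr_ge0.
lra.
Qed.

Lemma draws_concentrated (R : realType) (U : finType) (W T : {set U}) (N : nat) (x M : R) :
  (N <= #|W|)%N -> (0 < #|W|)%N -> T \subset W -> 0 < x <= 2^-1 ->
  N%:R / #|W|%:R * #|T|%:R <= M ->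
  #|[set E in draws W N | 4 * x * M < `|#|E :&: T|%:R - N%:R / #|W|%:R * #|T|%:R| ]|%:R
   <= #|draws W N|%:R * (2 * expR (- (2 * x ^+ 2 * M))).
Proof.
move=> NW W0 TW /andP[x0 x2] muM.
have t1 := draws_tail NW W0 TW x2 muM.
have x2' : - x <= 2^-1 by lra.
have t2 := draws_tail NW W0 TW x2' muM; rewrite sqrrN in t2.
set mu := _ * #|T|%:R in muM t1 t2 *.
have -> : #|draws W N|%:R * (2 * expR (- (2 * x ^+ 2 * M))) =
  #|draws W N|%:R * expR (- (2 * x ^+ 2 * M)) + #|draws W N|%:R * expR (- (2 * x ^+ 2 * M)).
  by ring.
apply: le_trans (lerD t1 t2); rewrite -natrD ler_nat.
set B0 := [set _ | _]%SET; set B1 := [set _ | _]%SET; set B2 := [set _ | _]%SET.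
apply: (@leq_trans #|B1 :|: B2|); last by rewrite cardsU leq_subr.
apply: subset_leq_card; apply/fintype.subsetP => E; rewrite !inE => /andP[-> /=].
by rewrite ltr_normr => /orP[] h; apply/orP; [left|right];
  have := ler_wpM2l (ltW x0) (ltW h); lra.
Qed.

(** * Discrepancy of random corner counts *)

(** The weight of the edge from x to y in the graph that has an edge from s w to t w for
every w in E. *)
Definition corner_count (U X : finType) (s t : U -> X) (E : {set U}) (x y : X) : nat :=
  #|[set w in E | (s w == x) && (t w == y)]|.

Lemma sum_corner_count (U X : finType) (s t : U -> X) (E : {set U}) (S T : {set X}) :
  (\sum_(x in S) \sum_(y in T) corner_count s t E x y =
   #|[set w in E | (s w \in S) && (t w \in T)]|)%N.
Proof.
rewrite -sum1_card (partition_big s (mem S))/=; last first.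
  by move=> w; rewrite !inE => /andP[_ /andP[]].
apply: eq_bigr => x xS; rewrite (partition_big t (mem T))/=; last first.
  by move=> w; rewrite !inE => /andP[/andP[_ /andP[]]].
apply: eq_bigr => y yT; rewrite /corner_count -sum1_card; apply: eq_bigl => w.
rewrite !inE; have [->|] := eqVneq (s w) x; last by rewrite !andbF.
have [->|] := eqVneq (t w) y; last by rewrite !andbF.
by rewrite xS yT !andbT.
Qed.

Lemma card_union_le (R : realType) (U I : finType) (B : I -> {set U}) (P : pred I)
    (c : I -> R) (d : R) :
  (forall i, P i -> #|B i|%:R <= d * c i) ->
  #|\bigcup_(i | P i) B i|%:R <= d * \sum_(i | P i) c i.
Proof.
move=> Bc; apply: (@le_trans _ _ (\sum_(i | P i) #|B i|%:R)).
  rewrite -natr_sum ler_nat.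
  apply: (big_rec2 (fun (A : {set U}) k => (#|A| <= k)%N)); first by rewrite cards0.
  by move=> i k A _ Ak; rewrite cardsU; apply: leq_trans (leq_subr _ _) _; rewrite leq_add2l.
by rewrite mulr_sumr; apply: ler_sum.
Qed.

(** The pairs for which the Chernoff exponent of the permitted deviation exceeds
L (|S| + |T|), and hence pays for the choice of S and T. *)
Definition balanced (R : realType) (X : finType) (D eta L : R) (S T : {set X}) : bool :=
  [&& S != finset.set0, T != finset.set0 &
   L * (#|S|%:R + #|T|%:R) <= eta ^+ 2 * (D * Num.sqrt (#|S|%:R * #|T|%:R)) / 32].

(** If the Chernoff exponent is too small for S and T, their sizes must be so far
apart that the smaller one is a small multiple of the geometric mean; the degree
bound on the smaller set is then as good as the discrepancy bound. *)
Lemma unbalanced_min (R : realType) (D eta L s t : R) :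
  0 < s -> 0 < t -> 0 <= L -> 0 < eta <= 1 -> 0 < D -> 128 * L <= eta ^+ 3 * D ->
  eta ^+ 2 * (D * Num.sqrt (s * t)) / 32 < L * (s + t) ->
  2 * Num.min s t <= eta * Num.sqrt (s * t).
Proof.
move=> s0 t0 L0 /andP[e0 e1] D0 LD.
wlog st : s t s0 t0 / s <= t.
  move=> h; case/orP: (le_total s t) => [st|ts]; first exact: h.
  move=> u; have := h _ _ t0 s0 ts; rewrite (mulrC t) (addrC t) minC; exact.
rewrite min_l//; set r := Num.sqrt (s * t) => unb.
have r0 : 0 < r by rewrite sqrtr_gt0 mulr_gt0.
have rr : r * r = s * t by rewrite -expr2 sqr_sqrtr// mulr_ge0// ltW.
have {}unb : eta ^+ 2 * D * r < 64 * L * t.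
  have : L * (s + t) <= L * (t + t) by rewrite ler_wpM2l// lerD2r.
  lra.
have h1 : eta ^+ 2 * D * s < 64 * L * r.
  rewrite -(ltr_pM2r t0).
  have -> : eta ^+ 2 * D * s * t = eta ^+ 2 * D * r * r by rewrite -!mulrA rr.
  have -> : 64 * L * r * t = 64 * L * t * r by ring.
  by rewrite ltr_pM2r.
have h2 : eta ^+ 2 * D * (2 * s) <= eta ^+ 2 * D * (eta * r).
  have : 128 * L * r <= eta ^+ 3 * D * r by rewrite ler_wpM2r// ltW.
  have -> : eta ^+ 2 * D * (eta * r) = eta ^+ 3 * D * r by ring.
  lra.
by rewrite -(ler_pM2l (x := eta ^+ 2 * D))// mulr_gt0// exprn_gt0.
Qed.

Definition good_draw (R : realType) (U X : finType) (s t u : U -> X) (D eta : R) (E : {set U}) :=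
  quasirandom D eta (fun x y => (corner_count s t E x y)%:R)
  /\ forall c, #|[set w in E | u w == c]|%:R <= (1 + eta) * D.

(** The words in W should be spread almost evenly over the corners.  Each count in
question has mean at most M, where M is D for degrees and D sqrt (|S| |T|) for
pairs of sets.  By [draws_concentrated] it deviates by eta M / 2 with probability
at most 2 exp (- eta^2 M / 32); the other half of eta absorbs the uneven
spread of W.  For degrees this is at most 2 exp (- L); for balanced pairs
it is at most 2 exp (- L (|S| + |T|)), which sums to O ((n exp (- L))^2) over all
pairs.  Unbalanced pairs follow from the degrees. *)
Lemma bad_draws_le (R : realType) (U X : finType) (s t u : U -> X) (W : {set U}) (N : nat)
    (D eta L : R) :
  (forall S T : {set X}, `|#|[set w in W | (s w \in S) && (t w \in T)]|%:R
     - #|X|%:R * (#|S|%:R * #|T|%:R)| <= 3 * #|X|%:R * (minn #|S| #|T|)%:R :> R) ->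
  (forall S T : {set X}, #|[set w in W | (s w \in S) && (t w \in T)]| <= #|X| * (#|S| * #|T|))%N ->
  (forall c, #|[set w in W | u w == c]| <= #|X| * #|X|)%N ->
  (0 < N <= #|W|)%N -> D = N%:R / #|W|%:R * (#|X|%:R * #|X|%:R) ->
  0 <= L -> 0 < eta <= 1 -> 6 / #|X|%:R <= eta -> 128 * L <= eta ^+ 3 * D ->
  #|X|%:R * expR (- L) <= 2^-1 ->
  #|[set E in draws W N | ~~ `[< good_draw s t u D eta E >] ]|%:R <=
    #|draws W N|%:R * (10 * (#|X|%:R * expR (- L))).
Proof.
move=> W1 W2 W3 /andP[N0 NW] DE L0 /andP[e0 e1] nE LD nz.
set n : R := #|X|%:R in W1 DE nE nz *; set z := expR (- L) in nz *.
have W0 : (0 < #|W|)%N by exact: leq_trans NW.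
pose q : R := N%:R / #|W|%:R.
have q0 : 0 < q by rewrite divr_gt0// ltr0n.
have n0 : 0 < n.
  rewrite ltr0n lt0n; apply/negP => /eqP X0; move: W0; rewrite lt0n => /negP; apply.
  rewrite cards_eq0; apply/eqP/finset.setP => w; rewrite inE; apply/negbTE/negP => wW.
  by have := card0_eq X0 (s w); rewrite inE.
have D0 : 0 < D by rewrite DE -/q; apply: mulr_gt0 => //; exact: mulr_gt0.
pose TST (S T : {set X}) := [set w in W | (s w \in S) && (t w \in T)]%SET.
pose dev (T : {set U}) (M : R) :=
  [set E in draws W N | 4 * (eta / 8) * M < `|#|E :&: T|%:R - q * #|T|%:R| ]%SET.
(* The parameter eta / 8 permits a deviation of 4 (eta / 8) M = eta M / 2. *)
have e8 : 0 < eta / 8 <= 2^-1 by apply/andP; split; lra.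
have devle (T : {set U}) M : T \subset W -> q * #|T|%:R <= M ->
    #|dev T M|%:R <= #|draws W N|%:R * (2 * expR (- (eta ^+ 2 * M / 32))).
  move=> TW qT; have := draws_concentrated NW W0 TW e8 qT; rewrite -/q.
  by rewrite (_ : 2 * (eta / 8) ^+ 2 * M = eta ^+ 2 * M / 32)//; field.
have TSTW S T : TST S T \subset W by apply/fintype.subsetP => w; rewrite inE => /andP[].
have nM (S : {set X}) : #|S|%:R <= n by rewrite ler_nat max_card.
have sq (S T : {set X}) : #|S|%:R * #|T|%:R <= n * Num.sqrt (#|S|%:R * #|T|%:R) :> R.
  set a : R := _ * _; have a0 : 0 <= a by rewrite mulr_ge0.
  rewrite -{1}(sqr_sqrtr a0) expr2; apply: ler_wpM2r; first exact: sqrtr_ge0.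
  rewrite -[leRHS](ger0_norm (ltW n0)) -sqrtr_sqr ler_sqrt ?sqr_ge0//.
  by rewrite expr2; apply: ler_pM.
have qn2 : q * (n * n) = D by rewrite DE.
have TSTq (S T : {set X}) : q * #|TST S T|%:R <= D / n * (#|S|%:R * #|T|%:R).
  rewrite -qn2 (_ : q * (n * n) / n = q * n); last by field; rewrite gt_eqF.
  by rewrite -mulrA ler_pM2l// -!natrM ler_nat; exact: W2.
have TSTm (S T : {set X}) : q * #|TST S T|%:R <= D * Num.sqrt (#|S|%:R * #|T|%:R).
  apply: le_trans (TSTq S T) _; rewrite -mulrA ler_pM2l// mulrC ler_pdivrMr// [leRHS]mulrC.
  exact: sq.
have TSTmin (S T : {set X}) : `|q * #|TST S T|%:R - D / n * (#|S|%:R * #|T|%:R)| <=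
    eta / 2 * (D * (minn #|S| #|T|)%:R).
  rewrite (_ : D / n = q * n); last by rewrite -qn2; field; rewrite gt_eqF.
  rewrite -mulrA -mulrBr normrM (gtr0_norm q0).
  apply: le_trans (ler_wpM2l (ltW q0) (W1 S T)) _.
  rewrite (_ : q * _ = (6 / n) / 2 * (D * (minn #|S| #|T|)%:R)); last first.
    by rewrite -qn2; field; rewrite gt_eqF.
  apply: ler_wpM2r; last lra.
  by rewrite mulr_ge0// ltW.
have TSTmean (S T : {set X}) : `|q * #|TST S T|%:R - D / n * (#|S|%:R * #|T|%:R)| <=
    eta / 2 * (D * Num.sqrt (#|S|%:R * #|T|%:R)).
  apply: le_trans (TSTmin S T) _; apply: ler_wpM2l; first lra.
  apply: ler_wpM2l; first exact: ltW.
  rewrite -[leLHS](ger0_norm (ler0n _ _)) -sqrtr_sqr ler_sqrt ?mulr_ge0//.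
  rewrite expr2 -!natrM ler_nat; apply: leq_mul; [exact: geq_minl|exact: geq_minr].
(* The bad events: a balanced pair of sets, a third letter, or the degree at one
   of the two ends of a corner deviates. *)
pose B1 := \bigcup_(ST : {set X} * {set X} | balanced D eta L ST.1 ST.2)
  dev (TST ST.1 ST.2) (D * Num.sqrt (#|ST.1|%:R * #|ST.2|%:R)).
pose B2 := (\bigcup_(c : X) dev [set w in W | u w == c] D)%SET.
pose B3 := (\bigcup_(x : X) dev (TST [set x] finset.setT) D)%SET.
pose B4 := (\bigcup_(y : X) dev (TST finset.setT [set y]) D)%SET.
have etaL : L <= eta ^+ 2 * D / 32.
  have : eta ^+ 3 * D <= eta ^+ 2 * D.
    rewrite exprS -mulrA ler_piMl// mulr_ge0 ?sqr_ge0//; exact: ltW.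
  lra.
have zE : expR (- (eta ^+ 2 * D / 32)) <= z by rewrite ler_expR lerN2.
have single (F : X -> {set U}) : (forall x, F x \subset W) ->
    (forall x, q * #|F x|%:R <= D) ->
    #|(\bigcup_x dev (F x) D)%SET|%:R <= #|draws W N|%:R * (2 * (n * z)).
  move=> FW Fq; apply: le_trans (card_union_le (c := fun => 2 * z) _) _.
    move=> x _; apply: le_trans (devle _ _ (FW x) (Fq x)) _.
    by apply: ler_wpM2l => //; apply: ler_wpM2l.
  by rewrite sum_constE; apply: ler_wpM2l => //; rewrite mulrCA mulrC mulrA.
have subW (P : pred U) : [set w in W | P w]%SET \subset W.
  by apply/fintype.subsetP => w; rewrite inE => /andP[].
have qcard (k : nat) : (k <= #|X| * #|X|)%N -> q * k%:R <= D.
  by move=> k2; rewrite -qn2 ler_pM2l// -natrM ler_nat.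
have B2le : #|B2|%:R <= #|draws W N|%:R * (2 * (n * z)).
  by apply: single => x; [exact: subW|exact/qcard/W3].
have B3le : #|B3|%:R <= #|draws W N|%:R * (2 * (n * z)).
  apply: single => x; first exact: TSTW.
  by apply: qcard; apply: leq_trans (W2 _ _) _; rewrite cards1 mul1n cardsT.
have B4le : #|B4|%:R <= #|draws W N|%:R * (2 * (n * z)).
  apply: single => x; first exact: TSTW.
  by apply: qcard; apply: leq_trans (W2 _ _) _; rewrite cards1 muln1 cardsT.
have B1le : #|B1|%:R <= #|draws W N|%:R * (2 * (2 * (n * z)) ^+ 2).
  apply: le_trans (card_union_le
     (c := fun ST : {set X} * {set X} => 2 * (z ^+ #|ST.1| * z ^+ #|ST.2|)) _) _.
    move=> [S T] /= /and3P[_ _ bal]; apply: le_trans (devle _ _ (TSTW S T) (TSTm S T)) _.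
    apply: ler_wpM2l => //; apply: ler_wpM2l => //; rewrite -!expRM_natl -expRD ler_expR; lra.
  apply: ler_wpM2l => //.
  apply: (@le_trans _ _ (
      \sum_(ST : {set X} * {set X} | (ST.1 != finset.set0) && (ST.2 != finset.set0))
    2 * (z ^+ #|ST.1| * z ^+ #|ST.2|))).
    rewrite big_mkcond [leRHS]big_mkcond/=; apply: ler_sum => -[S T] _ /=.
    have zz : 0 <= 2 * (z ^+ #|S| * z ^+ #|T|) by rewrite !mulr_ge0// exprn_ge0// expR_ge0.
    by rewrite /balanced; case: (S != _); case: (T != _) => //=; case: ifP.
  rewrite -(pair_big (fun S : {set X} => S != finset.set0) (fun S : {set X} => S != finset.set0)
    (fun S T => 2 * (z ^+ #|S| * z ^+ #|T|)))/=.
  under eq_bigr do rewrite -mulr_sumr -mulr_sumr.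
  rewrite -mulr_sumr -mulr_suml -expr2 ler_wpM2l//.
  (* Over the nonempty sets, z^|S| sums to (1 + z)^n - 1 <= exp (n z) - 1. *)
  have sumz : \sum_(S : {set X} | S != finset.set0) z ^+ #|S| = (1 + z) ^+ #|X| - 1.
    rewrite -cardsT -sum_subset_exp [in RHS](bigD1 finset.set0) ?finset.sub0set//=.
    rewrite cards0 expr0 addrC addrK; apply: eq_bigl => S.
    by rewrite finset.subsetT.
  have z0 : 0 <= z by exact: expR_ge0.
  have lo : 0 <= (1 + z) ^+ #|X| - 1 by rewrite subr_ge0 exprn_ege1// lerDl.
  have nz0 : 0 <= n * z by rewrite mulr_ge0// ltW.
  rewrite sumz; apply: lerXn2r; rewrite ?nnegrE//; first exact: mulr_ge0.
  rewrite lerBlDl; apply: (@le_trans _ _ (expR (n * z))).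
    rewrite expRM_natl; apply: lerXn2r; rewrite ?nnegrE ?expR_ge0 ?addr_ge0//.
    exact: expR_ge1Dx.
  apply: le_trans (expR_le_quadratic nz) _.
  have : (n * z) * (n * z) <= (n * z) * 2^-1.
    by apply: ler_wpM2l => //; rewrite mulr_ge0// ltW.
  rewrite expr2; lra.
apply: (@le_trans _ _ #|B1 :|: B2 :|: (B3 :|: B4)|%:R); last first.
  have cU (A B : {set {set U}}) : #|A :|: B|%:R <= #|A|%:R + #|B|%:R :> R.
    by rewrite -natrD ler_nat cardsU leq_subr.
  have h : 2 * (2 * (n * z)) ^+ 2 <= 4 * (n * z).
    have : (n * z) * (n * z) <= (n * z) * 2^-1.
      by apply: ler_wpM2l => //; rewrite mulr_ge0 ?expR_ge0// ltW.
    lra.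
  have := ler_wpM2l (ler0n R #|draws W N|) h.
  have := cU (B1 :|: B2) (B3 :|: B4); have := cU B1 B2; have := cU B3 B4; lra.
(* A draw outside of all bad events is good. *)
rewrite ler_nat; apply: subset_leq_card; apply/fintype.subsetP => E.
rewrite inE => /andP[ED]; apply: contraR; rewrite !inE !negb_or.
move=> /andP[/andP[nB1 nB2] /andP[nB3 nB4]].
have ndev (T : {set U}) M : E \notin dev T M -> `|#|E :&: T|%:R - q * #|T|%:R| <= eta / 2 * M.
  rewrite inE ED /= -leNgt => /le_trans; apply.
  by rewrite le_eqVlt; apply/orP; left; apply/eqP; field.
have EW : E \subset W by move: ED; rewrite inE => /andP[].
have ET (P : pred U) : E :&: [set w in W | P w]%SET = [set w in E | P w]%SET.
  apply/finset.setP => w; rewrite !inE; case wE : (w \in E) => //=.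
  by rewrite (fintype.subsetP EW).
have corner (S T : {set X}) : \sum_(x in S) \sum_(y in T) (corner_count s t E x y)%:R =
    #|E :&: TST S T|%:R :> R.
  rewrite /TST ET -sum_corner_count natr_sum; apply: eq_bigr => x _.
  by rewrite natr_sum.
have sqn (S T : {set X}) : `|#|E :&: TST S T|%:R - q * #|TST S T|%:R| <=
    eta / 2 * (D * Num.sqrt (#|S|%:R * #|T|%:R)) ->
    `|#|E :&: TST S T|%:R - D / n * (#|S|%:R * #|T|%:R)| <=
    eta * D * Num.sqrt (#|S|%:R * #|T|%:R).
  move=> h; have := lerD h (TSTmean S T); move/(le_trans (ler_normD _ _)).
  rewrite addrA subrK => /le_trans; apply.
  by rewrite le_eqVlt; apply/orP; left; apply/eqP; field.
(* Degrees are the rectangles with a singleton side and a full side. *)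
have line (S T : {set X}) : (#|S| * #|T| = #|X|)%N -> (minn #|S| #|T| <= 1)%N ->
    E \notin dev (TST S T) D -> `|#|E :&: TST S T|%:R - D| <= eta * D.
  move=> ST mST /ndev h.
  have ST' : #|S|%:R * #|T|%:R = n :> R by rewrite -natrM ST.
  have q3 : `|q * #|TST S T|%:R - D| <= eta / 2 * D.
    have := TSTmin S T; rewrite ST' divfK ?gt_eqF// => /le_trans; apply.
    apply: ler_wpM2l; first lra.
    by apply: ler_piMr; [exact: ltW|rewrite -[1]/(1%:R) ler_nat].
  have := lerD h q3; move/(le_trans (ler_normD _ _)).
  rewrite addrA subrK => /le_trans; apply.
  by rewrite le_eqVlt; apply/orP; left; apply/eqP; field.
have n1 : (1 <= #|X|)%N by rewrite -(ltr0n R).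
have row x : `|#|E :&: TST [set x]%SET finset.setT|%:R - D| <= eta * D.
  apply: line; rewrite ?cards1 ?cardsT ?mul1n ?(minn_idPl n1)//.
  by apply: contra nB3 => h; apply/bigcupP; exists x.
have col y : `|#|E :&: TST finset.setT [set y]%SET|%:R - D| <= eta * D.
  apply: line; rewrite ?cards1 ?cardsT ?muln1 ?(minn_idPr n1)//.
  by apply: contra nB4 => h; apply/bigcupP; exists y.
have rowE x : \sum_y (corner_count s t E x y)%:R = #|E :&: TST [set x]%SET finset.setT|%:R :> R.
  by rewrite -corner big_set1; apply: eq_bigl => y; rewrite inE.
have colE y : \sum_x (corner_count s t E x y)%:R = #|E :&: TST finset.setT [set y]%SET|%:R :> R.
  by rewrite -corner; apply: eq_big => [x|x _]; rewrite ?inE// big_set1.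
have etaD : eta * D <= D by apply: ler_piMl => //; exact: ltW.
have up (k : R) : `|k - D| <= eta * D -> k <= 2 * D.
  rewrite ler_norml => /andP[_]; lra.
have cc0 x y : 0 <= (corner_count s t E x y)%:R :> R by [].
split; last first.
  move=> c; have /ndev : E \notin dev [set w in W | u w == c]%SET D.
    by apply: contra nB2 => h; apply/bigcupP; exists c.
  rewrite ET ler_norml => /andP[_]; have := qcard _ (W3 c).
  have : 0 <= eta * D by rewrite mulr_ge0// ltW.
  lra.
split => //.
- by move=> x; rewrite rowE.
- by move=> y; rewrite colE.
move=> S T; rewrite corner.
have [->|S0] := eqVneq S finset.set0.
  rewrite [X in `|X - _|](_ : _ = 0).
    by rewrite cards0 mul0r mulr0 subrr normr0 sqrtr0 mulr0.
  apply/eqP; rewrite pnatr_eq0 cards_eq0; apply/eqP/finset.setP => w.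
  by rewrite finset.in_setI finset.in_set !finset.in_set0 !andbF.
have [->|T0] := eqVneq T finset.set0.
  rewrite [X in `|X - _|](_ : _ = 0).
    by rewrite cards0 !mulr0 subrr normr0 sqrtr0 mulr0.
  apply/eqP; rewrite pnatr_eq0 cards_eq0; apply/eqP/finset.setP => w.
  by rewrite finset.in_setI finset.in_set !finset.in_set0 !andbF.
have [bal|unbal] := boolP (balanced D eta L S T).
  apply/sqn/ndev; apply: contra nB1 => h; apply/bigcupP; exists (S, T) => //.
have s0 : 0 < #|S|%:R :> R by rewrite ltr0n card_gt0.
have t0 : 0 < #|T|%:R :> R by rewrite ltr0n card_gt0.
have {}unbal : eta ^+ 2 * (D * Num.sqrt (#|S|%:R * #|T|%:R)) / 32 < L * (#|S|%:R + #|T|%:R).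
  by move: unbal; rewrite /balanced S0 T0 /= -ltNge.
have e01 : 0 < eta <= 1 by rewrite e0 e1.
have mn := unbalanced_min s0 t0 L0 e01 D0 LD unbal.
(* Count from the smaller side: each of its points has degree at most 2 D. *)
have upper : `|#|E :&: TST S T|%:R - D / n * (#|S|%:R * #|T|%:R)| <=
    D * (2 * Num.min #|S|%:R #|T|%:R).
  have bnd (k v c : R) : 0 <= k -> 0 <= v -> k <= 2 * D * c -> v <= D * c -> 0 <= c ->
      `|k - v| <= D * (2 * c).
    move=> k0 v0 kc vc c0; have : 0 <= D * c by rewrite mulr_ge0// ltW.
    by rewrite ler_norml => Dc; apply/andP; split; lra.
  have Dn (a b : R) : 0 <= a -> b <= n -> D / n * (a * b) <= D * a.
    move=> a0 bn; rewrite -mulrA ler_pM2l// mulrC ler_pdivrMr//.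
    exact: ler_wpM2l.
  have v0 : 0 <= D / n * (#|S|%:R * #|T|%:R) by rewrite mulr_ge0 ?divr_ge0 ?mulr_ge0// ltW.
  have sumS : #|E :&: TST S T|%:R <= 2 * D * #|S|%:R :> R.
    rewrite -corner -[leRHS]sum_constE; apply: ler_sum => x _.
    apply: le_trans (up _ (row x)); rewrite -rowE [leRHS](bigID (mem T))/=.
    by rewrite lerDl sumr_ge0.
  have sumT : #|E :&: TST S T|%:R <= 2 * D * #|T|%:R :> R.
    rewrite -corner -[leRHS]sum_constE exchange_big/=; apply: ler_sum => y _.
    apply: le_trans (up _ (col y)); rewrite -colE [leRHS](bigID (mem S))/=.
    by rewrite lerDl sumr_ge0.
  have [st|ts] := leP (#|S|%:R : R) #|T|%:R.
    by apply: bnd => //; exact: Dn.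
  by apply: bnd => //; rewrite (mulrC #|S|%:R); exact: Dn.
apply: le_trans upper _; rewrite (mulrC eta) -mulrA; apply: ler_wpM2l => //; exact: ltW.
Qed.

(** * Cyclically reduced words of length three *)

Definition letter1 (X : Type) (w : 3.-tuple X) : X := tnth w (@Ordinal 3 0 isT).
Definition letter2 (X : Type) (w : 3.-tuple X) : X := tnth w (@Ordinal 3 1 isT).
Definition letter3 (X : Type) (w : 3.-tuple X) : X := tnth w (@Ordinal 3 2 isT).
(** A relator a b c = 1 gives a^-1 = b c: the translates of a vector by a^-1 and by b
are as far apart as those by c and by 1. *)
Definition corner_source (S : Type) (w : 3.-tuple (letter S)) : letter S := letter_inv (letter1 w).

Lemma letter_invK (S : Type) : involutive (@letter_inv S).
Proof. by move=> [s b]; rewrite /letter_inv /= negbK. Qed.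

Lemma letter_tupleE (X : Type) (a b c : X) :
  (letter1 [tuple a; b; c] = a) * (letter2 [tuple a; b; c] = b) * (letter3 [tuple a; b; c] = c).
Proof. by []. Qed.

Lemma tuple3_eta (X : Type) (w : 3.-tuple X) : w = [tuple letter1 w; letter2 w; letter3 w].
Proof. by case: w => [[|a [|b [|c []]]]] // i; apply: val_inj. Qed.

Lemma card_tuple3 (X : finType) (P : pred (3.-tuple X)) :
  #|[set w | P w]%SET| = (\sum_a \sum_b \sum_c P [tuple a; b; c])%N.
Proof.
rewrite -sum1_card big_mkcond/= pair_bigA pair_bigA/=.
rewrite (reindex (fun p : X * X * X => [tuple p.1.1; p.1.2; p.2]))/=; last first.
  exists (fun w : 3.-tuple X => (letter1 w, letter2 w, letter3 w)) => [[[a b] c] _|w _] //=.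
  by rewrite -tuple3_eta.
by apply: eq_bigr => -[[a b] c] _ /=; rewrite inE; case: (P _).
Qed.

Lemma cyclically_reduced3 (S : eqType) (a b c : letter S) :
  cyclically_reduced [:: a; b; c] = [&& b != letter_inv a, c != letter_inv b & a != letter_inv c].
Proof. by rewrite /cyclically_reduced /= andbT. Qed.

Definition reduced_words (m : nat) : {set 3.-tuple (letter 'I_m)} :=
  [set w : 3.-tuple (letter 'I_m) | cyclically_reduced w]%SET.

Lemma card_letter (m : nat) : #|{: letter 'I_m}| = (2 * m)%N.
Proof. by rewrite card_prod card_ord card_bool mulnC. Qed.

(** The number of z for which x^-1 y z is cyclically reduced. *)
Definition third_letters (m : nat) (x y : letter 'I_m) : nat :=
  \sum_z ((y != x) && ((z != letter_inv y) && (z != x))).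

Lemma card_corner_words (m : nat) (S T : {set letter 'I_m}) :
  #|[set w in reduced_words m | (corner_source w \in S) && (letter2 w \in T)]%SET| =
  (\sum_(x in S) \sum_(y in T) third_letters x y)%N.
Proof.
rewrite card_tuple3 (reindex_inj (inv_inj (@letter_invK _)))/= [RHS]big_mkcond/=.
apply: eq_bigr => x _; rewrite /corner_source.
case xS : (x \in S); last first.
  by rewrite big1// => y _; rewrite big1// => z _; rewrite inE !letter_tupleE letter_invK xS andbF.
rewrite [RHS]big_mkcond/=; apply: eq_bigr => y _.
case yT : (y \in T); last first.
  by rewrite big1// => z _; rewrite !letter_tupleE !andbF.
apply: eq_bigr => z _; rewrite !letter_tupleE letter_invK xS ?yT andbT /reduced_words finset.in_set.
rewrite (cyclically_reduced3 (letter_inv x) y z) letter_invK.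
by rewrite (inj_eq (inv_inj (@letter_invK _))) (eq_sym x z) andbT.
Qed.

Lemma third_letters_le (m : nat) (x y : letter 'I_m) : (third_letters x y <= 2 * m)%N.
Proof.
rewrite -card_letter -sum1_card /third_letters; apply: leq_sum => z _; exact: leq_b1.
Qed.

(** For y different from x the word x^-1 y z is spoilt by at most two letters z; for
y = x it is never reduced, and the last term compensates. *)
Lemma third_letters_ge (m : nat) (x y : letter 'I_m) :
  (2 * m <= third_letters x y + 2 + (y == x) * (2 * m))%N.
Proof.
rewrite /third_letters; have [->|yx] := eqVneq y x; first by rewrite mul1n leq_addl.
rewrite mul0n addn0 -card_letter.
have -> : (\sum_z ((z != letter_inv y) && (z != x)))%N = #|~: [set letter_inv y; x]%SET|.
  rewrite -sum1_card [RHS]big_mkcond/=; apply: eq_bigr => z _.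
  by rewrite !inE negb_or; case: (_ && _).
rewrite -(cardsC [set letter_inv y; x]%SET) addnC leq_add2l.
by rewrite cards2; case: (_ != _).
Qed.

Lemma card_corner_words_le (m : nat) (S T : {set letter 'I_m}) :
  (#|[set w in reduced_words m | (corner_source w \in S) && (letter2 w \in T)]%SET|
    <= #|{: letter 'I_m}| * (#|S| * #|T|))%N.
Proof.
rewrite card_corner_words card_letter mulnC -mulnA -sum_nat_const; apply: leq_sum => x _.
by rewrite -sum_nat_const; apply: leq_sum => y _; exact: third_letters_le.
Qed.

(** The words missing from a rectangle are due to two excluded letters for each pair
(x, y), and to the diagonal, which has at most min (|S|, |T|) points. *)
Lemma card_corner_words_ge (m : nat) (S T : {set letter 'I_m}) :
  (#|{: letter 'I_m}| * (#|S| * #|T|) <=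
   #|[set w in reduced_words m | (corner_source w \in S) && (letter2 w \in T)]%SET|
    + 3 * #|{: letter 'I_m}| * minn #|S| #|T|)%N.
Proof.
rewrite card_corner_words card_letter.
have diag : (\sum_(x in S) \sum_(y in T) (y == x) * (2 * m) = #|S :&: T| * (2 * m))%N.
  rewrite -sum_nat_const big_mkcond [RHS]big_mkcond/=; apply: eq_bigr => x _.
  rewrite inE; case: (x \in S) => //=; rewrite big_mkcond (bigD1 x)//= eqxx mul1n.
  rewrite big1 ?addn0// => y /negbTE ->; by case: ifP.
apply: (@leq_trans (\sum_(x in S) \sum_(y in T)
    (third_letters x y + 2 + (y == x) * (2 * m)))%N).
  rewrite [X in (X <= _)%N]mulnC -mulnA -sum_nat_const.
  apply: leq_sum => x _; rewrite -sum_nat_const; apply: leq_sum => y _.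
  exact: third_letters_ge.
under eq_bigr do rewrite big_split/= big_split/= sum_nat_const.
rewrite big_split/= big_split/= sum_nat_const diag -addnA leq_add2l.
have ST : (#|S :&: T| <= minn #|S| #|T|)%N.
  by rewrite leq_min !subset_leq_card ?finset.subsetIl ?finset.subsetIr.
have Sm : (#|S| <= 2 * m)%N by rewrite -card_letter max_card.
have Tm : (#|T| <= 2 * m)%N by rewrite -card_letter max_card.
have h1 : (#|S| * #|T| <= 2 * m * minn #|S| #|T|)%N.
  rewrite /minn; case: ltnP => _; last by rewrite leq_mul.
  by rewrite mulnC leq_mul.
have gen (k i a b M : nat) :
  (a * b <= M * k -> i <= k -> a * (b * 2) + i * M <= 3 * M * k)%N by nia.
exact: gen.
Qed.

Lemma card_third_letter_le (m : nat) (c : letter 'I_m) :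
  (#|[set w in reduced_words m | letter3 w == c]%SET| <= #|{: letter 'I_m}| * #|{: letter 'I_m}|)%N.
Proof.
rewrite card_tuple3 -sum_nat_const; apply: leq_sum => a _.
rewrite -sum1_card; apply: leq_sum => b _.
rewrite (bigD1 c)//= big1 ?addn0 ?leq_b1// => z /negbTE zc.
by rewrite letter_tupleE zc andbF.
Qed.

Lemma bad_relators_le (R : realType) (m N : nat) (D eta L : R) :
  let n : R := (2 * m)%N%:R in
  (0 < N <= #|reduced_words m|)%N -> D = N%:R / #|reduced_words m|%:R * (n * n) ->
  0 <= L -> 0 < eta <= 1 -> 6 / n <= eta -> 128 * L <= eta ^+ 3 * D ->
  n * expR (- L) <= 2^-1 ->
  #|[set E in draws (reduced_words m) N |
      ~~ `[< good_draw (@corner_source 'I_m) (@letter2 _) (@letter3 _) D eta E >] ]%SET|%:R <=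
    #|draws (reduced_words m) N|%:R * (10 * (n * expR (- L))).
Proof.
rewrite /= -card_letter => hN hD hL he h6 h128 hz.
apply: bad_draws_le => //.
- move=> S T; have := card_corner_words_le S T; have := card_corner_words_ge S T.
  rewrite -!(ler_nat R) !natrD !natrM => h1 h2.
  rewrite ler_norml; apply/andP; split; lra.
- exact: card_corner_words_le.
- exact: card_third_letter_le.
Qed.

Lemma card_reduced_words_ge (m : nat) :
  ((2 * m) ^ 3 <= #|reduced_words m| + 3 * (2 * m) ^ 2)%N.
Proof.
have := @card_corner_words_ge m finset.setT finset.setT.
rewrite !cardsT card_letter minnn (_ : [set w in _ | _]%SET = reduced_words m).
  by rewrite !expnS expn0 !muln1; nia.
by apply/finset.setP => w; rewrite finset.in_set !finset.in_setT !andbT.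
Qed.

Lemma card_reduced_words_le (m : nat) : (#|reduced_words m| <= (2 * m) ^ 3)%N.
Proof.
by rewrite -card_letter -card_tuple; exact: max_card.
Qed.

(** * Fixed points from a Poincare inequality *)

(** With m the mean, the two numbers are m (1 + x) and m (1 - x); add the Bernoulli
inequalities for x and - x. *)
Lemma powR_midpoint (R : realType) (p a b : R) : 1 <= p -> 0 <= a -> 0 <= b ->
  ((a + b) / 2) `^ p <= (a `^ p + b `^ p) / 2.
Proof.
move=> p1 a0 b0; have [ab0|ab0] := eqVneq (a + b) 0.
  by rewrite ab0 mul0r powR0 ?divr_ge0 ?addr_ge0 ?powR_ge0//; lra.
have m0 : 0 < (a + b) / 2 by rewrite divr_gt0// lt_neqAle eq_sym ab0 addr_ge0.
set m := (a + b) / 2 in m0 *; pose x := (a - b) / (a + b).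
have xa : a = m * (1 + x) by rewrite /m /x; field.
have xb : b = m * (1 - x) by rewrite /m /x; field.
have x1 : -1 <= x by have := a0; rewrite xa pmulr_rge0//; lra.
have x2 : -1 <= - x by have := b0; rewrite xb pmulr_rge0//; lra.
clearbody m x; rewrite xa xb !powRM ?(ltW m0)//; [|lra..].
have h1 := powR_bernoulli p1 x1; have h2 := powR_bernoulli p1 x2.
by rewrite -mulrDr -mulrA ler_pMr ?powR_gt0//; lra.
Qed.

(** Completeness in the only form that the iteration uses; it is meaningful for a
normed space that has not been given a complete structure, such as [Lp]. *)
Definition geometrically_complete (R : realType) (V : normedModType R) : Prop :=
  forall (u : nat -> V) (K t : R), 0 <= t < 1 ->
    (forall k, `|u k.+1 - u k| <= K * t ^+ k) ->
    exists l, exists K', forall k, `|u k - l| <= K' * t ^+ k.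

Lemma geometric_dist (R : realType) (V : normedModType R) (u : nat -> V) (K t : R) :
  0 <= t < 1 -> (forall k, `|u k.+1 - u k| <= K * t ^+ k) ->
  forall k n, `|u (k + n)%N - u k| <= K / (1 - t) * t ^+ k.
Proof.
move=> /andP[t0 t1] uK k n.
have K0 : 0 <= K by have := uK 0%N; rewrite expr0 mulr1; apply: le_trans.
have t2 : 0 < 1 - t by lra.
suff : `|u (k + n)%N - u k| <= K / (1 - t) * (t ^+ k - t ^+ (k + n)).
  move=> h; apply: le_trans h _; rewrite ler_wpM2l ?divr_ge0 ?(ltW t2)//.
  by rewrite gerBl exprn_ge0.
elim: n => [|n ih]; first by rewrite addn0 !subrr normr0 mulr0.
have -> : u (k + n.+1)%N - u k = (u (k + n).+1 - u (k + n)%N) + (u (k + n)%N - u k).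
  by rewrite addnS subrKA.
apply: le_trans (ler_normD _ _) _; apply: le_trans (lerD (uK _) ih) _.
rewrite addnS exprS le_eqVlt; apply/orP; left; apply/eqP; field; lra.
Qed.

Lemma complete_geometrically (R : realType) (V : completeNormedModType R) :
  geometrically_complete V.
Proof.
move=> u K t tt uK; have /andP[t0 t1] := tt.
pose d k := u k.+1 - u k.
have cs : cvgn (series d).
  apply: normed_cvg; apply: (@series_le_cvg _ _ (geometric K t)) => //.
  - by move=> k; exact: normr_ge0.
  - by move=> k; exact: le_trans (normr_ge0 _) (uK k).
  by apply: is_cvg_geometric_series; rewrite ger0_norm.
have seriesE n : series d n = u n - u 0%N.
  by rewrite /series/= telescope_sumr.
exists (limn (series d) + u 0%N), (K / (1 - t)) => k.
have cu : u @ \oo --> limn (series d) + u 0%N.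
  have : (fun n => series d n + u 0%N) @ \oo --> limn (series d) + u 0%N.
    by apply: cvgD; [exact: cs|exact: cvg_cst].
  by under eq_fun do rewrite seriesE subrK.
have cn : `|u k - u n| @[n --> \oo] --> `|u k - (limn (series d) + u 0%N)|.
  by apply: cvg_norm; apply: cvgB; [exact: cvg_cst|exact: cu].
apply: (cvgr_to_le cn); exists k => // n /= kn.
by rewrite distrC -(subnKC kn); exact: geometric_dist.
Qed.

Lemma le0_of_geometric (R : realType) (a K t : R) : 0 <= t < 1 ->
  (forall k, a <= K * t ^+ k) -> a <= 0.
Proof.
move=> /andP[t0 t1] h.
have c : K * t ^+ k @[k --> \oo] --> (0 : R).
  by apply: cvg_geometric; rewrite ger0_norm.
by apply: (cvgr_to_ge c); apply: nearW.
Qed.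

Lemma scaler_half (R : numFieldType) (V : lmodType R) (v : V) : 2^-1 *: (v + v) = v.
Proof.
by rewrite scalerDr -scalerDl -[RHS]scale1r; congr (_ *: _); rewrite -div1r -splitr.
Qed.

Lemma action_dist (R : realType) (V : normedModType R) (G : groupType) (alpha : G -> V -> V)
    (g : G) (u v : V) : affine_isometric_action alpha ->
  `|alpha g u - alpha g v| = `|u - v|.
Proof.
move=> [_ _ aff _]; have [f [b [fn fE]]] := aff g.
by rewrite !fE -[RHS]fn linearB opprD addrACA subrr addr0.
Qed.

Lemma action_midpoint (R : realType) (V : normedModType R) (G : groupType) (alpha : G -> V -> V)
    (g : G) (u v : V) : affine_isometric_action alpha ->
  alpha g (2^-1 *: (u + v)) = 2^-1 *: (alpha g u + alpha g v).
Proof.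
move=> [_ _ aff _]; have [f [b [fn fE]]] := aff g.
rewrite !fE linearZ/= linearD.
have -> : f u + b + (f v + b) = (f u + f v) + (b + b) by rewrite addrACA.
rewrite [RHS]scalerDr; congr (_ + _).
by rewrite scaler_half.
Qed.

Lemma actionK (R : realType) (V : normedModType R) (G : groupType) (alpha : G -> V -> V)
    (g : G) (v : V) : affine_isometric_action alpha ->
  alpha g^-1%g (alpha g v) = v.
Proof. by move=> [a1 aM _ _]; rewrite -aM mulVg a1. Qed.

(** Apply the isometry g^-1. *)
Lemma action_swap (R : realType) (V : normedModType R) (G : groupType) (alpha : G -> V -> V)
    (g : G) (u v : V) : affine_isometric_action alpha ->
  `|alpha g u - v| = `|alpha g^-1%g v - u|.
Proof. by move=> act; rewrite -(action_dist g^-1%g _ _ act) (actionK _ _ act) distrC. Qed.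

(** From v pass to the midpoint of v and the point c that the Poincare inequality
yields for the orbit map x -> x v.  The energy is multiplied by at most
B / kappa < 1 while v moves by at most the p-th root of its energy, so the
sequence of iterates is geometric, and the energy of its limit is zero. *)
Theorem fixed_point_of_poincare (R : realType) (V : normedModType R) (G : groupType)
    (alpha : G -> V -> V) (U X : finType) (gen : X -> G) (inv : X -> X)
    (s t u : U -> X) (E : {set U}) (p B kappa : R) :
  affine_isometric_action alpha -> geometrically_complete V ->
  involutive inv -> (forall x, gen (inv x) = (gen x)^-1)%g ->
  (forall v, (forall x, alpha (gen x) v = v) -> forall g, alpha g v = v) ->
  (forall w, w \in E -> (gen (s w))^-1 * gen (t w) * gen (u w) = 1)%g ->
  1 <= p -> 0 <= B < kappa ->
  (forall c, #|[set w in E | u w == c]|%:R <= B) ->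
  (forall F : X -> V, exists c, kappa * \sum_x `|F x - c| `^ p <=
     \sum_x \sum_y (corner_count s t E x y)%:R * `|F x - F y| `^ p) ->
  has_fixed_point alpha.
Proof.
move=> act compl invK genV gens rels p1 /andP[B0 Bk] third poincare.
have p0 : 0 < p by lra.
have k0 : 0 < kappa by lra.
pose energy v := \sum_x `|alpha (gen x) v - v| `^ p.
have energy0 v : 0 <= energy v by apply: sumr_ge0 => x _; exact: powR_ge0.
have powRK (a : R) : 0 <= a -> (a `^ p) `^ p^-1 = a.
  by move=> a0; rewrite -powRrM mulfV ?powRr1// gt_eqF.
have energyx x v : `|alpha (gen x) v - v| <= energy v `^ p^-1.
  rewrite -[leLHS]powRK//.
  apply: ge0_ler_powR; rewrite ?nnegrE ?powR_ge0 ?invr_ge0 ?(ltW p0)//.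
  by rewrite /energy (bigD1 x)//= lerDl sumr_ge0// => y _; exact: powR_ge0.
have [x0|X0] := pickP X; last first.
  by exists 0; apply: gens => x; have := X0 x.
(* A relator turns the corner from s w to t w into a displacement by u w. *)
have corners v : \sum_x \sum_y (corner_count s t E x y)%:R *
    `|alpha (gen x) v - alpha (gen y) v| `^ p <= B * energy v.
  have -> : \sum_x \sum_y (corner_count s t E x y)%:R *
      `|alpha (gen x) v - alpha (gen y) v| `^ p =
      \sum_(w in E) `|alpha (gen (u w)) v - v| `^ p.
    rewrite [RHS](partition_big s predT)//=; apply: eq_bigr => x _.
    rewrite [RHS](partition_big t predT)//=; apply: eq_bigr => y _.
    rewrite /corner_count -sum1_card natr_sum mulr_suml.
    apply: eq_big => [w|w]; first by rewrite inE andbA.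
    rewrite inE => /and3P[wE /eqP sw /eqP tw]; rewrite mul1r; congr (_ `^ _).
    have [a1 aM _ _] := act.
    have e : (gen (t w) * gen (u w) = gen (s w))%g.
      by have := rels w wE; rewrite -mulgA => /mulg1_eq <-; rewrite invgK.
    rewrite -sw -tw -e aM (action_dist _ _ _ act); done.
  rewrite (partition_big u predT)//= mulr_sumr; apply: ler_sum => c _.
  rewrite (eq_bigr (fun => `|alpha (gen c) v - v| `^ p)) => [|w /andP[_ /eqP ->]//].
  rewrite sumr_const -[leLHS]mulr_natl; apply: ler_wpM2r; first exact: powR_ge0.
  apply: le_trans (third c); rewrite ler_nat; apply: subset_leq_card.
  by apply/fintype.subsetP => w; rewrite inE.
have step v : exists w, energy w <= B / kappa * energy v /\ `|w - v| <= energy v `^ p^-1.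
  have [c hc] := poincare (fun x => alpha (gen x) v).
  pose Q := \sum_x `|alpha (gen x) v - c| `^ p.
  have Qle : Q <= B / kappa * energy v.
    rewrite mulrAC ler_pdivlMr// mulrC; exact: le_trans hc (corners v).
  exists (2^-1 *: (v + c)); split.
    apply: le_trans Qle; rewrite /energy.
    (* The midpoint identity; the second half is moved to x^-1 by an isometry. *)
    have half x : `|alpha (gen x) (2^-1 *: (v + c)) - 2^-1 *: (v + c)| `^ p <=
        (`|alpha (gen x) v - c| `^ p + `|alpha (gen (inv x)) v - c| `^ p) / 2.
      apply: le_trans (powR_midpoint p1 (normr_ge0 _) (normr_ge0 _)).
      apply: ge0_ler_powR; rewrite ?nnegrE ?divr_ge0 ?addr_ge0 ?(ltW p0)//.
      rewrite (action_midpoint _ _ _ act) -scalerBr normrZ ger0_norm ?invr_ge0//.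
      rewrite mulrC ler_wpM2r ?invr_ge0//.
      rewrite genV -(action_swap _ _ _ act).
      have -> : alpha (gen x) v + alpha (gen x) c - (v + c) =
        (alpha (gen x) v - c) + (alpha (gen x) c - v).
        by rewrite opprD (addrC (- v)) addrACA.
      exact: ler_normD.
    apply: le_trans (ler_sum _ (fun x _ => half x)) _.
    have Qinv : \sum_x `|alpha (gen (inv x)) v - c| `^ p = Q.
      by rewrite /Q [RHS](reindex_inj (inv_inj invK)).
    rewrite -mulr_suml big_split/= Qinv -/Q; lra.
  have -> : 2^-1 *: (v + c) - v = 2^-1 *: (c - v).
    rewrite {2}(_ : v = 2^-1 *: (v + v)) -?scalerBr; last by rewrite scaler_half.
    by congr (_ *: _); rewrite opprD addrACA subrr add0r.
  rewrite normrZ ger0_norm ?invr_ge0//.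
  have h : `|c - v| <= `|alpha (gen x0) v - c| + `|alpha (gen x0) v - v|.
    rewrite (_ : c - v = (alpha (gen x0) v - v) - (alpha (gen x0) v - c)); last first.
      by rewrite opprB [RHS]addrC subrKA.
    by rewrite [leRHS]addrC; exact: ler_normB.
  apply: (@le_trans _ _ ((`|alpha (gen x0) v - c| + `|alpha (gen x0) v - v|) / 2)); first lra.
  rewrite -[leLHS]powRK ?divr_ge0 ?addr_ge0//.
  apply: ge0_ler_powR; rewrite ?nnegrE ?powR_ge0 ?invr_ge0 ?(ltW p0)//.
  apply: le_trans (powR_midpoint p1 (normr_ge0 _) (normr_ge0 _)) _.
  have h1 : `|alpha (gen x0) v - c| `^ p <= Q.
    by rewrite /Q (bigD1 x0)//= lerDl sumr_ge0// => y _; exact: powR_ge0.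
  have h2 : `|alpha (gen x0) v - v| `^ p <= energy v.
    by rewrite /energy (bigD1 x0)//= lerDl sumr_ge0// => y _; exact: powR_ge0.
  have h3 : B / kappa * energy v <= energy v.
    by rewrite ler_piMl// ler_pdivrMr// mul1r ltW.
  lra.
(* Here r is the contraction ratio of the energy, and th that of its p-th root. *)
have [nxt nxtP] := choice step.
pose v k := iter k nxt 0.
pose r := B / kappa.
have r0 : 0 <= r by rewrite divr_ge0// ltW.
have r1 : r < 1 by rewrite ltr_pdivrMr// mul1r.
pose th := r `^ p^-1.
have th01 : 0 <= th < 1.
  rewrite powR_ge0/= [ltRHS](_ : 1 = 1 `^ p^-1); last by rewrite powR1.
  by apply: gt0_ltr_powR; rewrite ?nnegrE ?invr_gt0.
have Ev k : energy (v k) <= r ^+ k * energy 0.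
  elim: k => [|k ih]; first by rewrite expr0 mul1r.
  apply: le_trans (nxtP (v k)).1 _; rewrite exprS -[leRHS]mulrA.
  exact: ler_wpM2l.
have Ev' k : energy (v k) `^ p^-1 <= energy 0 `^ p^-1 * th ^+ k.
  have -> : energy 0 `^ p^-1 * th ^+ k = (r ^+ k * energy 0) `^ p^-1.
    rewrite powRM ?exprn_ge0// mulrC; congr (_ * _).
    by rewrite -(powR_mulrn k (powR_ge0 r p^-1)) -(powR_mulrn k r0) powRAC.
  by apply: ge0_ler_powR; rewrite ?nnegrE ?mulr_ge0 ?exprn_ge0 ?invr_ge0 ?(ltW p0).
have [l [K hl]] := compl v (energy 0 `^ p^-1) th th01
  (fun k => le_trans (nxtP (v k)).2 (Ev' k)).
exists l; apply: gens => x; apply/eqP; rewrite -subr_eq0 -normr_le0.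
apply: (@le0_of_geometric _ _ (2 * K + energy 0 `^ p^-1) th) => // k.
have e : alpha (gen x) l - l = (alpha (gen x) l - alpha (gen x) (v k)) +
   (alpha (gen x) (v k) - v k) + (v k - l).
  by rewrite subrKA subrKA.
rewrite e; apply: le_trans (ler_normD _ _) _; apply: le_trans (lerD (ler_normD _ _) (lexx _)) _.
rewrite (action_dist _ _ _ act) distrC.
rewrite (_ : (2 * K + energy 0 `^ p^-1) * th ^+ k =
  K * th ^+ k + energy 0 `^ p^-1 * th ^+ k + K * th ^+ k); last by clear; ring.
by apply: lerD (hl k); apply: lerD (hl k) _; exact: le_trans (energyx x (v k)) (Ev' k).
Qed.

(** * Poincare inequalities for maps to l^p *)

(** The mean is used in place of an optimal constant because it is linear in f: taken
in every coordinate, it stays in the function space. *)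
Definition scalar_poincare (R : realType) (X : finType) (p kappa : R) (A : X -> X -> R) : Prop :=
  forall f : X -> R,
    kappa * \sum_x `|f x - (\sum_y f y) / #|X|%:R| `^ p
    <= \sum_x \sum_y A x y * `|f x - f y| `^ p.

Definition vector_poincare (R : realType) (X : finType) (p kappa : R) (A : X -> X -> R)
    (U : zmodType) (normU : U -> R) (B : set U) : Prop :=
  forall F : X -> U, (forall x, B (F x)) -> exists2 c, B c &
    kappa * \sum_x normU (F x - c) `^ p
    <= \sum_x \sum_y A x y * normU (F x - F y) `^ p.

(** The p-th power of either Lipschitz bound is lost once. *)
Lemma vector_poincare_bilipschitz (R : realType) (X : finType) (p kappa L : R)
    (A : X -> X -> R) (U V : zmodType) (normU : U -> R) (normV : V -> R)
    (B : set U) (C : set V) :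
  0 < p -> 0 < L -> 0 <= kappa -> (forall x y, 0 <= A x y) -> (forall u, 0 <= normU u) ->
  bilipschitz_equiv L normU normV B C ->
  vector_poincare p kappa A normV C ->
  vector_poincare p (kappa / L `^ (2 * p)) A normU B.
Proof.
move=> p0 L0 k0 A0 nU0 [Phi [PhiBC _ Phisurj] PhiL] poin F FB.
have [c' Cc' hc] := poin (Phi \o F) (fun x => PhiBC _ (FB x)).
have [c Bc PhicE] := Phisurj c' Cc'.
exists c => //; rewrite -PhicE in hc.
have nV0 u v : B u -> B v -> 0 <= normV (Phi u - Phi v).
  move=> Bu Bv; have /andP[h _] := PhiL u v Bu Bv.
  by apply: le_trans h; rewrite mulr_ge0// invr_ge0 ltW.
have lo u v : B u -> B v -> normU (u - v) `^ p / L `^ p <= normV (Phi u - Phi v) `^ p.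
  move=> Bu Bv; have /andP[h _] := PhiL u v Bu Bv.
  rewrite mulrC -powR_inv1 ?powR_ge0// powRAC powR_inv1 ?(ltW L0)// -powRM ?invr_ge0 ?(ltW L0)//.
  by apply: ge0_ler_powR; rewrite ?nnegrE ?nV0 ?mulr_ge0 ?invr_ge0 ?(ltW p0) ?(ltW L0).
have hi u v : B u -> B v -> normV (Phi u - Phi v) `^ p <= L `^ p * normU (u - v) `^ p.
  move=> Bu Bv; have /andP[_ h] := PhiL u v Bu Bv.
  rewrite -powRM ?(ltW L0)//.
  by apply: ge0_ler_powR; rewrite ?nnegrE ?nV0 ?mulr_ge0 ?(ltW p0) ?(ltW L0).
have Lp0 : 0 < L `^ p by exact: powR_gt0.
rewrite (_ : 2 * p = p + p); last ring.
rewrite powRD; last by apply/implyP => _; rewrite gt_eqF.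
set S := \sum_x normU (F x - c) `^ p; set l := L `^ p in lo hi Lp0 *.
have hS : S / l <= \sum_x normV (Phi (F x) - Phi c) `^ p.
  by rewrite /S mulr_suml; apply: ler_sum => x _; exact: lo.
have -> : kappa / (l * l) * S = kappa * (S / l) / l by field; rewrite gt_eqF.
rewrite ler_pdivrMr//; apply: le_trans (ler_wpM2l k0 hS) _; apply: le_trans hc _.
rewrite mulr_suml; apply: ler_sum => x _; rewrite mulr_suml; apply: ler_sum => y _.
by rewrite -mulrA ler_wpM2l// mulrC; exact: hi.
Qed.

Lemma cvg_fin_sum (R : realType) (I : finType) (T : Type) (F : set_system T)
    (f : I -> T -> R) (l : I -> R) : Filter F ->
  (forall i, f i x @[x --> F] --> l i) -> \sum_i f i x @[x --> F] --> \sum_i l i.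
Proof. by move=> FF fl; apply: cvg_big => //; exact: add_continuous. Qed.

Lemma lp_norm_powR (R : realType) (p : R) (n : nat) (x : 'rV[R]_n) : 0 < p ->
  lp_norm p x `^ p = \sum_(i < n) `|x 0 i| `^ p.
Proof.
move=> p0; rewrite /lp_norm -powRrM mulVf ?gt_eqF// powRr1//.
by apply: sumr_ge0 => i _; exact: powR_ge0.
Qed.

(** Both sides are sums over the coordinates of the scalar inequality. *)
Lemma lp_norm_poincare (R : realType) (X : finType) (p kappa : R) (A : X -> X -> R) (n : nat) :
  0 < p -> scalar_poincare p kappa A ->
  vector_poincare p kappa A (@lp_norm R p n) setT.
Proof.
move=> p0 poin F _.
exists (\row_i ((\sum_y F y 0 i) / #|X|%:R)) => //.
under eq_bigr do rewrite lp_norm_powR//.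
rewrite exchange_big/= mulr_sumr.
under [leRHS]eq_bigr do under eq_bigr do rewrite lp_norm_powR// mulr_sumr.
under [leRHS]eq_bigr do rewrite exchange_big/=.
rewrite [leRHS]exchange_big/=; apply: ler_sum => i _.
rewrite (eq_bigr (fun x => `|F x 0 i - (\sum_y F y 0 i) / #|X|%:R| `^ p)) => [|x _].
  rewrite [leRHS](eq_bigr (fun x => \sum_y A x y * `|F x 0 i - F y 0 i| `^ p)) => [|x _].
    exact: poin (fun x => F x 0 i).
  by apply: eq_bigr => y _; rewrite !mxE.
by rewrite !mxE.
Qed.

Lemma powR_normD_le (R : realType) (p a b : R) : 1 <= p ->
  `|a + b| `^ p <= 2 `^ p * (`|a| `^ p + `|b| `^ p).
Proof.
move=> p1; have p0 : 0 < p by lra.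
apply: (@le_trans _ _ ((2 * ((`|a| + `|b|) / 2)) `^ p)).
  apply: ge0_ler_powR; rewrite ?nnegrE ?(ltW p0)//.
  by rewrite mulrC divfK// ler_normD.
rewrite powRM ?divr_ge0 ?addr_ge0// ler_wpM2l ?powR_ge0//.
apply: le_trans (powR_midpoint p1 (normr_ge0 _) (normr_ge0 _)) _.
have : 0 <= `|a| `^ p + `|b| `^ p by rewrite addr_ge0 ?powR_ge0.
lra.
Qed.

Lemma lp_seqD (R : realType) (p : R) (u v : nat -> R) : 1 <= p ->
  lp_seq p u -> lp_seq p v -> lp_seq p (u + v).
Proof.
move=> p1 hu hv; rewrite /lp_seq/=.
apply: (@series_le_cvg _ _ (fun k => 2 `^ p * (`|u k| `^ p + `|v k| `^ p))).
- by move=> k; exact: powR_ge0.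
- by move=> k; rewrite mulr_ge0 ?addr_ge0 ?powR_ge0.
- by move=> k; exact: powR_normD_le.
rewrite (_ : series _ = fun n =>
    2 `^ p * (series (fun k => `|u k| `^ p) n + series (fun k => `|v k| `^ p) n)).
  by apply: is_cvgMl_tmp; exact: is_cvgD hu hv.
by apply/funext => n; rewrite /series/= -mulr_sumr big_split.
Qed.

Lemma lp_seqZ (R : realType) (p a : R) (u : nat -> R) :
  lp_seq p u -> lp_seq p (fun k => a * u k).
Proof.
move=> hu; rewrite /lp_seq/=.
rewrite (_ : series _ = fun n => `|a| `^ p * series (fun k => `|u k| `^ p) n).
  exact: is_cvgMl_tmp.
apply/funext => n; rewrite /series/= mulr_sumr; apply: eq_bigr => k _.
by rewrite normrM powRM.
Qed.

Lemma lp_seqB (R : realType) (p : R) (u v : nat -> R) : 1 <= p ->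
  lp_seq p u -> lp_seq p v -> lp_seq p (u - v).
Proof.
move=> p1 hu hv; have := lp_seqD p1 hu (lp_seqZ (a := -1) hv).
by under [X in _ + X]eq_fun do rewrite mulN1r.
Qed.

Lemma lp_seq_sum (R : realType) (I : finType) (p : R) (u : I -> nat -> R) : 1 <= p ->
  (forall i, lp_seq p (u i)) -> lp_seq p (fun k => \sum_i u i k).
Proof.
move=> p1 hu; elim: (index_enum I) => [|i s ih].
  rewrite /lp_seq/= (_ : series _ = cst 0); first exact: is_cvg_cst.
  apply/funext => n; rewrite /series/= big1// => k _.
  by rewrite big_nil normr0 powR0//; lra.
have := lp_seqD p1 (hu i) ih; congr lp_seq; apply/funext => k.
by rewrite big_cons.
Qed.

Lemma lp_seq_norm_powR (R : realType) (p : R) (u : nat -> R) : 0 < p -> lp_seq p u ->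
  lp_seq_norm p u `^ p = limn (series (fun k => `|u k| `^ p)).
Proof.
move=> p0 hu; rewrite /lp_seq_norm -powRrM mulVf ?gt_eqF// powRr1//.
by apply: limr_ge => //; apply: nearW => n; apply: sumr_ge0 => i _; exact: powR_ge0.
Qed.

(** The scalar inequality for each coordinate gives the one for partial sums, and then
for their limits; the coordinatewise mean is again p-summable. *)
Lemma lp_seq_poincare (R : realType) (X : finType) (p kappa : R) (A : X -> X -> R) :
  1 <= p -> scalar_poincare p kappa A ->
  vector_poincare p kappa A (@lp_seq_norm R p) (@lp_seq R p).
Proof.
move=> p1 poin F Fl; have p0 : 0 < p by lra.
pose c k := (\sum_y F y k) / #|X|%:R.
have lc : lp_seq p c.
  have := lp_seqZ (a := #|X|%:R^-1) (lp_seq_sum p1 Fl).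
  by under eq_fun do rewrite mulrC.
exists c => //.
have lB x : lp_seq p (F x - c) := lp_seqB p1 (Fl x) lc.
have lF x y : lp_seq p (F x - F y) := lp_seqB p1 (Fl x) (Fl y).
rewrite (eq_bigr _ (fun x _ => lp_seq_norm_powR p0 (lB x))).
rewrite [leRHS](eq_bigr (fun x => \sum_y A x y * limn (series (fun k => `|(F x - F y) k| `^ p)))).
  2: by move=> x _; apply: eq_bigr => y _; rewrite (lp_seq_norm_powR p0 (lF x y)).
pose lhs n := kappa * \sum_x series (fun k => `|(F x - c) k| `^ p) n.
pose rhs n := \sum_x \sum_y A x y * series (fun k => `|(F x - F y) k| `^ p) n.
have cl : lhs @ \oo --> kappa * \sum_x limn (series (fun k => `|(F x - c) k| `^ p)).
  apply: cvgMl_tmp; apply: cvg_fin_sum => x; exact: lB.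
have cr : rhs @ \oo --> \sum_x \sum_y A x y * limn (series (fun k => `|(F x - F y) k| `^ p)).
  apply: cvg_fin_sum => x; apply: cvg_fin_sum => y; apply: cvgMl_tmp; exact: lF.
apply: (ler_cvg_to cl cr); apply: nearW => n; rewrite /lhs /rhs /series/=.
rewrite exchange_big/= mulr_sumr.
under [leRHS]eq_bigr do under eq_bigr do rewrite mulr_sumr.
under [leRHS]eq_bigr do rewrite exchange_big/=.
rewrite [leRHS]exchange_big/=; apply: ler_sum => i _.
exact: poin (fun x => F x i).
Qed.

(** * Poincare inequalities and completeness of L^p *)

Section LpPoincare.
Context d (T : measurableType d) (R : realType).
Variables (mu : {measure set T -> \bar R}) (p : R) (p1 : (1 <= p%:E)%E).
Notation LT := (LfunType mu p1).
Local Open Scope quotient_scope.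

Lemma Lp_exp_gt0 : 0 < p. Proof. by apply: lt_le_trans ltr01 _; rewrite -lee_fin. Qed.

Lemma measurable_pow_norm (f : T -> R) : measurable_fun setT f ->
  measurable_fun setT (fun t => (`|f t| `^ p)%:E).
Proof.
move=> mf; apply/measurable_EFinP.
apply: (measurableT_comp (measurable_powR p)).
exact: measurableT_comp.
Qed.

Lemma Lnorm_powE (f : T -> R) :
  ('N[mu]_p%:E[EFin \o f] `^ p = \int[mu]_t (`|f t| `^ p)%:E)%E.
Proof. by rewrite poweR_Lnorm ?gt_eqF ?Lp_exp_gt0. Qed.

Lemma Lp_norm_powE (f : LT) :
  ((Lp_norm (\pi_(Lp mu p1) f) `^ p)%:E = \int[mu]_t (`|f t| `^ p)%:E)%E.
Proof. by rewrite Lp_norm_pi -Lnorm_powE -finite_norm_fine. Qed.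

Lemma Lfun_sumE (I : finType) (f : I -> LT) (t : T) : (\sum_i f i : LT) t = \sum_i f i t.
Proof.
elim: (index_enum I) => [|i s ih]; first by rewrite !big_nil.
by rewrite !big_cons -ih.
Qed.

Lemma Lp_piB (f g : LT) : \pi_(Lp mu p1) (f - g) = \pi_(Lp mu p1) f - \pi_(Lp mu p1) g.
Proof. by rewrite Lp_piD; congr (_ + _); exact: Quotient.pi_opp. Qed.

Lemma Lfun_measurable (f : LT) : measurable_fun setT (f : T -> R).
Proof. exact: measurable_funPT. Qed.

(** Choose representatives, apply the scalar inequality at every point, and
integrate. *)
Lemma Lp_poincare (X : finType) (kappa : R) (A : X -> X -> R) :
  0 <= kappa -> (forall x y, 0 <= A x y) -> scalar_poincare p kappa A ->
  vector_poincare p kappa A (fun v : Lp mu p1 => `|v|) setT.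
Proof.
move=> k0 A0 poin F _.
pose H x : LT := repr (F x).
pose C : LT := #|X|%:R^-1 *: \sum_x H x.
have FE x : F x = \pi_(Lp mu p1) (H x) by rewrite reprK.
have CE t : C t = (\sum_y H y t) / #|X|%:R by rewrite mulrC -Lfun_sumE.
exists (\pi_(Lp mu p1) C) => //; rewrite -lee_fin EFinM -!sumEFin.
have powm (f : LT) : measurable_fun setT (fun t => (`|f t| `^ p)%:E).
  exact/measurable_pow_norm/Lfun_measurable.
have pow0 (f : LT) t : (0 <= (`|f t| `^ p)%:E)%E by rewrite lee_fin powR_ge0.
have normE (f g : LT) : ((`|\pi_(Lp mu p1) f - \pi_(Lp mu p1) g| `^ p)%:E =
    \int[mu]_t (`|(f - g) t| `^ p)%:E)%E by rewrite -Lp_piB; exact: Lp_norm_powE.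
under eq_bigr do rewrite FE normE.
rewrite -ge0_integral_sum// -ge0_integralZl_EFin//; last 2 first.
  by move=> t _; apply: sume_ge0.
  exact: emeasurable_sum.
under [leRHS]eq_bigr => x _.
  rewrite -sumEFin.
  under eq_bigr => y _.
    rewrite EFinM !FE normE -ge0_integralZl_EFin//.
    over.
  rewrite -ge0_integral_sum//; last 2 first.
    by move=> y; apply: measurable_funeM.
    by move=> y t _; rewrite mule_ge0 ?lee_fin.
  over.
rewrite -ge0_integral_sum//; last 2 first.
  by move=> x; apply: emeasurable_sum => y; apply: measurable_funeM.
  by move=> x t _; apply: sume_ge0 => y _; rewrite mule_ge0 ?lee_fin.
apply: ge0_le_integral => //.
- by move=> t _; rewrite mule_ge0 ?lee_fin// sume_ge0.
- by apply: measurable_funeM; apply: emeasurable_sum.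
- by apply: emeasurable_sum => x; apply: emeasurable_sum => y; apply: measurable_funeM.
move=> t _.
under [leRHS]eq_bigr do under eq_bigr do rewrite -EFinM.
under [leRHS]eq_bigr do rewrite sumEFin.
rewrite !sumEFin -EFinM lee_fin.
rewrite (eq_bigr (fun x => `|H x t - (\sum_y H y t) / #|X|%:R| `^ p)); last first.
  by move=> x _; rewrite -CE.
exact: poin (fun x => H x t).
Qed.
End LpPoincare.

(** At l = 0 differentiability is not available, but f^p <= f once f <= 1. *)
Lemma cvg_powR (R : realType) (S : Type) (F : set_system S) (f : S -> R) (l p : R) :
  ProperFilter F -> 1 <= p -> (forall s, 0 <= f s) -> 0 <= l ->
  f s @[s --> F] --> l -> f s `^ p @[s --> F] --> l `^ p.
Proof.
move=> FF p1 f0; rewrite le_eqVlt => /predU1P[<-|l0] fl.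
  rewrite powR0; last lra.
  apply: (squeeze_cvgr _ (cvg_cst 0) fl).
  have : \forall s \near F, f s <= 1.
    by apply: (cvgr_le _ fl).
  apply: filterS => s fs1; rewrite powR_ge0/=.
  have := f0 s; rewrite le_eqVlt => /predU1P[<-|fs0]; first by rewrite powR0//; lra.
  by apply: ge1r_powR; rewrite ?fs0.
suff dc : {for l, continuous (fun a : R => a `^ p : R)} by exact: (cvg_comp _ _ fl dc).
have : differentiable (fun a => a `^ p : R) l.
  by apply/derivable1_diffP; apply: derivable_powR; rewrite in_itv/= l0.
exact: differentiable_continuous.
Qed.

Section LpComplete.
Context d (T : measurableType d) (R : realType).
Variables (mu : {measure set T -> \bar R}) (p : R) (p1 : (1 <= p%:E)%E).
Notation LT := (LfunType mu p1).
Local Open Scope quotient_scope.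

Lemma Lnorm_sum_le (g : nat -> T -> R) (c : nat -> R) :
  (forall k, measurable_fun setT (g k)) ->
  (forall k, ('N[mu]_p%:E[EFin \o g k] <= (c k)%:E)%E) ->
  forall n, ('N[mu]_p%:E[EFin \o (fun t => (\sum_(k < n) g k t)%R)] <= (\sum_(k < n) c k)%:E)%E.
Proof.
move=> mg gc; elim=> [|n ih].
  rewrite (_ : EFin \o _ = cst 0%E); last by apply/funext => t /=; rewrite big_ord0.
  rewrite Lnorm0; first by rewrite big_ord0.
  by rewrite eqe gt_eqF// (Lp_exp_gt0 p1).
rewrite (_ : (fun t => _) = (fun t => \sum_(k < n) g k t) \+ g n); last first.
  by apply/funext => t /=; rewrite big_ord_recr.
have mS : measurable_fun setT (fun t => \sum_(k < n) g k t).
  by apply: measurable_sum => k.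
apply: le_trans (minkowski_EFin mu mS (mg n) _) _; first by rewrite -lee_fin.
by rewrite big_ord_recr EFinD; exact: leeD.
Qed.

(** The p-th powers of the partial sums increase to a function with finite integral,
by monotone convergence; such a function is finite almost everywhere. *)
Lemma ae_series_bounded (g : nat -> T -> R) (M : R) :
  (forall k, measurable_fun setT (g k)) -> (forall k t, 0 <= g k t) ->
  (forall n, ('N[mu]_p%:E[EFin \o (fun t => (\sum_(k < n) g k t)%R)] <= M%:E)%E) ->
  {ae mu, forall t, exists c, forall n, \sum_(k < n) g k t <= c}.
Proof.
move=> mg g0 gM; have p0 := Lp_exp_gt0 p1.
pose S n t := \sum_(k < n) g k t.
have S0 n t : 0 <= S n t by apply: sumr_ge0.
pose P n t := (`|S n t| `^ p)%:E.
have mS n : measurable_fun setT (S n) by apply: measurable_sum => k.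
have mP n : measurable_fun setT (P n) by exact: measurable_pow_norm.
have P0 n t : (0 <= P n t)%E by rewrite lee_fin powR_ge0.
have ndS t : {homo (fun n => S n t) : n m / (n <= m)%N >-> n <= m}.
  apply/nondecreasing_seqP => n; rewrite /S big_ord_recr/= lerDl//.
have ndP t : {homo (fun n => P n t) : n m / (n <= m)%N >-> (n <= m)%E}.
  move=> n m nm; rewrite lee_fin !ger0_norm//.
  by apply: ge0_ler_powR; rewrite ?nnegrE ?S0 ?(ltW p0)//; exact: ndS.
have cP t : cvgn (P ^~ t) by apply: ereal_nondecreasing_is_cvgn; exact: ndP.
pose G t := limn (P ^~ t).
have mG : measurable_fun setT G.
  by apply: emeasurable_fun_cvg mP _ => t _; exact: cP.
have G0 t : (0 <= G t)%E by apply: lime_ge => //; exact: nearW.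
have M0 : (0 <= M%:E)%E by apply: le_trans (gM 0%N); exact: Lnorm_ge0.
have intP n : (\int[mu]_t P n t <= (M `^ p)%:E)%E.
  rewrite -(Lnorm_powE mu p1) -poweR_EFin.
  apply: gt0_ler_poweR; [exact: ltW| | |exact: gM].
    by rewrite in_itv/= Lnorm_ge0 leey.
  by rewrite in_itv/=; apply/andP; split; [exact: M0|exact: leey].
have intG : (\int[mu]_t G t <= (M `^ p)%:E)%E.
  rewrite monotone_convergence//.
  apply: lime_le; last exact: nearW.
  apply: ereal_nondecreasing_is_cvgn => n m nm; apply: ge0_le_integral => //.
  by move=> t _; exact: ndP.
have Gint : mu.-integrable setT G.
  apply/integrableP; split => //.
  under eq_integral do rewrite gee0_abs//.
  exact: le_lt_trans intG (ltry _).
have := integrable_ae measurableT Gint; apply: filterS => t /(_ I) Gfin.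
exists (fine (G t) `^ p^-1) => n.
have : (P n t <= G t)%E.
  apply: lime_ge => //; exists n => // m /= nm; exact: ndP.
move=> h; have {}h : S n t `^ p <= fine (G t).
  by rewrite -lee_fin fineK//; move: h; rewrite /P ger0_norm.
rewrite -/(S n t) (_ : S n t = (S n t `^ p) `^ p^-1); last first.
  by rewrite -powRrM mulfV ?powRr1// gt_eqF.
apply: ge0_ler_powR; rewrite ?nnegrE ?powR_ge0 ?invr_ge0 ?(ltW p0)//.
by apply: fine_ge0; exact: G0.
Qed.

(** The argument of Riesz and Fischer.  The norms of the increments form a convergent
series, hence the increments are absolutely summable almost everywhere and the
representatives converge pointwise to some f; Fatou's lemma bounds the distance
from u k to f by the tail of the series. *)
Lemma Lp_geometrically_complete : geometrically_complete (Lp mu p1 : normedModType R).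
Proof.
move=> u K t0 tt uK; have p0 := Lp_exp_gt0 p1; have /andP[t00 t01] := tt.
have K0 : 0 <= K by have := uK 0%N; rewrite expr0 mulr1; apply: le_trans.
pose U k : LT := repr (u k).
have UE k : \pi_(Lp mu p1) (U k) = u k by exact: reprK.
have mU k : measurable_fun setT (U k : T -> R) by exact: Lfun_measurable.
pose g k t := `|U k.+1 t - U k t|.
have mg k : measurable_fun setT (g k).
  by apply: measurableT_comp => //; apply: measurable_funB.
have normU k n : ('N[mu]_p%:E[EFin \o (fun t => (U k t - U n t)%R)] = (`|u k - u n|)%:E)%E.
  by rewrite -UE -(UE n) -Lp_piB -[`|_|]/(Lp_norm _) Lp_norm_pi finite_norm_fine.
have gK k : ('N[mu]_p%:E[EFin \o g k] <= (K * t0 ^+ k)%:E)%E.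
  rewrite (_ : EFin \o g k = abse \o (EFin \o (fun t => (U k.+1 t - U k t)%R)))//.
  by rewrite Lnorm_abse normU lee_fin.
have sumK n : \sum_(k < n) K * t0 ^+ k <= K / (1 - t0).
  have t2 : 0 < 1 - t0 by lra.
  suff -> : \sum_(k < n) K * t0 ^+ k = K / (1 - t0) * (1 - t0 ^+ n).
    by rewrite ler_piMr ?divr_ge0 ?(ltW t2)// gerBl exprn_ge0.
  elim: n => [|n ih]; first by rewrite big_ord0 expr0 subrr mulr0.
  rewrite big_ord_recr/= ih exprS; field; lra.
have aeb : {ae mu, forall t, exists c, forall n, \sum_(k < n) g k t <= c}.
  apply: (@ae_series_bounded g (K / (1 - t0)) mg) => [k t|n]; first exact: normr_ge0.
  by apply: le_trans (Lnorm_sum_le mg gK n) _; rewrite lee_fin.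
have aecv : {ae mu, forall t, cvgn (fun k => U k t)}.
  apply: filterS aeb => t [c hc].
  have cd : cvgn (series (fun k => U k.+1 t - U k t)).
    apply: normed_cvg; apply: nondecreasing_is_cvgn.
      by apply/nondecreasing_seqP => n; rewrite [leRHS]/series/= big_nat_recr//= lerDl.
    by exists c => _ [n _ <-]; have := hc n; rewrite -(big_mkord xpredT (fun k => g k t)).
  have -> : (fun k => U k t) = (fun n => series (fun k => U k.+1 t - U k t) n + U 0%N t).
    by apply/funext => n; rewrite /series/= telescope_sumr// subrK.
  by apply: is_cvgD => //; exact: is_cvg_cst.
(* The upper limit is measurable and agrees with the limit almost everywhere. *)
pose f t := fine (limn_esup (fun k => (U k t)%:E)).
have mf : measurable_fun setT f.
  apply: measurableT_comp => //; apply: measurable_fun_limn_esup => k.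
  exact/measurable_EFinP.
have aef : {ae mu, forall t, U k t @[k --> \oo] --> f t}.
  apply: filterS aecv => t cv.
  have cve : (U k t)%:E @[k --> \oo] --> (limn (fun k => U k t))%:E.
    by apply: cvg_EFin => //; exact: nearW.
  rewrite /f is_cvg_limn_esupE; last by apply/cvg_ex; eexists; exact: cve.
  by rewrite (cvg_lim _ cve).
pose M := K / (1 - t0).
have M0 : 0 <= M by rewrite divr_ge0// subr_ge0 ltW.
have Mk k : 0 <= M * t0 ^+ k by rewrite mulr_ge0// exprn_ge0.
have mfU k : measurable_fun setT (fun t => f t - U k t) by exact: measurable_funB.
(* Fatou along n, keeping k fixed. *)
have dist k : (\int[mu]_t (`|f t - U k t| `^ p)%:E <= ((M * t0 ^+ k) `^ p)%:E)%E.
  have mh n : measurable_fun setT (fun t => (`|U n t - U k t| `^ p)%:E).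
    by apply: measurable_pow_norm => //; exact: measurable_funB.
  have h0 n t : (0 <= (`|U n t - U k t| `^ p)%:E)%E by rewrite lee_fin powR_ge0.
  apply: (@le_trans _ _ (\int[mu]_t limn_einf (fun n => (`|U n t - U k t| `^ p)%:E))%E).
    apply: ae_ge0_le_integral => //.
    - exact: measurable_pow_norm.
    - move=> t _; rewrite limn_einf_lim; apply: lime_ge; first exact: is_cvg_einfs.
      by apply: nearW => n; apply: le_ereal_inf_tmp => _ [m _ <-]; exact: h0.
    - apply: (@emeasurable_fun_cvg _ _ _ _
        (fun n t => einfs (fun n => (`|U n t - U k t| `^ p)%:E) n)).
        exact: measurable_fun_einfs.
      by move=> t _; rewrite limn_einf_lim; exact: is_cvg_einfs.
    apply: filterS aef => t cv _.
    have c1 : `|U n t - U k t| `^ p @[n --> \oo] --> `|f t - U k t| `^ p.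
      have c2 : `|U n t - U k t| @[n --> \oo] --> `|f t - U k t|.
        by apply: cvg_norm; apply: cvgB => //; exact: cvg_cst.
      by apply: cvg_powR c2 => //; rewrite -lee_fin.
    have c3 : (`|U n t - U k t| `^ p)%:E @[n --> \oo] --> (`|f t - U k t| `^ p)%:E.
      by apply: cvg_EFin => //; exact: nearW.
    by rewrite (cvg_limn_einf_sup c3).1.
  apply: le_trans (fatou mu measurableT mh (fun n t _ => h0 n t)) _.
  rewrite limn_einf_lim; apply: lime_le; first exact: is_cvg_einfs.
  apply: nearW => n.
  apply: (@le_trans _ _ (\int[mu]_t (`|U (k + n)%N t - U k t| `^ p)%:E)%E).
    by apply: ereal_inf_lbound; exists (k + n)%N => //=; exact: leq_addl.
  rewrite -(Lnorm_powE mu p1 (fun t => U (k + n)%N t - U k t)) normU poweR_EFin lee_fin.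
  apply: ge0_ler_powR; rewrite ?nnegrE ?(ltW p0)//.
  exact: geometric_dist.
have Nle k : ('N[mu]_p%:E[EFin \o (fun t => (f t - U k t)%R)] <= (M * t0 ^+ k)%:E)%E.
  have := dist k; rewrite -(Lnorm_powE mu p1 (fun t => f t - U k t)).
  set N := 'N[mu]_p%:E[_]%E => h.
  have N0 : (0 <= N)%E by exact: Lnorm_ge0.
  have : ((N `^ p) `^ p^-1 <= ((M * t0 ^+ k) `^ p)%:E `^ p^-1)%E.
    apply: gt0_ler_poweR; [by rewrite invr_ge0 ltW| | |exact: h].
      by rewrite in_itv/= poweR_ge0 leey.
    by rewrite in_itv/= lee_fin powR_ge0 leey.
  rewrite -poweRrM mulfV ?gt_eqF// poweRe1// poweR_EFin -powRrM mulfV ?gt_eqF//.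
  by rewrite powRr1.
(* f differs from the p-integrable U 0 by a function of finite norm. *)
have ff : f \in Lfun mu p%:E.
  apply/andP; split; first by rewrite inE.
  rewrite inE/= /finite_norm.
  have -> : EFin \o f = EFin \o ((fun t => f t - U 0%N t) \+ U 0%N)%R.
    by apply/funext => t /=; rewrite subrK.
  apply: le_lt_trans (minkowski_EFin mu (mfU 0%N) (mU 0%N) _) _.
    by rewrite -lee_fin.
  apply: lte_add_pinfty; first exact: le_lt_trans (Nle 0%N) (ltry _).
  exact: Lfunction_finite.
pose F : LT := Lfun_Sub p1 ff.
exists (\pi_(Lp mu p1) F), M => k.
rewrite distrC -UE -Lp_piB -[`|_|]/(Lp_norm _) Lp_norm_pi -lee_fin finite_norm_fine.
exact: Nle.
Qed.
End LpComplete.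

(** * Actions of triangular random groups *)

(** Add the vectors one at a time, skipping those that are already in the span. *)
Lemma finite_span (R : realType) (V : lmodType R) (s : seq V) :
  exists n (e : 'I_n -> V), linearly_independent e /\
    forall v, v \in s -> exists c : 'I_n -> R, v = \sum_i c i *: e i.
Proof.
elim: s => [|w s [n [e [einj espan]]]].
  by exists 0%N, (fun=> 0); split => [c _ []|].
have [[c wE]|wspan] := pselect (exists c : 'I_n -> R, w = \sum_i c i *: e i).
  by exists n, e; split => // v; rewrite inE => /predU1P[->|/espan//]; exists c.
pose e' (i : 'I_n.+1) := oapp e w (unlift ord0 i).
have e'0 : e' ord0 = w by rewrite /e' unlift_none.
have e'S i : e' (lift ord0 i) = e i by rewrite /e' liftK.
exists n.+1, e'; split.
  move=> c; rewrite big_ord_recl e'0; under eq_bigr do rewrite e'S.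
  move=> h; have c0 : c ord0 = 0.
    apply/eqP/negPn/negP => c0; apply: wspan.
    exists (fun i => - (c ord0)^-1 * c (lift ord0 i)).
    under eq_bigr do rewrite -scalerA; rewrite -scaler_sumr.
    rewrite -(addKr (c ord0 *: w) (\sum_(i < n) _)) h addr0 scaleNr scalerN opprK.
    by rewrite scalerA mulVf// scale1r.
  rewrite c0 scale0r add0r in h.
  move=> i; case: (unliftP ord0 i) => [j ->|->//].
  exact: (einj (fun j => c (lift ord0 j))).
move=> v; rewrite inE => /predU1P[->|/espan[c ->]].
  exists (fun i => (i == ord0)%:R); rewrite big_ord_recl e'0 eqxx scale1r big1 ?addr0// => i _.
  by rewrite scale0r.
exists (fun i => oapp c 0 (unlift ord0 i)); rewrite big_ord_recl unlift_none scale0r add0r.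
by apply: eq_bigr => i _; rewrite liftK e'S.
Qed.

Lemma finite_has_dimension (R : realType) (V : lmodType R) (s : seq V) :
  exists n, exists2 W : {pred V}, has_dimension n W & {subset s <= W}.
Proof.
have [n [e [einj espan]]] := finite_span s.
exists n, (fun v => `[< exists c : 'I_n -> R, v = \sum_i c i *: e i >]).
  by exists e => // v; rewrite unfold_in; split => /asboolP.
by move=> v /espan vE; rewrite unfold_in; apply/asboolP.
Qed.

(** The finitely many values of F span a space of some finite dimension n0; by
hypothesis it lies in a subspace W with a bi-Lipschitz model in which the
inequality is known.  The point c is found in W. *)
Lemma Lp_geometry_poincare (R : realType) (X : finType) (p kappa L : R) (p1 : (1 <= p%:E)%E)
    (A : X -> X -> R) (V : normedModType R) :
  0 < L -> 0 <= kappa -> (forall x y, 0 <= A x y) -> scalar_poincare p kappa A ->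
  Lp_geometry p1 L V ->
  vector_poincare p (kappa / L `^ (2 * p)) A (fun v : V => `|v|) setT.
Proof.
move=> L0 k0 A0 poin geo F _; have p0 := Lp_exp_gt0 p1.
have pR : 1 <= p by rewrite -lee_fin.
have [n0 [E dimE FE]] := finite_has_dimension [seq F x | x : X].
have [W [_ EW bil]] := geo n0 E dimE.
have FW x : [set` W] (F x) by apply/EW/FE/map_f; rewrite mem_enum.
have nU0 (v : V) : 0 <= `|v| by exact: normr_ge0.
suff poinW : vector_poincare p (kappa / L `^ (2 * p)) A (fun v : V => `|v|) [set` W].
  by have [c _ hc] := poinW F FW; exists c.
case: bil => [[n _ h]|h|[d [T [mu h]]]].
- by apply: vector_poincare_bilipschitz h _ => //; exact: lp_norm_poincare.
- by apply: vector_poincare_bilipschitz h _ => //; exact: lp_seq_poincare.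
- by apply: vector_poincare_bilipschitz h _ => //; exact: Lp_poincare.
Qed.

Section Presented.
Variables (S : choiceType) (rels : set (seq (letter S))).
Let G : groupType := presented rels.
Local Open Scope quotient_scope.

Definition generator (x : letter S) : G := \pi_(presented rels) [:: x].

Lemma presented_pi_cat u v :
  \pi_(presented rels) (u ++ v) = (\pi_(presented rels) u * \pi_(presented rels) v)%g :> G.
Proof.
apply/presented_piP; apply: word_equiv_sym; apply: word_equiv_cat; exact: presented_reprP.
Qed.

Lemma generator_inv x : generator (letter_inv x) = (generator x)^-1%g.
Proof.
apply/esym/mulg1_eq; rewrite -presented_pi_cat.
apply/presented_piP; exact: (@word_equiv_cancel _ rels [::] [::]).
Qed.

Lemma relation_eq1 (a b c : letter S) : rels [:: a; b; c] ->
  (generator a * generator b * generator c = 1)%g.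
Proof.
move=> r; rewrite -(presented_pi_cat [:: a] [:: b]) -(presented_pi_cat [:: a; b] [:: c]).
by apply/presented_piP; exact: (@word_equiv_rel _ rels [::] [::] _ r).
Qed.

(** Every element is the class of a word. *)
Lemma generators_fix (V : Type) (alpha : G -> V -> V) (v : V) :
  alpha 1%g v = v -> (forall g h w, alpha (g * h)%g w = alpha g (alpha h w)) ->
  (forall x, alpha (generator x) v = v) -> forall g, alpha g v = v.
Proof.
move=> a1 aM gv g; rewrite -[g]reprK; elim: (repr g) => [|x w ih].
  by rewrite -[RHS]a1.
by rewrite -cat1s presented_pi_cat aM ih gv.
Qed.
End Presented.

Lemma random_group_fixed_point (R : realType) (m : nat) (E : {set 3.-tuple (letter 'I_m)})
    (V : normedModType R) (alpha : random_group E -> V -> V) (p B kappa : R) :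
  geometrically_complete V -> 1 <= p -> 0 <= B < kappa ->
  (forall c, #|[set w in E | letter3 w == c]%SET|%:R <= B) ->
  vector_poincare p kappa (fun x y => (corner_count (@corner_source 'I_m) (@letter2 _) E x y)%:R)
    (fun v : V => `|v|) setT ->
  affine_isometric_action alpha -> has_fixed_point alpha.
Proof.
move=> compl p1 Bk third poin act.
apply: (@fixed_point_of_poincare R V _ alpha _ _ (generator _) (@letter_inv _)
   (@corner_source 'I_m) (@letter2 _) (@letter3 _) E p B kappa) => //.
- exact: letter_invK.
- exact: generator_inv.
- by have [a1 aM _ _] := act => v; apply: generators_fix.
- move=> w wE; rewrite -generator_inv letter_invK; apply: relation_eq1.
  by exists w; [exact: wE|exact: (congr1 val (tuple3_eta w))].
- by move=> F; have [c _ hc] := poin F (fun=> I); exists c.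
Qed.

Lemma quasirandom_scalar_poincare (R : realType) (X : finType) (D eta p s : R) (K : nat)
    (A : X -> X -> R) :
  quasirandom D eta A -> 0 <= D -> 0 <= eta <= 1 -> 2 <= p -> 0 < s ->
  scalar_poincare p ((2 - poincare_defect eta p s K) * D) A.
Proof.
move=> qr D0 eta01 p2 s0 f.
set c := (\sum_y f y) / #|X|%:R.
have fc0 : \sum_x (f x - c) = 0.
  have [X0|X0] := posnP #|X|.
    by rewrite big_pred0// => x; have := card0_eq X0 x; rewrite !inE.
  rewrite sumrB sumr_const -[c *+ _]mulr_natr /c divfK ?subrr//.
  by rewrite pnatr_eq0 -lt0n.
have h := quasirandom_poincare K qr D0 eta01 p2 s0 fc0.
rewrite -[leLHS]mulrA; apply: (le_trans h).
rewrite le_eqVlt; apply/orP; left; apply/eqP; apply: eq_bigr => x _.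
by apply: eq_bigr => y _; congr (_ * `|_| `^ _); rewrite opprB addrA subrK.
Qed.

(** A good draw satisfies the Poincare inequality with constant (2 - defect) D, and the
energy of a vector bounds the corner sum with constant (1 + eta) D.  The bi-Lipschitz
model divides the first one by L^(2 p) = 2 - 2 eps, and the gap that remains is
what is assumed. *)
Lemma good_relators_FLp (R : realType) (m : nat) (E : {set 3.-tuple (letter 'I_m)})
    (D eta p eps s : R) (K : nat) (p2 : 2 <= p) :
  good_draw (@corner_source 'I_m) (@letter2 _) (@letter3 _) D eta E ->
  0 < D -> 0 <= eta <= 1 -> 0 < s -> 0 < eps <= 2^-1 ->
  (1 + eta) * (2 - 2 * eps) < 2 - poincare_defect eta p s K ->
  FLpL (ge2_ge1 p2) ((2 - 2 * eps) `^ (2 * p)^-1) (random_group E)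
  /\ FLp (ge2_ge1 p2) (random_group E).
Proof.
move=> [qr third] D0 eta01 s0 /andP[eps0 eps1] gap.
have /andP[eta0 eta1] := eta01.
set delta := poincare_defect eta p s K in gap.
have poin := quasirandom_scalar_poincare K qr (ltW D0) eta01 p2 s0.
rewrite -/delta in poin.
have e1 : 1 <= 2 - 2 * eps by lra.
have e0 : 0 < 2 - 2 * eps by lra.
have gap1 : 1 + eta < 2 - delta.
  by apply: le_lt_trans gap; rewrite ler_peMr//; lra.
have k0 : 0 <= (2 - delta) * D by rewrite mulr_ge0 ?(ltW D0)//; lra.
have B0 : 0 <= (1 + eta) * D by rewrite mulr_ge0 ?(ltW D0)//; lra.
have p1 : 1 <= p by lra.
have A0 (x y : letter 'I_m) :
  0 <= (corner_count (@corner_source 'I_m) (@letter2 _) E x y)%:R :> R by [].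
split.
- move=> V geo alpha act.
  have L0 : 0 < (2 - 2 * eps) `^ (2 * p)^-1 by exact: powR_gt0.
  have LE : ((2 - 2 * eps) `^ (2 * p)^-1) `^ (2 * p) = 2 - 2 * eps.
    by rewrite -powRrM mulVf ?powRr1 ?(ltW e0)// gt_eqF//; lra.
  apply: (@random_group_fixed_point R m E V alpha p ((1 + eta) * D)
    ((2 - delta) * D / (2 - 2 * eps))) => //.
  + exact: complete_geometrically.
  + by rewrite B0 ltr_pdivlMr// mulrAC ltr_pM2r.
  + rewrite -LE; exact: Lp_geometry_poincare geo.
- move=> d T mu alpha act.
  apply: (@random_group_fixed_point R m E _ alpha p ((1 + eta) * D) ((2 - delta) * D)) => //.
  + exact: Lp_geometrically_complete.
  + by rewrite B0 ltr_pM2r.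
  + exact: Lp_poincare.
Qed.

(** Take levels of width s = eps / (24 p^2) to keep the rounding loss at eps / 4.  Then
s K has to be about 24 p / eps for the far levels to lose at most another
eps / 4, which makes K about 576 p^3 / eps^2 and the coefficient of the
discrepancy exp (O (p^2 / eps)) / eps^2. *)
Lemma poincare_defect_le (R : realType) (eta p eps : R) : 2 <= p -> 0 < eps <= 2^-1 ->
  0 <= eta ->
  exists s, exists2 K, 0 < s & poincare_defect eta p s K <=
    eps / 2 + 2 * eta + 3500 / eps ^+ 2 * expR (14 / eps * p ^+ 2) * eta.
Proof.
move=> p2 /andP[eps0 eps1] eta0.
have p0 : 0 < p by lra.
pose a := eps^-1; have a0 : 0 < a by rewrite invr_gt0.
have a2 : 2 <= a by rewrite -[leLHS]invrK lef_pV2 ?posrE ?invr_gt0.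
have epsE : eps = a^-1 by rewrite invrK.
pose s := eps / (24 * p ^+ 2).
have s0 : 0 < s by rewrite divr_gt0// mulr_gt0// exprn_gt0.
pose x := 576 * p ^+ 3 * a ^+ 2.
have x0 : 0 <= x.
  exact: (mulr_ge0 (mulr_ge0 (ler0n R 576) (exprn_ge0 3 (ltW p0))) (exprn_ge0 2 (ltW a0))).
have [K [K1 K2]] : exists K : nat, x <= K%:R /\ K%:R <= x + 1.
  have /andP[h1 h2] := truncn_itv x0.
  by exists (Num.truncn x).+1; rewrite ltW// -natr1 lerD2r.
have sE : s * x = 24 * p * a.
  by rewrite /s /x epsE; field; rewrite !gt_eqF.
have s1 : s <= 1.
  rewrite ler_pdivrMr ?mul1r ?mulr_gt0 ?exprn_gt0//.
  have : 2 ^+ 2 <= p ^+ 2 by apply: lerXn2r; rewrite ?nnegrE// ltW.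
  lra.
have sK1 : 24 * p * a <= s * K%:R by rewrite -sE ler_pM2l.
have sK2 : s * K%:R <= 24 * p * a + 1.
  by rewrite -sE; have := ler_wpM2l (ltW s0) K2; rewrite mulrDr mulr1; lra.
exists s, K => //; rewrite /poincare_defect.
have t1 : 6 * (s * p ^+ 2) = eps / 4.
  by rewrite /s; field; rewrite gt_eqF.
have t2 : 6 * (p * expR (- (s * K%:R))) <= eps / 4.
  have pa : 0 < 24 * p * a by rewrite !mulr_gt0.
  have h : expR (- (s * K%:R)) <= (24 * p * a)^-1.
    rewrite expRN lef_pV2 ?posrE ?expR_gt0//.
    apply: le_trans sK1 _; apply: le_trans (expR_ge1Dx _); lra.
  apply: le_trans (ler_wpM2l _ (ler_wpM2l (ltW p0) h)) _ => //.
  by rewrite epsE le_eqVlt; apply/orP; left; apply/eqP; field; rewrite !gt_eqF.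
have t3 : p * expR (s * K%:R * (p / 2)) * ((2 * K + 1) * 3)%N%:R <=
    3500 / eps ^+ 2 * expR (14 / eps * p ^+ 2).
  (* 3 (2 K + 1) <= 3 (2 * 576 p^3 / eps^2 + 3), rounded up with p >= 2 and 1 / eps >= 2. *)
  have Kle : ((2 * K + 1) * 3)%N%:R <= 3500 * a ^+ 2 * p ^+ 3.
    rewrite natrM natrD natrM.
    have : 2 ^+ 2 <= a ^+ 2 by apply: lerXn2r; rewrite ?nnegrE// ltW.
    have : 2 ^+ 3 <= p ^+ 3 by apply: lerXn2r; rewrite ?nnegrE// ltW.
    move: K2; rewrite /x; move: (p ^+ 3) (a ^+ 2) => u v q1 u8 v4.
    have : 8 * 4 <= u * v by apply: ler_pM => //; lra.
    lra.
  have pe : p * p ^+ 3 <= expR (4 * p).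
    rewrite -exprS expRM_natl; apply: lerXn2r; rewrite ?nnegrE ?expR_ge0 ?(ltW p0)//.
    by apply: le_trans (expR_ge1Dx p); lra.
  (* s K <= 24 p / eps + 1, and the powers of p are put into exp (4 p). *)
  have ee : s * K%:R * (p / 2) + 4 * p <= 14 / eps * p ^+ 2.
    apply: (@le_trans _ _ ((24 * p * a + 1) * (p / 2) + 4 * p)).
      by rewrite lerD2r ler_wpM2r//; lra.
    rewrite -/a; have : 2 * (p * p) <= a * (p * p) by rewrite ler_wpM2r// mulr_ge0// ltW.
    have : 2 * p <= p * p by rewrite ler_wpM2r// ltW.
    lra.
  apply: (@le_trans _ _ (p * expR (s * K%:R * (p / 2)) * (3500 * a ^+ 2 * p ^+ 3))).
    by apply: ler_wpM2l => //; apply: mulr_ge0; [exact: ltW|exact: expR_ge0].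
  have -> : p * expR (s * K%:R * (p / 2)) * (3500 * a ^+ 2 * p ^+ 3) =
     3500 * a ^+ 2 * (expR (s * K%:R * (p / 2)) * (p * p ^+ 3)) by ring.
  have -> : 3500 / eps ^+ 2 = 3500 * a ^+ 2 by rewrite exprVn.
  apply: ler_wpM2l; first exact: (mulr_ge0 (ler0n R 3500) (sqr_ge0 a)).
  apply: (@le_trans _ _ (expR (s * K%:R * (p / 2)) * expR (4 * p))).
    by rewrite ler_wpM2l// expR_ge0.
  by rewrite -expRD ler_expR.
have t4 := ler_wpM2r eta0 t3.
lra.
Qed.

(** * Asymptotics *)

Lemma near_powR_ge (R : realType) (c A : R) : 0 < c ->
  \forall m \near \oo, A <= m%:R `^ c.
Proof.
move=> c0; have := nbhs_infty_ger (`|A| `^ c^-1); apply: filterS => m mA.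
apply: (le_trans (ler_norm A)).
rewrite (_ : `|A| = (`|A| `^ c^-1) `^ c); last first.
  by rewrite -powRrM mulVf ?powRr1// gt_eqF.
by apply: ge0_ler_powR; rewrite ?nnegrE ?powR_ge0// ltW.
Qed.

Lemma ln_le_powR (R : realType) (c x : R) : 0 < c -> 0 < x -> ln x <= x `^ c / c.
Proof.
move=> c0 x0; rewrite ler_pdivlMr// mulrC -ln_powR.
have y0 : 0 < x `^ c by exact: powR_gt0.
rewrite -[leRHS](lnK (x := x `^ c)) ?posrE//.
by apply: le_trans (expR_ge1Dx _); rewrite lerDr.
Qed.

Definition letters (R : realType) (m : nat) : R := (2 * m)%N%:R.
(** The number of relators divided by the number of words, times the number of words
with a prescribed third letter, up to lower order. *)
Definition corner_degree (R : realType) (m : nat) (d : R) : R :=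
  (relator_count m d)%:R / #|reduced_words m|%:R * (letters R m * letters R m).
(** Writing b for this exponent and n for the number of letters, the relative
discrepancy n^(- b) makes eta^3 D of the order of n^(3 d - 1 - 3 b) = n^(3 b), a
positive power of n for d > 1/3. *)
Definition decay_exponent (R : realType) (d : R) : R := (3 * d - 1) / 6.
Definition discrepancy (R : realType) (m : nat) (d : R) : R :=
  letters R m `^ (- decay_exponent d).

Lemma relator_count_bounds (R : realType) (m : nat) (d : R) :
  3^-1 < d < 1 -> (1 <= m)%N -> 8 <= letters R m ->
  letters R m `^ (3 * d) / 16 <= (relator_count m d)%:R <= 2 * letters R m `^ (3 * d).
Proof.
move=> /andP[d1 d2] m1; set n := letters R m => n8.
have nE : n = 2 * m%:R by rewrite /n /letters natrM.
have n0 : 0 < n by lra.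
set X := (2 * m%:R - 1) `^ (3 * d).
have X0 : 0 <= X by exact: powR_ge0.
have X1 : X <= n `^ (3 * d).
  by apply: ge0_ler_powR; rewrite ?nnegrE -?nE; lra.
have n3d : 8 <= n `^ (3 * d).
  by apply: (le_trans n8); apply: le1r_powR; lra.
have X2 : n `^ (3 * d) / 8 <= X.
  apply: (@le_trans _ _ ((n / 2) `^ (3 * d))).
    rewrite powRM ?invr_ge0 ?(ltW n0)//; apply: ler_wpM2l; first exact: powR_ge0.
    rewrite (_ : 8^-1 = 2^-1 `^ 3); last by rewrite powR_mulrn ?invr_ge0//; field.
    by apply: ger_powR; [apply/andP; split; lra|lra].
  by apply: ge0_ler_powR; rewrite ?nnegrE -?nE; lra.
have Xh : 0 <= X + 2^-1 by lra.
have /andP[h1 h2] : (relator_count m d)%:R <= X + 2^-1 < (relator_count m d).+1%:R.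
  exact: truncn_itv Xh.
have {}h2 : X + 2^-1 < (relator_count m d)%:R + 1 by rewrite natr1.
by apply/andP; split; lra.
Qed.

(** With n letters, there are about n^3 words and n^(3 d) relators, so that D is about
n^(3 d - 1); all the estimates are comparisons of powers of n. *)
Lemma degree_conditions (R : realType) (m : nat) (d : R) :
  3^-1 < d < 1 -> (1 <= m)%N -> 8 <= letters R m ->
  4 <= letters R m `^ (3 - 3 * d) ->
  6 <= letters R m `^ (1 - decay_exponent d) ->
  4096 / decay_exponent d <= letters R m `^ (2 * decay_exponent d) ->
  [/\ (0 < relator_count m d <= #|reduced_words m|)%N,
      0 < corner_degree m d, 0 < discrepancy m d <= 1,
      6 / letters R m <= discrepancy m d
    & 128 * (2 * ln (letters R m)) <= discrepancy m d ^+ 3 * corner_degree m d].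
Proof.
move=> dd m1; set n := letters R m => n8 h3 h4 h5.
have /andP[N1 N2] := relator_count_bounds dd m1 n8; have /andP[d1 d2] := dd.
rewrite -/n in N1 N2; set b := decay_exponent d in h4 h5 *.
have b0 : 0 < b by rewrite /b /decay_exponent; lra.
have n0 : 0 < n by lra.
have n3d0 : 0 < n `^ (3 * d) by exact: powR_gt0.
have Npos : 0 < (relator_count m d)%:R :> R by apply: lt_le_trans N1; lra.
have W1 : n ^+ 3 / 2 <= #|reduced_words m|%:R.
  have := card_reduced_words_ge m; rewrite -(ler_nat R) natrD natrM !natrX -/(letters R m) -/n.
  have : 8 * n ^+ 2 <= n * n ^+ 2 by rewrite ler_wpM2r// sqr_ge0.
  have : 0 <= n ^+ 3 by rewrite exprn_ge0// ltW.
  rewrite -exprS; lra.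
have W2 : #|reduced_words m|%:R <= n ^+ 3.
  by have := card_reduced_words_le m; rewrite -(ler_nat R) natrX.
have n33 : n ^+ 3 = n `^ (3 * d) * n `^ (3 - 3 * d).
  rewrite -powRD; last by apply/implyP => _; rewrite gt_eqF.
  by rewrite subrKC powR_mulrn// ltW.
have NW : (relator_count m d)%:R <= #|reduced_words m|%:R :> R.
  apply: le_trans N2 _; apply: le_trans W1.
  have := ler_wpM2l (ltW n3d0) h3; rewrite -n33; lra.
have W0 : 0 < #|reduced_words m|%:R :> R by exact: lt_le_trans NW.
have D0 : 0 < corner_degree m d.
  by rewrite /corner_degree -/n; apply: mulr_gt0; [exact: divr_gt0|exact: mulr_gt0].
have eE k : discrepancy m d ^+ k = n `^ (- (b * k%:R)).
  by rewrite /discrepancy -powR_mulrn ?powR_ge0// -powRrM mulNr.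
have e0 : 0 < discrepancy m d by exact: powR_gt0.
split => //.
- by rewrite -(ltr0n R) Npos -(ler_nat R).
- rewrite e0 /discrepancy -/n -/b powRN invf_le1 ?powR_gt0//.
  have n1 : 1 <= n by lra.
  have := ler_powR n1 (ltW b0); rewrite powRr0; exact.
- rewrite ler_pdivrMr// /discrepancy -/n -/b.
  apply: le_trans h4 _; rewrite addrC powRD; last by apply/implyP => _; rewrite gt_eqF.
  by rewrite powRr1// ltW.
have Dlo : n `^ (3 * d - 1) / 16 <= corner_degree m d.
  rewrite powRB; last by apply/implyP => _; rewrite gt_eqF.
  rewrite powRr1 ?(ltW n0)// /corner_degree -/n.
  apply: (@le_trans _ _ ((relator_count m d)%:R / n)).
    by rewrite mulrAC ler_wpM2r// invr_ge0 ltW.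
  rewrite -mulrA; apply: ler_wpM2l; first exact: ltW.
  rewrite ler_pdivlMl// ler_pdivrMr//.
  by rewrite (_ : n * n * n = n ^+ 3)//; ring.
rewrite eE; apply: (@le_trans _ _ (n `^ (- (b * 3)) * (n `^ (3 * d - 1) / 16))); last first.
  by rewrite ler_wpM2l// powR_ge0.
rewrite [leRHS]mulrA -powRD; last by apply/implyP => _; rewrite gt_eqF.
rewrite (_ : - (b * 3) + (3 * d - 1) = b + 2 * b); last first.
  by rewrite /b /decay_exponent; field.
rewrite powRD; last by apply/implyP => _; rewrite gt_eqF.
have := ler_wpM2l (powR_ge0 n b) h5; have := ln_le_powR b0 n0.
rewrite (_ : n `^ b * (4096 / b) = 4096 * (n `^ b / b)); last by field; rewrite gt_eqF.
lra.
Qed.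

Lemma near_degree_conditions (R : realType) (d : R) : 3^-1 < d < 1 ->
  \forall m \near \oo, (8 <= m)%N /\
    [/\ (0 < relator_count m d <= #|reduced_words m|)%N,
      0 < corner_degree m d, 0 < discrepancy m d <= 1,
      6 / letters R m <= discrepancy m d
    & 128 * (2 * ln (letters R m)) <= discrepancy m d ^+ 3 * corner_degree m d].
Proof.
move=> dd; have /andP[d1 d2] := dd.
have b0 : 0 < decay_exponent d by rewrite /decay_exponent; lra.
have h3 : 0 < 3 - 3 * d by lra.
have h4 : 0 < 1 - decay_exponent d by rewrite /decay_exponent; lra.
have h5 : 0 < 2 * decay_exponent d by lra.
near=> m.
have m8 : (8 <= m)%N by near: m; exists 8%N.
have mono (c : R) : 0 < c -> m%:R `^ c <= letters R m `^ c.
  move=> c0; apply: ge0_ler_powR; rewrite ?nnegrE ?(ltW c0)//.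
  by rewrite ler_nat leq_pmull.
split => //; apply: degree_conditions => //.
- exact: leq_trans m8.
- by rewrite ler_nat; apply: leq_trans m8 _; rewrite leq_pmull.
- by apply: le_trans (mono _ h3); near: m; exact: near_powR_ge.
- by apply: le_trans (mono _ h4); near: m; exact: near_powR_ge.
- by apply: le_trans (mono _ h5); near: m; exact: near_powR_ge.
Unshelve. all: by end_near. Qed.

(** Apply [bad_relators_le] with L = 2 log n, so that the bad draws have probability at
most 10 / n. *)
Lemma aas_of_good_draw (R : realType) (d : R) (P : nat -> groupType -> Prop) :
  3^-1 < d < 1 ->
  (\forall m \near \oo, forall E : {set 3.-tuple (letter 'I_m)},
     good_draw (@corner_source 'I_m) (@letter2 _) (@letter3 _)
       (corner_degree m d) (discrepancy m d) E -> P m (random_group E)) ->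
  aas d P.
Proof.
move=> dd good; rewrite /aas.
have lim1 : (1 - 10 * harmonic m) @[m --> \oo] --> (1 - 10 * 0 : R).
  by apply: cvgB; [exact: cvg_cst|apply: cvgMl_tmp; exact: cvg_harmonic].
rewrite mulr0 subr0 in lim1.
apply: (@squeeze_cvgr _ _ _ _ (fun m => 1 - 10 * harmonic m) (fun=> 1));
  [|exact: lim1|exact: cvg_cst].
near=> m.
have [m8 [NW D0 e01 ne LD]] : (8 <= m)%N /\
    [/\ (0 < relator_count m d <= #|reduced_words m|)%N,
      0 < corner_degree m d, 0 < discrepancy m d <= 1,
      6 / letters R m <= discrepancy m d
    & 128 * (2 * ln (letters R m)) <= discrepancy m d ^+ 3 * corner_degree m d].
  by near: m; exact: near_degree_conditions.
have goodm : forall E : {set 3.-tuple (letter 'I_m)},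
     good_draw (@corner_source 'I_m) (@letter2 _) (@letter3 _)
       (corner_degree m d) (discrepancy m d) E -> P m (random_group E) by near: m.
have n8 : 8 <= letters R m by rewrite ler_nat; apply: leq_trans m8 _; rewrite leq_pmull.
set n := letters R m in n8 ne LD.
have n0 : 0 < n by lra.
have nz : n * expR (- (2 * ln n)) = n^-1.
  rewrite expRN expRM_natl lnK; last by rewrite posrE.
  by rewrite expr2 invfM mulrA mulfV ?gt_eqF// mul1r.
have ln0 : 0 <= 2 * ln n by rewrite mulr_ge0// ln_ge0//; lra.
have nh : n^-1 <= 2^-1 by rewrite lef_pV2 ?posrE//; lra.
have bad := bad_relators_le NW erefl ln0 e01 ne LD; rewrite -/n nz in bad.
have {}bad := bad nh.
have relE : relator_sets m d = draws (reduced_words m) (relator_count m d) by [].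
have d0 : 0 < #|draws (reduced_words m) (relator_count m d)|%:R :> R.
  by rewrite ltr0n cards_draws bin_gt0; case/andP: NW.
rewrite /triangular_prob relE; set DD := draws _ _ in bad d0 *.
set Bad := [set _ | _]%SET in bad; set Good := [set _ | _]%SET.
have tot : (#|DD| <= #|Good| + #|Bad|)%N.
  apply: (@leq_trans #|Good :|: Bad|); last by rewrite cardsU leq_subr.
  apply: subset_leq_card; apply/fintype.subsetP => E ED; apply/finset.setUP.
  have [g|g] := boolP `[< good_draw (@corner_source 'I_m) (@letter2 _) (@letter3 _)
       (corner_degree m d) (discrepancy m d) E >]; [left|right].
    rewrite /Good finset.in_set; apply/andP; split; first exact: ED.
    by apply/asboolP/goodm/asboolP.
  by rewrite /Bad finset.in_set; apply/andP; split; first exact: ED.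
have gd : (#|Good| <= #|DD|)%N.
  by apply: subset_leq_card; apply/fintype.subsetP => E; rewrite inE => /andP[].
apply/andP; split; last by rewrite ler_pdivrMr// mul1r ler_nat.
rewrite ler_pdivlMr//.
have hn : n^-1 <= harmonic m.
  rewrite lef_pV2 ?posrE// ler_nat -addn1 mul2n -addnn leq_add2l.
  exact: leq_trans m8.
have := ler_wpM2l (ltW d0) hn.
move: tot; rewrite -(ler_nat R) natrD; lra.
Unshelve. all: by end_near. Qed.

(** Where p^2 <= log m / log log m, the factor exp (14 p^2 / eps) is at most
m^(b / 2), since log log m is eventually large; the discrepancy is at most
m^(- b), and this product tends to zero. *)
Lemma near_defect_small (R : realType) (d eps : R) : 3^-1 < d < 1 -> 0 < eps <= 2^-1 ->
  \forall m \near \oo, forall p, 2 <= p -> p <= Num.sqrt (ln m%:R / ln (ln m%:R)) ->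
    exists s, exists2 K, 0 < s &
      (1 + discrepancy m d) * (2 - 2 * eps) < 2 - poincare_defect (discrepancy m d) p s K.
Proof.
move=> /andP[d1 d2] eps01; have /andP[eps0 eps1] := eps01.
pose b := decay_exponent d; have b0 : 0 < b by rewrite /b /decay_exponent; lra.
have b2 : 0 < b / 2 by lra.
have [c1 [c1E c1pos]] : exists c1, c1 = 3500 / eps ^+ 2 /\ 0 < c1.
  eexists; split; first reflexivity.
  exact: (divr_gt0 (ltr0Sn R 3499) (exprn_gt0 2 eps0)).
have [c2 [c2E c2pos]] : exists c2, c2 = 14 / eps /\ 0 < c2.
  by eexists; split; [reflexivity|exact: (divr_gt0 (ltr0Sn R 13) eps0)].
near=> m => p p2 pr.
have m3 : expR (expR (2 * c2 / b)) <= m%:R by near: m; exact: nbhs_infty_ger.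
have m0 : 0 < m%:R :> R by apply: lt_le_trans m3; exact: expR_gt0.
have l1 : expR (2 * c2 / b) <= ln m%:R by rewrite -ler_expR lnK.
have l0 : 0 < ln (m%:R : R) by apply: lt_le_trans l1; exact: expR_gt0.
have ll : 2 * c2 / b <= ln (ln m%:R) by rewrite -ler_expR lnK.
have cb0 : 0 < 2 * c2 / b by rewrite divr_gt0// mulr_gt0.
have ll0 : 0 < ln (ln (m%:R : R)) by exact: lt_le_trans ll.
have pp : p ^+ 2 <= ln m%:R / ln (ln m%:R).
  rewrite -[leRHS]sqr_sqrtr; last by rewrite divr_ge0// ltW.
  by apply: lerXn2r; rewrite ?nnegrE ?sqrtr_ge0//; lra.
have c2p : c2 * p ^+ 2 <= b / 2 * ln m%:R.
  apply: le_trans (ler_wpM2l (ltW c2pos) pp) _.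
  rewrite mulrA ler_pdivrMr//.
  have := ler_wpM2l (mulr_ge0 (ltW b2) (ltW l0)) ll.
  by rewrite (_ : b / 2 * ln m%:R * (2 * c2 / b) = c2 * ln m%:R)//; field; rewrite gt_eqF.
have ex : expR (c2 * p ^+ 2) <= m%:R `^ (b / 2).
  by rewrite /powR gt_eqF// ler_expR.
set eta := discrepancy m d.
have eta0 : 0 <= eta by exact: powR_ge0.
have etam : eta <= (m%:R `^ b)^-1.
  rewrite /eta /discrepancy powRN lef_pV2 ?posrE ?powR_gt0//; last first.
    by rewrite /letters ltr0n muln_gt0 /= -(ltr0n R).
  by apply: ge0_ler_powR; rewrite ?nnegrE ?(ltW b0)// ler_nat leq_pmull.
have mb : 16 / eps <= m%:R `^ b by near: m; exact: near_powR_ge.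
have mb2 : c1 / eps <= m%:R `^ (b / 2) by near: m; exact: near_powR_ge.
have e1 : eta <= eps / 16.
  apply: le_trans etam _; rewrite -[leRHS]invrK invf_div lef_pV2 ?posrE ?powR_gt0//.
  by rewrite divr_gt0.
have e2 : c1 * expR (c2 * p ^+ 2) * eta <= eps.
  apply: (@le_trans _ _ (c1 * m%:R `^ (b / 2) * (m%:R `^ b)^-1)).
    by apply: ler_pM; rewrite ?mulr_ge0 ?expR_ge0 ?(ltW c1pos)// ler_wpM2l// ltW.
  have -> : m%:R `^ b = m%:R `^ (b / 2) * m%:R `^ (b / 2).
    rewrite -powRD; first by rewrite -splitr.
    by apply/implyP => _; rewrite gt_eqF.
  have mp : 0 < m%:R `^ (b / 2) :> R by exact: powR_gt0.
  move: mb2 mp; move: (m%:R `^ (b / 2)) => x mb2 x0.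
  rewrite (_ : c1 * x / (x * x) = c1 / x); last by field; rewrite gt_eqF.
  by rewrite ler_pdivrMr// mulrC -ler_pdivrMr.
have [s [K s0 defect]] := poincare_defect_le p2 eps01 eta0.
exists s, K => //.
rewrite -c1E -c2E in defect.
have ee : 0 <= eta * eps by rewrite mulr_ge0// ltW.
apply: (le_lt_trans _ (y := 2 - 2 * eps + 2 * eta)).
  have -> : (1 + eta) * (2 - 2 * eps) = 2 - 2 * eps + 2 * eta - 2 * (eta * eps) by ring.
  by rewrite gerBl mulr_ge0.
clear -defect e1 e2 eps0; lra.
Unshelve. all: by end_near. Qed.

Theorem corollary1p7 (R : realType) (d : R) (hd : 3^-1 < d < 1) :
  exists2 C : R, 0 < C &
    (forall eps : R, 0 < eps <= 2^-1 ->
       aas d (fun (m : nat) (G : groupType) =>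
         forall (p : R) (p2 : 2 <= p),
           p <= C * Num.sqrt (ln m%:R / ln (ln m%:R)) ->
           FLpL (ge2_ge1 p2) ((2 - 2 * eps) `^ (2 * p)^-1) G))
    /\
    aas d (fun (m : nat) (G : groupType) =>
      forall (p : R) (p2 : 2 <= p),
        p <= C * Num.sqrt (ln m%:R / ln (ln m%:R)) ->
        FLp (ge2_ge1 p2) G).
Proof.
(* Every C would do: in this range exp (O (p^2)) stays below every positive power of m. *)
exists 1 => //.
have main (eps : R) : 0 < eps <= 2^-1 -> \forall m \near \oo,
    forall E : {set 3.-tuple (letter 'I_m)},
     good_draw (@corner_source 'I_m) (@letter2 _) (@letter3 _)
       (corner_degree m d) (discrepancy m d) E ->
     forall (p : R) (p2 : 2 <= p), p <= 1 * Num.sqrt (ln m%:R / ln (ln m%:R)) ->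
       FLpL (ge2_ge1 p2) ((2 - 2 * eps) `^ (2 * p)^-1) (random_group E)
       /\ FLp (ge2_ge1 p2) (random_group E).
  move=> eps01.
  have := near_defect_small hd eps01; have := near_degree_conditions hd.
  apply: filterS2 => m [_ [_ D0 /andP[e0 e1] _ _]] small E good p p2 pr.
  rewrite mul1r in pr; have [s [K s0 gap]] := small p p2 pr.
  by apply: good_relators_FLp good D0 _ s0 eps01 gap; rewrite (ltW e0).
split.
  move=> eps eps01; apply: aas_of_good_draw => //.
  apply: filterS (main eps eps01) => m h E good p p2 pr.
  by have [] := h E good p p2 pr.
(* The bound for eps = 1/2 also covers L^p itself. *)
have half : 0 < (2^-1 : R) <= 2^-1 by rewrite invr_gt0 ltr0n lexx.
apply: aas_of_good_draw => //.
apply: filterS (main 2^-1 half) => m h E good p p2 pr.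
by have [] := h E good p p2 pr.
Qed.
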